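(* Let $\alpha\in(0,1)$ and $C_0>0$ be constants. There exist constants $\gamma',c>0$ such that the following is true for every $\gamma\in(0,\gamma')$ and every large enough integer $n$. Let $G=(V,E)$ be a graph on $n$ vertices such that the following properties hold: (1) There is a partition $V=V_1\cup V_2$ with $|V_2|=500\lfloor\gamma n\rfloor$. (2) There are a vertex $x^\ast$ and disjoint sets $R^\ast,S^\ast\subset V_1$ such that: (a) $|S^\ast|=\lfloor 25C_0\log(n)\rfloor$ and $S^\ast\subset N_G(x^\ast)$; (b) $|R^\ast|\le 25$ and for each $v\in R^\ast$ that is not adjacent to $x^\ast$ there is a vertex $s_v\in S^\ast$ adjacent to $v$, such that $s_v\neq s_w$ whenever $v\neq w$; (c) for all $w\in V\setminus(R^\ast\cup S^\ast)$ we have $d_G(w,S^\ast)\ge 2C_0\log(n)$. (3) For every $v\in V$ there are at most $\log(n)$ vertices $w\in V$ such that $|N_G(v)\cap N_G(w)\cap V_1|<\alpha n$. (4) Between every two disjoint sets $A\subset V_1$ and $B\subset V$, each of size $\lfloor C_0\log(n)\rfloor$, there is an edge of $G$. (5) In $G[V_2]$ there is a collection $\mathcal{K}$ of $100\lfloor\gamma n\rfloor$ vertex-disjoint copies of $K_5$ such that: (a) there is a partition $\mathcal{K}=\mathcal{K}_{good}\cup\mathcal{K}_{bad}$ with $|\mathcal{K}_{bad}|=\lfloor\gamma n\rfloor$; (b) every vertex $v\in V$ which is not in a clique of $\mathcal{K}_{good}$ satisfies $d_G(v,V_2)\ge 40\lfloor\gamma n\rfloor$; (c) for every clique $K\in\mathcal{K}_{good}$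 there are at most $\gamma n$ cliques $K'\in\mathcal{K}_{good}$ such that $G$ has no matching of size $3$ between $V(K)$ and $V(K')$. Then $G$ contains a copy of every tree $T$ on $n$ vertices with maximum degree $\Delta(T)\le\frac{cn}{\log(n)}$.
   Context: For a graph $G$, a vertex $v$ and a set $A\subset V(G)$, $N_G(v)$ is the neighborhood of $v$ and $d_G(v,A)=|N_G(v)\cap A|$. $G[V_2]$ denotes the subgraph induced by $V_2$. A matching between $V(K)$ and $V(K')$ means a set of pairwise disjoint edges of $G$ each having one endpoint in $V(K)$ and one in $V(K')$. $\log$ is the natural logarithm. *)

(* Defs.v *)
From mathcomp Require Import all_boot all_order all_algebra.
From mathcomp Require Import reals exp.

Set Implicit Arguments.
Unset Strict Implicit.
Unset Printing Implicit Defensive.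

Definition simple_graph (T : finType) (e : rel T) : Prop :=
  symmetric e /\ irreflexive e.

Definition nbhd (T : finType) (e : rel T) (v : T) : {set T} :=
  [set w | e v w].

Definition deg_in (T : finType) (e : rel T) (v : T) (A : {set T}) : nat :=
  #|nbhd e v :&: A|.

Definition max_degree (T : finType) (e : rel T) : nat :=
  \max_(v : T) #|nbhd e v|.

(* A closed walk of size 2 runs back and forth along one edge, so cycles are
   the duplicate-free closed walks of size at least 3. *)
Definition acyclic (T : finType) (e : rel T) : Prop :=
  forall p : seq T, ucycle e p -> size p <= 2.

Definition connected_graph (T : finType) (e : rel T) : Prop :=
  forall u v : T, connect e u v.

Definition tree (T : finType) (e : rel T) : Prop :=
  [/\ simple_graph e, connected_graph e & acyclic e].

Definition contains_copy (T U : finType) (e : rel T) (t : rel U) : Prop :=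
  exists f : U -> T,
    injective f /\ (forall u v : U, t u v -> e (f u) (f v)).

(* The vertex sets of the copies of K_k; a copy is determined by its set. *)
Definition is_clique (T : finType) (e : rel T) (k : nat) (K : {set T}) : bool :=
  (#|K| == k) && [forall u in K, forall v in K, (u != v) ==> e u v].

(* Edges are represented by their sets of endpoints. A and B may overlap. *)
Definition is_matching_between (T : finType) (e : rel T) (A B : {set T})
    (M : {set {set T}}) : bool :=
  trivIset M &&
  [forall E in M, exists a in A, exists b in B, e a b && (E == [set a; b])].

Definition has_matching (T : finType) (e : rel T) (k : nat)
    (A B : {set T}) : bool :=
  [exists M : {set {set T}}, is_matching_between e A B M && (#|M| == k)].

(* Main.v *)
(* Proof idea.  Fix a small constant eps depending on alpha and C0.

   If T has at least eps n leaves, remove (almost) all of them and embed the rest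
   of T by a Friedman-Pippenger type extension argument: (3) gives small sets
   linear neighbourhoods, (4) makes larger sets expand almost completely, and
   vertices placed outside the target set of the expansion never hurt, so a
   few vertices of T may be placed at will.  The leaves are put back by Hall's theorem, which
   applies once every uncovered vertex has C0 log n neighbours among the images of
   the leaf parents and every such image has linear degree into a reserved random
   set.  The first requirement is met with x*, S*, R* if some vertex of T has
   many leaf parents as neighbours; otherwise O(log n) leaf parents
   are embedded greedily, decreasing the potential
   sum_w 2^-hits(w) (1 - 1/b)^misses(w), with the exceptional sets of (3) of their
   parents kept pairwise disjoint.

   If T has fewer than eps n leaves, it contains linearly many disjoint bare paths of
   a constant length q.  Remove their interiors, embed the remaining small forest
   greedily in V1 and join the ends of the bare paths through V1 by (4), until
   floor(gamma n) vertices of V1 are left.  Each of them is absorbed by a bare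
   path of the form  V1 - 49 good cliques - vertex - 49 good cliques - V1,  while
   2 floor(gamma n) further bare paths swallow one clique each.  The end cliques of
   the chains are prescribed; the chains are filled by one long greedy path in the
   dense link graph on the good cliques, cut into pieces that are joined to the
   end cliques by Hall's theorem. *)

Require Import Defs.
From mathcomp Require Import all_boot all_order all_algebra.
From mathcomp Require Import reals sequences exp.
From mathcomp Require Import zify ring lra.

Set Implicit Arguments.
Unset Strict Implicit.
Unset Printing Implicit Defensive.

(** * Finite functions and Hall's theorem *)

(** Edges between disjoint sets are guaranteed by (4) only at sizes of order [log n], so a greedy
    embedding cannot use up the last vertices; both cases are about covering those. With many
    leaves, the danger is a hole [w] with few neighbours among the images of leaf parents. A leaf
    parent cannot be steered towards [w] only if the image of its own parent has few common
    neighbours with [w]. Since the exceptional sets of these images are disjoint, this happens at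
    the children of at most one tree vertex, and outside the star case these are [O(log n)] many.
    With few leaves, the holes are known only after the connecting paths are built, while those
    paths must already end at the chains. So the end cliques and end vertices are fixed beforehand,
    and the cliques next to the hole are chosen afterwards. With [N = floor(gamma n)], the chains
    use [98 * N] of the [99 * N] good cliques, and the remaining [N] good and [N] bad cliques are
    the ones swallowed singly. *)

Definition fupdate (A : eqType) (B : Type) (f : A -> B) (a : A) (b : B) : A -> B :=
  fun x => if x == a then b else f x.

Lemma fupdate_eq (A : eqType) (B : Type) (f : A -> B) a b : fupdate f a b a = b.
Proof. by rewrite /fupdate eqxx. Qed.

Lemma fupdate_neq (A : eqType) (B : Type) (f : A -> B) a b x :
  x != a -> fupdate f a b x = f x.
Proof. by rewrite /fupdate => /negbTE ->. Qed.

Lemma imset_fupdate (A B : finType) (f : A -> B) a b (S : {set A}) :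
  a \notin S -> fupdate f a b @: (a |: S) = b |: f @: S.
Proof.
move=> aS; rewrite imsetU1 fupdate_eq; congr (_ |: _).
by apply: eq_in_imset => x xS; rewrite fupdate_neq //; apply: contraNneq aS => <-.
Qed.

Lemma inj_fupdate (A B : finType) (f : A -> B) a b (S : {set A}) :
  a \notin S -> b \notin f @: S -> {in S &, injective f} ->
  {in a |: S &, injective (fupdate f a b)}.
Proof.
move=> aS bS finj x y; rewrite !inE.
case: (eqVneq x a) => [-> _|xa /= xS]; case: (eqVneq y a) => [-> _ //|ya /= yS].
- rewrite fupdate_eq fupdate_neq // => e; case/imsetP: bS; by exists y.
- rewrite fupdate_eq fupdate_neq // => e; case/imsetP: bS; by exists x.
- by rewrite !fupdate_neq //; apply: finj.
Qed.

Lemma subset_of_card (T : finType) (A : {set T}) k :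
  k <= #|A| -> exists B : {set T}, B \subset A /\ #|B| = k.
Proof.
move=> kA; exists [set x in take k (enum A)]; split.
  by apply/subsetP => x; rewrite inE => /mem_take; rewrite mem_enum.
rewrite cardsE; move/card_uniqP: (take_uniq k (enum_uniq (mem A))) => ->.
by rewrite size_take -cardE; case: ltngtP kA.
Qed.

Lemma card_gt0_ex (T : finType) (A : {set T}) : 0 < #|A| -> exists x, x \in A.
Proof. by rewrite card_gt0 => /set0Pn. Qed.

Lemma card_bigcup_leq (I T : finType) (P : pred I) (F : I -> {set T}) :
  #|\bigcup_(i | P i) F i| <= \sum_(i | P i) #|F i|.
Proof.
elim/big_rec2: _ => [|i n A _ le]; first by rewrite cards0.
apply: (leq_trans (leq_card_setU _ _)); by rewrite leq_add2l.
Qed.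

(* The Halmos-Vaughan induction; tight subfamilies are split off. *)
Lemma hall (I T : finType) (t0 : T) (J : {set I}) (S : I -> {set T}) :
  (forall K : {set I}, K \subset J -> #|K| <= #|\bigcup_(i in K) S i|) ->
  exists f : I -> T, {in J &, injective f} /\ {in J, forall i, f i \in S i}.
Proof.
elim: {J}#|J| {-2}J (leqnn #|J|) S => [|n IH] J Jn S hS.
  have J0 : J = set0 by apply/eqP; rewrite -cards_eq0 -leqn0.
  by exists (fun=> t0); rewrite J0; split=> i; rewrite inE.
have [tight|loose] := boolP [exists K : {set I},
    [&& K \proper J, K != set0 & #|\bigcup_(i in K) S i| <= #|K|]].
  case/existsP: tight => K /and3P[KJ K0 tK].
  have KsJ := proper_sub KJ.
  have ltKJ := proper_card KJ.
  have [f1 [f1i f1S]] : exists f : I -> T, {in K &, injective f} /\ {in K, forall i, f i \in S i}.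
    apply: IH; first by lia.
    by move=> K' K'K; apply: hS; apply: subset_trans KsJ.
  set U := \bigcup_(i in K) S i in tK.
  have [f2 [f2i f2S]] : exists f : I -> T, {in J :\: K &, injective f} /\
      {in J :\: K, forall i, f i \in S i :\: U}.
    apply: IH.
      have := cardsID K J; rewrite (setIidPr KsJ) => ?.
      have : 0 < #|K| by rewrite card_gt0. lia.
    move=> K' K'J.
    have dKK : [disjoint K & K'].
      rewrite disjoint_sym; apply: disjointWl K'J _.
      by rewrite -setI_eq0 setDE -setIA (setIC _ K) setICr setI0.
    have := hS (K :|: K').
    rewrite subUset KsJ (subset_trans K'J) ?subsetDl // => /(_ isT).
    rewrite cardsU disjoint_setI0 // cards0 subn0 bigcup_setU -/U => h.
    have e : \bigcup_(i in K') (S i :\: U) = (\bigcup_(i in K') S i) :\: U.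
      apply/setP => x; rewrite inE; apply/bigcupP/andP.
        by case=> i iK; rewrite inE => /andP[-> xS]; split=> //; apply/bigcupP; exists i.
      by case=> xU /bigcupP[i iK xS]; exists i => //; rewrite inE xU.
    rewrite e; have := cardsUI U (\bigcup_(i in K') S i).
    have := cardsID U (\bigcup_(i in K') S i); rewrite setIC. lia.
  exists (fun i => if i \in K then f1 i else f2 i); split.
    move=> i j iJ jJ.
    case: ifP => iK; case: ifP => jK.
    - exact: f1i.
    - move=> e; have := f2S j; rewrite !inE jK jJ -e => /(_ isT) /andP[/negP[]].
      by apply/bigcupP; exists i => //; apply: f1S.
    - move=> e; have := f2S i; rewrite !inE iK iJ e => /(_ isT) /andP[/negP[]].
      by apply/bigcupP; exists j => //; apply: f1S.
    - by apply: f2i; rewrite inE ?iK ?jK.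
  move=> i iJ; case: ifP => iK; first exact: f1S.
  by have := f2S i; rewrite !inE iK iJ => /(_ isT) /andP[].
have [J0|/set0Pn[i0 i0J]] := eqVneq J set0.
  by exists (fun=> t0); rewrite J0; split=> i; rewrite inE.
have [t tS] : exists t, t \in S i0.
  apply: card_gt0_ex; have := hS [set i0]; rewrite sub1set cards1 big_set1.
  by apply.
have [f [fi fS]] : exists f : I -> T, {in J :\ i0 &, injective f} /\
    {in J :\ i0, forall i, f i \in S i :\ t}.
  apply: IH; first by move: Jn; rewrite (cardsD1 i0) i0J.
  move=> K KJ; have [->|K0] := eqVneq K set0; first by rewrite cards0.
  have KpJ : K \proper J by apply: sub_proper_trans KJ _; apply: properD1.
  move: loose; rewrite negb_exists => /forallP /(_ K); rewrite KpJ K0 /= -ltnNge => h.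
  have e : \bigcup_(i in K) (S i :\ t) = (\bigcup_(i in K) S i) :\ t.
    apply/setP => x; rewrite in_setD1; apply/bigcupP/andP.
      by case=> i iK; rewrite in_setD1 => /andP[-> xS]; split=> //; apply/bigcupP; exists i.
    by case=> xU /bigcupP[i iK xS]; exists i => //; rewrite in_setD1 xU.
  rewrite e; move: h; rewrite (cardsD1 t (\bigcup_(i in K) S i)). lia.
exists (fupdate f i0 t); rewrite -(setD1K i0J); split.
  apply: inj_fupdate => //; rewrite ?setD11 //.
  by apply/imsetP => -[j jJ e]; have := fS j jJ; rewrite -e !inE eqxx.
move=> i; rewrite in_setU1; case: (eqVneq i i0) => [-> _|ne /= iJ]; first by rewrite fupdate_eq.
by move: (fS _ iJ); rewrite fupdate_neq // inE => /andP[].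
Qed.

(** * Random subsets *)

(* The exponential-moment bound: [sum_f prod_(v in A) 2 ^ [f v != j]] factors over [v]. *)
Lemma card_few_in_fiber (V : finType) m (A : {set V}) (j : 'I_m) k :
  #|[set f : {ffun V -> 'I_m} | #|[set v in A | f v == j]| <= k]| * 2 ^ (#|A| - k)
  <= (2 * m).-1 ^ #|A| * m ^ (#|V| - #|A|).
Proof.
pose w (v : V) (i : 'I_m) := if v \in A then (if i == j then 1 else 2) else 1.
have -> : (2 * m).-1 ^ #|A| * m ^ (#|V| - #|A|) = \prod_v \sum_(i < m) w v i.
  rewrite (bigID (mem A)) /=; congr (_ * _).
    rewrite (eq_bigr (fun=> (2 * m).-1)) ?prod_nat_const // => v vA.
    rewrite /w vA (bigD1 j) //= eqxx (eq_bigr (fun=> 2)); last first.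
      by move=> i /negbTE ->.
    rewrite sum_nat_const (eq_card (B := predC1 j)) // cardC1 card_ord.
    have := ltn_ord j. lia.
  rewrite (eq_bigr (fun=> m)); last first.
    by move=> v /negbTE vA; rewrite /w vA sum_nat_const card_ord muln1.
  rewrite prod_nat_const; congr (_ ^ _).
  by rewrite -(cardC A) addKn; apply: eq_card.
rewrite bigA_distr_bigA /= -sum_nat_const.
rewrite [X in _ <= X](bigID (fun f : {ffun V -> 'I_m} => f \in [set f : {ffun V -> 'I_m} | #|[set
  v in A | f v == j]| <= k])) /=.
apply: leq_trans (leq_addr _ _); apply: leq_sum => f; rewrite inE => fk.
rewrite (bigID (mem A)) /= [X in _ <= _ * X]big1 ?muln1; last first.
  by move=> v /negbTE vA; rewrite /w vA.
rewrite (bigID (fun v => f v == j)) /= big1 ?mul1n; last first.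
  by move=> v /andP[vA fv]; rewrite /w vA fv.
rewrite (eq_bigr (fun=> 2)); last by move=> v /andP[vA /negbTE fv]; rewrite /w vA fv.
rewrite prod_nat_const leq_pexp2l //.
have -> : #|[pred v | (v \in A) && (f v != j)]| = #|A :\: [set v in A | f v == j]|.
  by apply: eq_card => v; rewrite !inE; case: (v \in A); rewrite ?andbT ?andbF.
have := cardsID [set v in A | f v == j] A.
rewrite (setIidPr _); last by apply/subsetP => v; rewrite inE => /andP[].
lia.
Qed.

(** Colour [V] with [m] colours at random. The hypothesis is a union bound over all members of [J]
    and all colours, so some colouring has no poor fibre at all; its smallest fibre can then be
    taken. *)
Lemma random_subset (V I : finType) (A : I -> {set V}) (J : {set I}) a m k :
  0 < m -> k <= a -> (forall i, i \in J -> a <= #|A i|) ->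
  #|J| * m * ((2 * m).-1 ^ a * 2 ^ k) < (2 * m) ^ a ->
  exists Z : {set V}, #|Z| * m <= #|V| /\ (forall i, i \in J -> k < #|A i :&: Z|).
Proof.
move=> m0 ka hA hb.
have [J0|/set0Pn[i0 i0J]] := eqVneq J set0.
  by exists set0; rewrite cards0 J0; split=> // i; rewrite inE.
have aV : a <= #|V| by apply: leq_trans (hA _ i0J) (max_card _).
pose bad (i : I) (j : 'I_m) :=
  [set f : {ffun V -> 'I_m} | #|[set v in A i | f v == j]| <= k].
pose Bad := \bigcup_(i in J) \bigcup_j bad i j.
have badc i j : i \in J -> #|bad i j| * 2 ^ (a - k) <= (2 * m).-1 ^ a * m ^ (#|V| - a).
  move=> iJ; have [B [BA Ba]] := subset_of_card (hA _ iJ).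
  have := card_few_in_fiber B j k; rewrite Ba; apply: leq_trans.
  rewrite leq_mul2r; apply/orP; right; apply/subset_leq_card/subsetP => f; rewrite !inE.
  apply: leq_trans; apply/subset_leq_card/subsetP => v; rewrite !inE.
  by case/andP => /(subsetP BA) -> ->.
have BadC : #|Bad| * 2 ^ (a - k) <= #|J| * m * ((2 * m).-1 ^ a * m ^ (#|V| - a)).
  apply: (@leq_trans (\sum_(i in J) \sum_(j < m) #|bad i j| * 2 ^ (a - k))).
    under eq_bigr do rewrite -big_distrl /=.
    rewrite -big_distrl /= leq_mul2r; apply/orP; right.
    apply: leq_trans (card_bigcup_leq _ _) _.
    by apply: leq_sum => i _; exact: card_bigcup_leq.
  apply: (@leq_trans (\sum_(i in J) \sum_(j < m) (2 * m).-1 ^ a * m ^ (#|V| - a))).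
    by apply: leq_sum => i iJ; apply: leq_sum => j _; apply: badc.
  by rewrite !sum_nat_const card_ord mulnA.
have [f fB] : exists f, f \notin Bad.
  apply/existsP; rewrite -negb_forall; apply/negP => /forallP all.
  have : #|Bad| = m ^ #|V|.
    by rewrite -[X in X ^ _]card_ord -card_ffun; apply: eq_card => f; rewrite all.
  move=> BV; move: BadC; rewrite BV leqNgt => /negP[].
  rewrite -(@ltn_pmul2r (2 ^ k)) ?expn_gt0 // -[X in _ < X]mulnA -expnD subnK //.
  have -> : m ^ #|V| * 2 ^ a = (2 * m) ^ a * m ^ (#|V| - a).
    by rewrite expnMn -mulnA -expnD subnKC // mulnC.
  have -> : #|J| * m * ((2 * m).-1 ^ a * m ^ (#|V| - a)) * 2 ^ k =
     #|J| * m * ((2 * m).-1 ^ a * 2 ^ k) * m ^ (#|V| - a).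
    by rewrite -!mulnA [m ^ _ * 2 ^ k]mulnC.
  by rewrite ltn_pmul2r ?expn_gt0 ?m0.
pose fib (j : 'I_m) := [set v | f v == j].
have [j jm] : exists j, #|fib j| * m <= #|V|.
  apply/existsP; rewrite -[X in is_true X]negbK negb_exists; apply/negP => /forallP all.
  have : \sum_(j < m) #|fib j| = #|V|.
    rewrite -sum1_card (partition_big f predT) //=; apply: eq_bigr => j _.
    by rewrite sum1dep_card; apply: eq_card => v; rewrite inE.
  have : \sum_(j < m) (#|V|.+1) <= \sum_(j < m) #|fib j| * m.
    by apply: leq_sum => j _; move: (all j); rewrite -ltnNge.
  rewrite -big_distrl /= sum_nat_const card_ord => h1 h2; move: h1; rewrite h2.
  by rewrite [X in X <= _]mulnC leq_pmul2r // ltnn.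
exists (fib j); split=> // i iJ; rewrite ltnNge; apply: contra fB => h.
apply/bigcupP; exists i => //; apply/bigcupP; exists j => //; rewrite inE.
by apply: leq_trans h; apply/subset_leq_card/subsetP => v; rewrite !inE.
Qed.

Lemma square_lt_exp2 K : exists x0, forall x, x0 <= x -> K * x.+1 ^ 2 < 2 ^ x.
Proof.
exists (64 * K).+4 => x hx.
pose y := x %/ 4; have xy : 4 * y <= x < 4 * y + 4 by rewrite /y; lia.
have h1 : y.+1 ^ 4 <= 2 ^ x.
  apply: (@leq_trans (2 ^ (y * 4))); last by rewrite leq_pexp2l //; lia.
  by rewrite expnM leq_exp2r //; apply: ltn_expl.
apply: leq_trans h1; have : x.+1 ^ 2 <= 16 * y.+1 ^ 2.
  by rewrite -[16]/(4 ^ 2) -expnMn leq_exp2r //; lia.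
have e : y.+1 ^ 4 = y.+1 ^ 2 * y.+1 ^ 2 by rewrite -expnD.
have : 16 * K < y.+1 ^ 2 by rewrite -mulnn; nia.
rewrite e; nia.
Qed.

(** With [d = 2m - 1], Bernoulli gives [(1 + 1/d)^m >= 1 + m/d > 3/2]. *)
Lemma bernoulli_pow m : 0 < m -> 3 * (2 * m).-1 ^ m <= 2 * (2 * m) ^ m.
Proof.
move=> m0; set d := (2 * m).-1; have -> : 2 * m = d.+1 by rewrite /d; lia.
have bern k : d ^ k * d + k * d ^ k <= d.+1 ^ k * d.
  elim: k => [|k IH]; first by rewrite !expn0; lia.
  rewrite !expnS; nia.
have := bern m; have d0 : 0 < d by rewrite /d; lia.
have : d < 2 * m by rewrite /d; lia.
nia.
Qed.

Lemma leq_expn2r m n e : m <= n -> m ^ e <= n ^ e.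
Proof. by case: e => // e; rewrite leq_exp2r. Qed.

(** A random set of density [1 / m] meets [A i] in about [n / (a * m)] points; falling below an
    eighth of this is exponentially unlikely, which beats [n ^ 2] sets. The square allows for common
    neighbourhoods, indexed by pairs of vertices. *)
Lemma sparse_hitting_subset a m : 0 < a -> 0 < m -> exists n0, forall (V I : finType) (A : I ->
  {set V}) (J : {set I}),
  n0 <= #|V| -> #|J| <= #|V| ^ 2 -> (forall i, i \in J -> #|V| <= #|A i| * a) ->
  exists Z : {set V}, #|Z| * m <= #|V| /\
    (forall i, i \in J -> #|V| <= #|A i :&: Z| * (8 * a * m)).
Proof.
move=> a0 m0; have [x0 hx0] := square_lt_exp2 (16 * a ^ 2 * m ^ 3).
exists (4 * a * m * x0.+1) => V I A J; set n := #|V| => n0n Jn hA.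
pose b := n %/ a; pose x := b %/ (4 * m).
have nb : n < a * b.+1 by rewrite mulnC; apply: ltn_ceil.
have bx : b < 4 * m * x.+1 by rewrite mulnC; apply: ltn_ceil; lia.
have xb : x * (4 * m) <= b by apply: leq_divM.
have x0x : x0 <= x.
  rewrite /x leq_divRL; last lia.
  rewrite /b leq_divRL //. lia.
have key : 4 ^ x * (2 * m).-1 ^ b <= (2 * m) ^ b.
  (* Four rounds of [bernoulli_pow] suffice because [(3/2)^4 = 81/16 >= 4]. Of the gain [4 ^ x], one
     factor [2 ^ x] pays for the exponential moment and the other for the union bound. *)
  have h4 : 4 * (2 * m).-1 ^ (4 * m) <= (2 * m) ^ (4 * m).
    rewrite ![4 * m]mulnC !expnM.
    have := bernoulli_pow m0; set u := _ ^ m; set v := _ ^ m => h.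
    have : (3 * u) ^ 4 <= (2 * v) ^ 4 by rewrite leq_exp2r.
    rewrite !expnMn -[3 ^ 4]/81 -[2 ^ 4]/16; lia.
  rewrite -(subnKC xb) !expnD mulnA; apply: leq_mul.
    by rewrite [x * _]mulnC !(expnM _ (4 * m)) -expnMn; apply: leq_expn2r.
  by apply: leq_expn2r; apply: leq_pred.
have nsq : n ^ 2 * m < 2 ^ x.
  apply: leq_ltn_trans (hx0 x x0x).
  have : n <= 4 * a * m * x.+1.
    apply: leq_trans (ltnW nb) _; rewrite [4 * a]mulnC -!mulnA leq_mul2l mulnA.
    by rewrite bx orbT.
  move=> h; apply: (@leq_trans ((4 * a * m * x.+1) ^ 2 * m));
    first by rewrite leq_mul2r leq_exp2r // h orbT.
  have -> : (4 * a * m * x.+1) ^ 2 * m = 16 * a ^ 2 * m ^ 3 * x.+1 ^ 2.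
    by rewrite !expnMn (expnS m 2) -[4 ^ 2]/16; nia.
  exact: leqnn.
have [||||Z [Zm ZA]] := @random_subset V I A J b m x => //.
- by apply: leq_trans xb; nia.
- by move=> i iJ; rewrite -(mulnK #|A i| a0) leq_div2r ?hA.
- rewrite [(2 * m).-1 ^ b * _]mulnC mulnA.
  have : #|J| * m * 2 ^ x < 4 ^ x.
    by rewrite -[4]/(2 * 2) expnMn ltn_pmul2r ?expn_gt0 //; apply: leq_ltn_trans nsq;
      rewrite leq_mul2r Jn orbT.
  move=> h; apply: leq_trans key; rewrite ltn_pmul2r // expn_gt0; lia.
exists Z; split=> // i iJ; have := ZA i iJ; set z := #|_| => xz.
have : b < 4 * m * z.*2 by nia. nia.
Qed.

(** * Rooted trees *)

(** The value [par r] is left free, hence the guards [v != r] throughout. *)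
Definition rooted (U : finType) (t : rel U) (r : U) (par : U -> U) (dep : U -> nat) : Prop :=
  [/\ forall v, v != r -> t v (par v) /\ dep v = (dep (par v)).+1,
      dep r = 0 &
      forall u v, t u v -> (u != r /\ par u = v) \/ (v != r /\ par v = u)].

(** Take for [dep] the distance from [r] and for [par] a neighbour one step closer. Acyclicity gives
    the last clause: parent edges alone connect any two vertices, so a further edge would close a
    cycle. *)
Lemma tree_rooted (U : finType) (t : rel U) (r : U) :
  tree t -> exists par dep, rooted t r par dep.
Proof.
move=> [[tsym tirr] tcon tacy].
pose reach v k := [exists p : k.-tuple U, path t r p && (last r p == v)].
have reachP v k : reflect (exists p, [/\ size p = k, path t r p & last r p = v]) (reach v k).
  apply: (iffP existsP) => [[p /andP[pp /eqP lp]]|[p [<- pp /eqP lp]]].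
    by exists p; rewrite size_tuple.
  by exists (in_tuple p); rewrite pp.
have exr v : exists k, reach v k.
  have /connectP[p pp lp] := tcon r v.
  by exists (size p); apply/reachP; exists p.
pose dep v := ex_minn (exr v).
have dep_le v k : reach v k -> dep v <= k.
  by rewrite /dep; case: ex_minnP => m _; apply.
have dep_reach v : reach v (dep v) by rewrite /dep; case: ex_minnP.
have exu v : v != r -> exists u, t v u && (dep v == (dep u).+1).
  move=> vr; have /reachP[p [sp pp lp]] := dep_reach v.
  case/lastP: p sp pp lp => [|p w].
    by move=> _ _ /= e; move: vr; rewrite e eqxx.
  rewrite size_rcons rcons_path last_rcons => sp /andP[pp tw] wv; subst w.
  exists (last r p); rewrite tsym tw -sp eqSS eqn_leq /=; apply/andP; split; last first.
    by apply: dep_le; apply/reachP; exists p.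
  have /reachP[p' [sp' pp' lp']] := dep_reach (last r p).
  have : reach v (dep (last r p)).+1.
    apply/reachP; exists (rcons p' v); rewrite size_rcons sp' rcons_path pp' lp' last_rcons.
    by rewrite tw.
  by move/dep_le; rewrite -sp ltnS.
pose par v := odflt v [pick u | t v u && (dep v == (dep u).+1)].
have parP v : v != r -> t v (par v) /\ dep v = (dep (par v)).+1.
  move=> vr; rewrite /par; case: pickP => [u /andP[tu /eqP e]|no] //=.
  by have [u] := exu v vr; rewrite no.
exists par, dep; split=> //.
  by apply/eqP; rewrite -leqn0; apply: dep_le; apply/reachP; exists [::].
pose t' : rel U := fun x y => ((x != r) && (par x == y)) || ((y != r) && (par y == x)).
have t'sym : symmetric t' by move=> x y; rewrite /t' orbC.
have t't : subrel t' t.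
  move=> x y /orP[] /andP[nr /eqP <-]; first by have [] := parP _ nr.
  by rewrite tsym; have [] := parP _ nr.
have t'r v : connect t' v r && connect t' r v.
  elim: {v}(dep v) {-2}v (leqnn (dep v)) => [|k IH] v dv;
    have [->|vr] := eqVneq v r; rewrite ?connect0 //.
    by have [_ e] := parP _ vr; rewrite e in dv.
  have [_ e] := parP _ vr.
  have /andP[c1 c2] : connect t' (par v) r && connect t' r (par v).
    by apply: IH; rewrite e in dv.
  have tv : t' v (par v) by rewrite /t' vr eqxx.
  rewrite (connect_trans (connect1 tv) c1) /=.
  by apply: connect_trans c2 (connect1 _); rewrite t'sym.
move=> u v tuv.
have [|nt'] := boolP (t' u v).
  by move=> /orP[] /andP[nr /eqP e]; [left|right].
have uv : connect t' u v.
  by have /andP[h1 _] := t'r u; have /andP[_ h2] := t'r v; apply: connect_trans h1 h2.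
case/connectP: uv => p0 pp0 lp0.
case: (shortenP pp0) lp0 => p pp up _ lp.
have : ucycle t (u :: p).
  rewrite /ucycle up andbT /= rcons_path (sub_path t't pp) -lp tsym tuv //.
(* A path without edges contradicts irreflexivity, a single edge contradicts [nt'], and anything
   longer is a cycle of size at least 3. *)
move/tacy; case: p pp up lp => [|x [|y p]] //= pp _ lp _.
  by move: tuv; rewrite lp tirr.
by move: pp nt'; rewrite lp andbT => ->.
Qed.

Section RootedTree.
Variables (U : finType) (t : rel U) (r : U) (par : U -> U) (dep : U -> nat).
Hypothesis tsym : symmetric t.
Hypothesis rt : rooted t r par dep.

Definition children (u : U) : {set U} := [set w | (w != r) && (par w == u)].

Lemma in_children u w : (w \in children u) = (w != r) && (par w == u).
Proof. by rewrite inE. Qed.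

Lemma dep_par v : v != r -> dep v = (dep (par v)).+1.
Proof. by case: rt => h _ _ /h[]. Qed.

Lemma edge_par v : v != r -> t v (par v).
Proof. by case: rt => h _ _ /h[]. Qed.

Lemma nbhd_children u : children u \subset nbhd t u.
Proof.
apply/subsetP => w; rewrite !inE => /andP[wr /eqP <-].
by rewrite tsym edge_par.
Qed.

Lemma nbhd_par u : nbhd t u = if u == r then children u else par u |: children u.
Proof.
case: rt => h1 _ h3; apply/setP => w; rewrite inE.
have [->|ur] := eqVneq u r.
  rewrite inE; apply/idP/andP.
    by case/h3 => [][]; rewrite ?eqxx // => wr ->.
  by case=> wr /eqP <-; rewrite tsym edge_par.
rewrite !inE; apply/idP/orP.
  by case/h3 => [][wr ->]; [left|right; rewrite wr /=].
case=> [/eqP ->|/andP[wr /eqP <-]]; first exact: edge_par.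
by rewrite tsym edge_par.
Qed.

Lemma card_children u : #|children u| <= max_degree t.
Proof.
apply: leq_trans (subset_leq_card (nbhd_children u)) _.
exact: (leq_bigmax (F := fun v => #|nbhd t v|)).
Qed.

Lemma par_not_child u : u != r -> par u \notin children u.
Proof.
move=> ur; rewrite inE; apply/negP => /andP[pr /eqP e].
have := dep_par pr; rewrite e (dep_par ur); lia.
Qed.

Lemma card_nbhd_par u : u != r -> #|nbhd t u| = #|children u|.+1.
Proof. by move=> ur; rewrite nbhd_par (negbTE ur) cardsU1 par_not_child. Qed.

Lemma embedding_of_par (V : finType) (e : rel V) (f : U -> V) :
  symmetric e -> injective f -> (forall v, v != r -> e (f (par v)) (f v)) ->
  contains_copy e t.
Proof.
case: rt => _ _ h3 esym fi fe; exists f; split=> // u v /h3[][nr <-].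
  by rewrite esym fe.
exact: fe.
Qed.

End RootedTree.

(** * Extending partial embeddings *)

Definition nbhd_set (V : finType) (e : rel V) (X : {set V}) : {set V} :=
  [set y | [exists x in X, e x y]].

Lemma nbhd_setP (V : finType) (e : rel V) (X : {set V}) y :
  reflect (exists2 x, x \in X & e x y) (y \in nbhd_set e X).
Proof.
rewrite inE; apply: (iffP existsP) => [[x /andP[xX exy]]|[x xX exy]]; first by exists x.
by exists x; rewrite xX.
Qed.

Lemma nbhd_set1 (V : finType) (e : rel V) x : nbhd_set e [set x] = nbhd e x.
Proof.
apply/setP => y; rewrite [RHS]inE; apply/nbhd_setP/idP => [[z /set1P ->] //|exy].
by exists x; rewrite ?set11.
Qed.

Lemma nbhd_setU (V : finType) (e : rel V) X X' :
  nbhd_set e (X :|: X') = nbhd_set e X :|: nbhd_set e X'.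
Proof.
apply/setP => y; rewrite in_setU; apply/nbhd_setP/orP.
  by case=> x; rewrite inE => /orP[] xX exy; [left|right]; apply/nbhd_setP; exists x.
by case=> /nbhd_setP[x xX exy]; exists x => //; rewrite inE xX ?orbT.
Qed.

Section Extension.
Variables (V U : finType) (e : rel V) (r : U) (par : U -> U).
Variables (U0 : {set U}) (Y : {set V}) (d m : nat).

Definition partial_embedding (S : {set U}) (f : U -> V) : Prop :=
  [/\ S \subset U0, r \in S, {in S, forall v, v != r -> par v \in S},
      {in S &, injective f} &
      {in S, forall v, v != r -> e (f (par v)) (f v)}].

Definition waiting (S : {set U}) (f : U -> V) (X : {set V}) : {set U} :=
  [set w in U0 :\: S | (par w \in S) && (f (par w) \in X)].

(* Vertices outside the image are charged the maximal number [d] of children. *)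
Definition demand (S : {set U}) (f : U -> V) (X : {set V}) := d * #|X :\: f @: S| + #|waiting S f
  X|.

Definition supply (S : {set U}) (f : U -> V) (X : {set V}) := (nbhd_set e X :&: Y) :\: f @: S.

(** The Friedman-Pippenger invariant. The bound [2 * m] lets it be applied to unions of two sets of
    size at most [m]. *)
Definition extendable S f : Prop :=
  forall X : {set V}, #|X| <= 2 * m -> demand S f X <= #|supply S f X|.

Hypothesis childd : forall u, #|children r par u| <= d.
Hypothesis expand_small : forall X : {set V}, 0 < #|X| <= m -> d * #|X| <= #|nbhd_set e X :&: Y|.
Hypothesis expand_large : forall X : {set V}, m < #|X| <= 2 * m ->
  d * #|X| + #|U0| <= #|nbhd_set e X :&: Y|.

Lemma supplyU S f X X' : supply S f (X :|: X') = supply S f X :|: supply S f X'.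
Proof. by rewrite /supply nbhd_setU setIUl setDUl. Qed.

Lemma supplyI_sub S f X X' : supply S f (X :&: X') \subset supply S f X :&: supply S f X'.
Proof.
apply/subsetP => y; rewrite !in_setI !in_setD !in_setI => /andP[-> /andP[]].
case/nbhd_setP => x /setIP[xX xX'] exy ->; rewrite !andbT /=.
by apply/andP; split; apply/nbhd_setP; exists x.
Qed.

Lemma demand_modular S f X X' :
  demand S f (X :|: X') + demand S f (X :&: X') = demand S f X + demand S f X'.
Proof.
rewrite /demand.
have e1 : #|(X :|: X') :\: f @: S| + #|(X :&: X') :\: f @: S| =
          #|X :\: f @: S| + #|X' :\: f @: S|.
  by rewrite setDUl setDIl cardsUI.
have e2 : #|waiting S f (X :|: X')| + #|waiting S f (X :&: X')| =
          #|waiting S f X| + #|waiting S f X'|.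
  rewrite -[RHS]cardsUI; congr (_ + _); apply: eq_card => w; rewrite !inE;
    case: (w \in S) => //=; case: (w \in U0) => //=; by case: (par w \in S) => //=.
by rewrite addnACA -mulnDr e1 e2 mulnDr addnACA.
Qed.

(** An occupied vertex waits for at most [d] children, so it is charged no more than a free one. *)
Lemma demand_le (S : {set U}) (f : U -> V) X : r \in S -> {in S &, injective f} -> demand S f X
  <= d * #|X|.
Proof.
move=> rS fi; rewrite /demand -(cardsID (f @: S) X) mulnDr addnC leq_add2r.
pose D := [set p in S | f p \in X].
apply: (@leq_trans (\sum_(p in D) #|children r par p|)).
  apply: leq_trans (card_bigcup_leq _ _); apply/subset_leq_card/subsetP => w.
  rewrite inE in_setD => /andP[/andP[wS _] /andP[pS fX]].
  apply/bigcupP; exists (par w); rewrite ?inE ?pS //= eqxx andbT.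
  by apply: contraNneq wS => ->.
apply: (@leq_trans (\sum_(p in D) d)); first exact: leq_sum.
rewrite sum_nat_const mulnC leq_mul2l; apply/orP; right.
rewrite -(card_in_imset (f := f) (D := mem D)); last first.
  by move=> x y; rewrite !inE => /andP[xS _] /andP[yS _]; apply: fi.
apply/subset_leq_card/subsetP => y /imsetP[p]; rewrite inE => /andP[pS fX] ->.
by rewrite inE fX imset_f.
Qed.

Lemma extendable_disjoint (S : {set U}) (f : U -> V) : r \in S -> {in S &, injective f} ->
  [disjoint f @: S & Y] -> extendable S f.
Proof.
move=> rS fi dY X X2m; apply: leq_trans (demand_le _ rS fi) _.
have -> : supply S f X = nbhd_set e X :&: Y.
  apply/setP => y; rewrite in_setD in_setI; case: (boolP (y \in Y)) => yY; rewrite ?andbF //.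
  by rewrite (disjointFl dY yY).
have [->|X0] := eqVneq #|X| 0; first by rewrite muln0.
case: (leqP #|X| m) => Xm; first by apply: expand_small; rewrite lt0n X0.
by apply: leq_trans (leq_addr _ _) (expand_large _); rewrite Xm.
Qed.

(** At these sizes [expand_large] has [#|U0|] to spare, more than the image of a proper [S] can
    block. So no set of medium size is critical, which keeps unions of critical sets small. *)
Lemma demand_large S f (X : {set V}) : partial_embedding S f -> S != U0 -> m < #|X| <= 2 * m ->
  demand S f X < #|supply S f X|.
Proof.
case=> SU rS _ fi _ SnU hX; apply: leq_ltn_trans (demand_le _ rS fi) _.
have lt : #|S| < #|U0| by apply: proper_card; rewrite properEneq SnU.
have := expand_large hX; have : #|nbhd_set e X :&: Y| <= #|supply S f X| + #|S|.
  rewrite -(cardsID (f @: S)) addnC leq_add2l.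
  by apply: leq_trans (subset_leq_card (subsetIr _ _)) (leq_imset_card _ _).
lia.
Qed.

Section Step.
Variables (S : {set U}) (f : U -> V) (q : U).
Hypotheses (fS : partial_embedding S f) (qU : q \in U0) (qS : q \notin S) (pS : par q \in S).

Lemma partial_embedding_step y : y \notin f @: S -> e (f (par q)) y ->
  partial_embedding (q |: S) (fupdate f q y).
Proof.
case: fS => SU rS Sp fi fe yS ey; split.
- by rewrite subUset sub1set qU.
- by rewrite in_setU1 rS orbT.
- move=> v; rewrite !in_setU1 => /orP[/eqP -> _|vS vr]; first by rewrite pS orbT.
  by rewrite Sp ?orbT.
- exact: inj_fupdate.
- move=> v; rewrite in_setU1; case: (eqVneq v q) => [-> _ _|vq /= vS vr].
    by rewrite fupdate_eq fupdate_neq //; apply: contraNneq qS => <-.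
  have pvS := Sp _ vS vr.
  rewrite (fupdate_neq _ _ vq) fupdate_neq; first exact: fe.
  by apply: contraNneq qS => <-.
Qed.

(** The charge [d] on the free vertex [y] pays for the children of [q], and [q] itself stops waiting
    at [f (par q)]. *)
Lemma demand_step y (X : {set V}) : y \notin f @: S ->
  demand (q |: S) (fupdate f q y) X + (f (par q) \in X) <= demand S f X.
Proof.
case: fS => SU rS Sp fi fe yS; rewrite /demand imset_fupdate //.
have e1 : #|X :\: f @: S| = (y \in X) + #|X :\: (y |: f @: S)|.
  rewrite (cardsD1 y) in_setD yS /=; congr (_ + _).
  by apply: eq_card => z; rewrite !inE negb_or -andbA.
set W' := waiting _ _ X; set W := waiting S f X.
have q_W : (q \in W) = (f (par q) \in X) by rewrite !inE qS qU pS.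
have sub : W' \subset (W :\ q) :|: (if y \in X then children r par q else set0).
  apply/subsetP => w; rewrite !inE negb_or => /andP[/andP[/andP[wq wS] wU] /andP[]].
  have wr : w != r by apply: contraNneq wS => ->.
  case: (eqVneq (par w) q) => [pw|pwq] /=.
    by move=> _; rewrite /fupdate pw eqxx => ->; rewrite !inE wr pw eqxx orbT.
  by move=> pwS; rewrite fupdate_neq // => ->; rewrite wq wS wU pwS.
have := subset_leq_card sub;
  have [+ _] := leq_card_setU (W :\ q) (if y \in X then children r par q else set0).
have := cardsD1 q W; rewrite q_W e1 => -> h1 h2.
have h3 : #|if y \in X then children r par q else set0| <= d * (y \in X).
  by case: ifP => _; rewrite ?cards0 // muln1.
move: (leq_trans h2 h1) h3; rewrite mulnDr; clear.
move: (nat_of_bool _) (nat_of_bool _) (#|_|) (#|_|) (#|_|) (#|_|) => *; lia.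
Qed.

(** Supply counts only vertices of [Y], so occupying a vertex outside [Y] blocks none of it. This
    lets selected tree vertices be placed by another rule. *)
Lemma extendable_step_outside y : extendable S f -> y \notin f @: S -> y \notin Y ->
  extendable (q |: S) (fupdate f q y).
Proof.
move=> ext yS yY X X2m.
apply: (@leq_trans #|supply S f X|).
  exact: leq_trans (leq_addr _ _) (leq_trans (demand_step X yS) (ext X X2m)).
apply/subset_leq_card/subsetP => z;
  rewrite /supply imset_fupdate // !in_setD in_setI in_setU1 negb_or.
by move=> /and3P[-> -> zY]; rewrite zY !andbT; apply: contraNneq yY => <-.
Qed.

(* If every choice failed, the union of the critical sets would be critical
   and absorb all free neighbours of [f (par q)]. *)
Lemma extendable_step : 0 < m -> extendable S f -> exists y,
  [/\ y \in Y, y \notin f @: S, e (f (par q)) y & extendable (q |: S) (fupdate f q y)].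
Proof.
move=> m0 ext; set u := f (par q).
have [SU rS Sp fi fe] := fS.
have SnU : S != U0 by apply: contraNneq qS => ->.
pose crit (X : {set V}) := [&& #|X| <= m, u \notin X & #|supply S f X| <= demand S f X].
have [/existsP[y /and4P[yY yS ey /forallP exty]]|none] := boolP [exists y,
  [&& y \in Y, y \notin f @: S, e u y & [forall X : {set V},
    (#|X| <= 2 * m) ==> (demand (q |: S) (fupdate f q y) X <= #|supply (q |: S) (fupdate f q y)
      X|)]]].
  by exists y; split=> // X X2m; apply: (implyP (exty X)).
(* Demand is modular and supply submodular, so criticality passes to the union, and [demand_large]
   forces its size back to at most [m]. *)
have critU X X' : crit X -> crit X' -> crit (X :|: X').
  case/and3P=> Xm uX cX /and3P[X'm uX' cX'].
  have U2m : #|X :|: X'| <= 2 * m.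
    by apply: leq_trans (leq_card_setU _ _) _; rewrite mul2n -addnn leq_add.
  have dU : #|supply S f (X :|: X')| <= demand S f (X :|: X').
    have I2m : #|X :&: X'| <= 2 * m by apply: leq_trans (subset_leq_card (subsetIl _ _)) _;
      rewrite mul2n -addnn (leq_trans Xm) ?leq_addr.
    have := demand_modular S f X X'; have := ext _ I2m.
    have := subset_leq_card (supplyI_sub S f X X').
    have := cardsUI (supply S f X) (supply S f X'); rewrite supplyU.
    move: cX cX'; clear; lia.
  rewrite /crit in_setU negb_or uX uX' dU !andbT.
  rewrite leqNgt; apply/negP => Um.
  have : m < #|X :|: X'| <= 2 * m by rewrite Um.
  by move/(demand_large fS SnU); rewrite ltnNge dU.
have crit0 : crit set0.
  rewrite /crit cards0 inE /=.
  have -> : supply S f set0 = set0.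
    apply/setP => y; rewrite !in_setD in_setI in_set0; apply/negbTE/negP => /andP[_ /andP[]].
    by case/nbhd_setP => x; rewrite inE.
  by rewrite cards0.
pose X0 := \bigcup_(X | crit X) X.
have /and3P[X0m uX0 cX0] : crit X0 by rewrite /X0; elim/big_ind: _ => //.
(* A set witnessing that [y] fails must lose [y] from its supply with no drop in demand; hence it is
   critical, avoids [u], and has [y] among its neighbours. *)
have sup y : y \in Y -> y \notin f @: S -> e u y -> y \in supply S f X0.
  move=> yY yS ey; rewrite in_setD yS in_setI yY andbT /=.
  move: none; rewrite negb_exists => /forallP /(_ y); rewrite yY yS ey /=.
  rewrite negb_forall => /existsP[X]; rewrite negb_imply -ltnNge => /andP[X2m bad].
  have := ext X X2m; have := demand_step X yS; rewrite -/u => h1 h2.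
  have h3 : supply S f X :\ y \subset supply (q |: S) (fupdate f q y) X.
    apply/subsetP => z; rewrite !in_setD1 !in_setD imset_fupdate // in_setU1 negb_or.
    by rewrite andbA.
  have := subset_leq_card h3; have := cardsD1 y (supply S f X) => h4 h5.
  have {bad}h6 := leq_ltn_trans h5 bad.
  have ysup : y \in supply S f X.
    apply/negPn/negP => nys; move: h4 h6 h1 h2; rewrite (negbTE nys); clear; lia.
  rewrite ysup in h4.
  have uX : u \notin X.
    apply/negP => uX; move: h4 h6 h1 h2; rewrite uX; clear; lia.
  have cX : #|supply S f X| <= demand S f X by move: h4 h6 h1; clear; lia.
  have critX : crit X.
    rewrite /crit uX cX !andbT leqNgt; apply/negP => Xm.
    have : m < #|X| <= 2 * m by rewrite Xm.
    by move/(demand_large fS SnU); rewrite ltnNge cX.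
  move: ysup; rewrite in_setD in_setI => /andP[_ /andP[/nbhd_setP[x xX exy] _]].
  by apply/nbhd_setP; exists x => //; apply/bigcupP; exists X.
(* Adding [u] to the union brings no new supply but does bring the demand of [q], which contradicts
   extendability. *)
have supu : supply S f (u |: X0) = supply S f X0.
  rewrite supplyU; apply/setUidPr/subsetP => y; rewrite /supply in_setD in_setI nbhd_set1 inE.
  by move=> /and3P[yS ey yY]; apply: sup.
have du : demand S f X0 < demand S f (u |: X0).
  rewrite /demand; apply: (@leq_trans (d * #|(u |: X0) :\: f @: S| + #|q |: waiting S f X0|)).
    rewrite cardsU1.
    have -> : q \notin waiting S f X0 by rewrite !inE (negbTE uX0) !andbF.
    rewrite addnCA add1n ltnS leq_add2r leq_mul2l; apply/orP; right.
    by apply/subset_leq_card/setSD/subsetUr.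
  rewrite leq_add2l; apply/subset_leq_card/subsetP => w; rewrite in_setU1 => /orP[/eqP ->|].
    by rewrite !inE qS qU pS eqxx.
  by rewrite !inE => /andP[-> /andP[-> ->]]; rewrite orbT.
have u2m : #|u |: X0| <= 2 * m by rewrite cardsU1 uX0 mul2n -addnn leq_add.
by have := ext _ u2m; rewrite supu leqNgt (leq_ltn_trans cX0 du).
Qed.

End Step.

(** [Inv] carries the bookkeeping for the vertices of [Q], which the caller places outside [Y]; all
    others follow [extendable_step]. An unplaced vertex of least depth always has its parent
    placed. *)
Lemma grow_embedding (dep : U -> nat) (Q : {set U}) (Inv : {set U} -> (U -> V) -> Prop) S0 f0 :
  0 < m ->
  (forall v, v != r -> dep (par v) < dep v) ->
  {in U0, forall v, v != r -> par v \in U0} ->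
  (forall S f q, partial_embedding S f -> Inv S f -> q \in U0 -> q \notin S ->
     par q \in S -> q \in Q -> exists y,
     [/\ y \notin Y, y \notin f @: S, e (f (par q)) y & Inv (q |: S) (fupdate f q y)]) ->
  (forall S f q y, partial_embedding S f -> Inv S f -> q \in U0 -> q \notin S ->
     par q \in S -> q \notin Q -> y \in Y -> y \notin f @: S -> Inv (q |: S) (fupdate f q y)) ->
  partial_embedding S0 f0 -> extendable S0 f0 -> Inv S0 f0 ->
  exists f, partial_embedding U0 f /\ Inv U0 f.
Proof.
move=> m0 hdep U0p hQ hnQ.
elim: {S0}#|U0 :\: S0| {-2}S0 (leqnn #|U0 :\: S0|) f0 => [|k IH] S Sk f pe ext inv.
  have [SU _ _ _ _] := pe; exists f; suff <- : S = U0 by [].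
  apply/eqP; rewrite eqEsubset SU /= -setD_eq0 -cards_eq0; lia.
have [SU rS _ _ _] := pe.
have [D0|/set0Pn[v0 v0D]] := eqVneq (U0 :\: S) set0.
  exists f; suff <- : S = U0 by [].
  by apply/eqP; rewrite eqEsubset SU /= -setD_eq0 D0.
case: (@arg_minnP _ v0 (fun q => q \in U0 :\: S) dep v0D) => q qD qmin.
have qr : q != r by move: qD; rewrite in_setD; apply: contraTneq => ->; rewrite rS.
have /andP[qS qU] : (q \notin S) && (q \in U0) by rewrite -in_setD.
have pqS : par q \in S.
  apply/negPn/negP => npS; have := qmin (par q); rewrite in_setD npS U0p // => /(_ isT).
  by rewrite leqNgt hdep.
have less : #|U0 :\: (q |: S)| <= k.
  move: Sk; rewrite (cardsD1 q) qD => Sk; rewrite -ltnS; apply: leq_trans Sk; rewrite add1n ltnS.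
  by apply/subset_leq_card/subsetP => z; rewrite !inE negb_or -andbA.
have [qQ|qQ] := boolP (q \in Q).
  have [y [yY yS ey inv']] := hQ S f q pe inv qU qS pqS qQ.
  apply: (IH (q |: S) less (fupdate f q y)) inv'; first exact: partial_embedding_step.
  exact: extendable_step_outside.
have [y [yY yS ey ext']] := extendable_step pe qU qS pqS m0 ext.
apply: (IH (q |: S) less (fupdate f q y)) => //; first exact: partial_embedding_step.
exact: hnQ.
Qed.

End Extension.

(** Property (4) concerns sets of size exactly [s]; this form follows by passing to subsets. *)
Definition joined (V : finType) (e : rel V) (V1 : {set V}) (s : nat) : Prop :=
  forall A B : {set V}, A \subset V1 -> s <= #|A| -> s <= #|B| ->
  [disjoint A & B] -> exists a b : V, [/\ a \in A, b \in B & e a b].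

(** * Putting the leaves back by Hall's theorem *)

Section FinishLeaves.
Variables (V U : finType) (e : rel V) (t : rel U) (r : U) (par : U -> U) (dep : U -> nat).
Variables (V1 : {set V}) (s d : nat) (L : {set U}) (f : U -> V).
Hypotheses (esym : symmetric e) (tsym : symmetric t) (rt : rooted t r par dep).
Hypothesis childd : forall u, #|children r par u| <= d.
Hypothesis card_UV : #|U| = #|V|.
Hypothesis Lleaf : forall l u, l \in L -> u != r -> par u != l.
Hypothesis join : joined e V1 s.
Hypothesis fpe : partial_embedding e r par (~: L) (~: L) f.
Hypothesis parV1 : forall l, l \in L -> f (par l) \in V1.
Hypothesis par_rich : forall l, l \in L ->
  s * d <= #|nbhd e (f (par l)) :\: f @: (~: L)|.
Hypothesis hole_rich : forall w : V, w \notin f @: (~: L) ->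
  s <= #|[set l in L | e w (f (par l))]|.

(** Hall's condition for a family of leaves: fewer than [s] parents have at most [s * d] leaves, and
    one rich neighbourhood is enough. Otherwise fewer than [s] holes are missed, and a missed hole
    [w] keeps the [s] leaves of [hole_rich] outside the family, so the family is small enough. *)
Lemma finish_leaves : contains_copy e t.
Proof.
case: fpe => _ rL Lp fi fe.
have nr l : l \in L -> l != r by move=> lL; apply: contraTneq lL => ->; rewrite -in_setC.
have parL l : l \in L -> par l \in ~: L.
  move=> lL; rewrite inE; apply/negP => pL.
  by have := Lleaf pL (nr _ lL); rewrite eqxx.
pose S l := nbhd e (f (par l)) :\: f @: (~: L).
have cardW : #|~: (f @: (~: L))| = #|L|.
  have := cardsC (f @: (~: L)); have := cardsC L; rewrite card_in_imset // card_UV; lia.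
have [h [hi hS]] : exists h : U -> V, {in L &, injective h} /\ {in L, forall l, h l \in S l}.
  apply: (hall (f r)) => K KL.
  have [->|/set0Pn[l0 l0K]] := eqVneq K set0; first by rewrite cards0.
  pose A := f @: (par @: K).
  have KA : #|K| <= #|A| * d.
    have -> : #|A| = #|par @: K|.
      apply: card_in_imset => x y /imsetP[x' x'K ->] /imsetP[y' y'K ->].
      by apply: fi; apply: parL; apply: (subsetP KL).
    apply: (@leq_trans (\sum_(p in par @: K) #|children r par p|)).
      apply: leq_trans (card_bigcup_leq _ _); apply/subset_leq_card/subsetP => l lK.
      apply/bigcupP; exists (par l); rewrite ?imset_f // inE eqxx andbT.
      exact/nr/(subsetP KL).
    by rewrite -sum_nat_const; apply: leq_sum.
  case: (ltnP #|A| s) => As.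
    apply: (leq_trans KA); apply: (@leq_trans (s * d)); first by rewrite leq_mul2r ltnW ?orbT.
    apply: leq_trans (par_rich (subsetP KL _ l0K)) _.
    by apply: subset_leq_card; apply: (bigcup_sup l0).
  set N := \bigcup_(i in K) S i; pose B := ~: (f @: (~: L)) :\: N.
  have NW : N \subset ~: (f @: (~: L)).
    by apply/bigcupsP => l _; apply/subsetP => w;
      rewrite /S in_setD [in X in _ -> X]in_setC => /andP[].
  have cN : #|N| + #|B| = #|L|.
    by rewrite -cardW -(cardsID N (~: (f @: (~: L)))) (setIidPr NW).
  have [B0|/set0Pn[w wB]] := eqVneq B set0.
    by move: cN; rewrite B0 cards0 addn0 => ->; apply: subset_leq_card.
  have noedge a b : a \in A -> b \in B -> e a b -> False.
    move=> /imsetP[_ /imsetP[l lK ->] ->]; rewrite in_setD in_setC => /andP[/negP bN bW] eb.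
    by apply: bN; apply/bigcupP; exists l => //; rewrite in_setD bW inE.
  have Bs : #|B| < s.
    rewrite ltnNge; apply/negP => sB.
    have [||a [b [aA bB eab]]] := join _ As sB.
    - by apply/subsetP => _ /imsetP[_ /imsetP[l lK ->] ->]; apply: parV1; apply: (subsetP KL).
    - rewrite -setI_eq0; apply/eqP/setP => x; rewrite in_set0 in_setI; apply/negbTE/negP.
      case/andP=> /imsetP[_ /imsetP[l lK ->] ->]; rewrite in_setD in_setC => /andP[_ /negP[]].
      by apply/imset_f/parL/(subsetP KL).
    - exact: noedge aA bB eab.
  have wf : w \notin f @: (~: L) by move: wB; rewrite in_setD in_setC => /andP[].
  have := hole_rich wf; have : [set l in L | e w (f (par l))] \subset L :\: K.
    apply/subsetP => l; rewrite !inE => /andP[lL el]; rewrite lL andbT; apply/negP => lK.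
    by apply: (noedge (f (par l)) w) => //; rewrite 1?esym // imset_f ?imset_f.
  move/subset_leq_card; have := cardsID K L; rewrite (setIidPr KL); lia.
pose g u := if u \in L then h u else f u.
have hW l : l \in L -> h l \notin f @: (~: L).
  by move/hS; rewrite in_setD => /andP[].
apply: (embedding_of_par rt (f := g)) => //.
  move=> x y; rewrite /g; case: ifP => xL; case: ifP => yL.
  - exact: hi.
  - by move=> E; have := hW x xL; rewrite E imset_f // inE yL.
  - by move=> E; have := hW y yL; rewrite -E imset_f // inE xL.
  - by apply: fi; rewrite inE ?xL ?yL.
move=> v vr; rewrite /g.
have -> : par v \in L = false by apply/negP => /Lleaf /(_ vr); rewrite eqxx.
case: ifP => vL; last by apply: fe; rewrite // inE vL.
by have := hS v vL; rewrite !inE => /andP[].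
Qed.

End FinishLeaves.

(** * Trees with many leaf parents at one vertex *)

Lemma inj_into (A B : finType) (b0 : B) (X : {set A}) (Y : {set B}) : #|X| <= #|Y| ->
  exists f : A -> B, {in X &, injective f} /\ {in X, forall x, f x \in Y}.
Proof.
move=> XY; apply: (hall b0) => K KX.
have [->|/set0Pn[k kK]] := eqVneq K set0; first by rewrite cards0.
apply: leq_trans (subset_leq_card KX) (leq_trans XY _).
by apply: subset_leq_card; apply: (bigcup_sup k).
Qed.

Lemma inverse_on (A B : finType) (a0 : A) (X : {set A}) (g : A -> B) :
  {in X &, injective g} -> exists f : B -> A, {in X, forall x, f (g x) = x}.
Proof.
move=> gi; exists (fun y => odflt a0 [pick x in X | g x == y]) => x xX.
case: pickP => [z /andP[zX /eqP e]|no] /=; first exact: gi.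
by have := no x; rewrite xX eqxx.
Qed.

(** * Expansion from minimum degree and joinedness *)

Section Expansion.
Variables (V : finType) (e : rel V) (V1 Y : {set V}) (s d u : nat).
Hypotheses (esym : symmetric e) (join : joined e V1 s) (YV1 : Y \subset V1).
Hypothesis degY : forall v, s * d <= #|nbhd e v :&: Y|.
Hypothesis Ylarge : 3 * s + 2 * s * d + u <= #|Y|.

(** The neighbourhood of a single vertex of [X] is already large enough. *)
Lemma expand_small_of_degree (X : {set V}) : 0 < #|X| <= s ->
  d * #|X| <= #|nbhd_set e X :&: Y|.
Proof.
case/andP=> /card_gt0_ex[x xX] Xs; apply: (@leq_trans (s * d)).
  by rewrite mulnC leq_mul2r Xs orbT.
apply: leq_trans (degY x) _; apply/subset_leq_card/setSI/subsetP => y.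
by rewrite inE => exy; apply/nbhd_setP; exists x.
Qed.

(** By joinedness fewer than [s] vertices of [Y] outside [X] have no neighbour in [X]. *)
Lemma expand_large_of_joined (X : {set V}) : s < #|X| <= 2 * s ->
  d * #|X| + u <= #|nbhd_set e X :&: Y|.
Proof.
case/andP=> sX Xs.
have Rs : #|(Y :\: nbhd_set e X) :\: X| < s.
  rewrite ltnNge; apply/negP => sR.
  have [||a [b [aA bB eab]]] := join _ sR (ltnW sX).
  - by apply: subset_trans YV1; apply: subset_trans (subsetDl _ _) (subsetDl _ _).
  - by rewrite -setI_eq0 setDE -setIA [~: X :&: X]setIC setICr setI0.
  - move: aA; rewrite !in_setD => /and3P[_ /negP aN _].
    by apply: aN; apply/nbhd_setP; exists b => //; rewrite esym.
have h1 := cardsID (nbhd_set e X) Y; rewrite setIC in h1.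
have h2 := cardsID X (Y :\: nbhd_set e X).
have h3 : #|(Y :\: nbhd_set e X) :&: X| <= #|X| by apply/subset_leq_card/subsetIr.
have : d * #|X| <= 2 * s * d by rewrite mulnC leq_mul2r Xs orbT.
move: Ylarge Rs h1 h2 h3 Xs; clear; lia.
Qed.

End Expansion.

Definition leaves (U : finType) (t : rel U) : {set U} := [set l | #|nbhd t l| == 1].

Definition leaf_parents_at (U : finType) (t : rel U) (x : U) : {set U} :=
  [set p in nbhd t x | [exists l in leaves t, t p l]].

Lemma leaf_no_child (U : finType) (t : rel U) r par dep l u :
  symmetric t -> rooted t r par dep -> l \in leaves t -> l != r -> u != r -> par u != l.
Proof.
move=> tsym rt; rewrite inE => /eqP l1 lr ur; apply/eqP => pu.
have := card_nbhd_par tsym rt lr; rewrite l1 => -[] /esym/eqP.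
by rewrite cards_eq0 => /eqP/setP /(_ u); rewrite !inE ur pu eqxx.
Qed.

Section StarCase.
Variables (V U : finType) (e : rel V) (t : rel U) (V1 : {set V}) (s : nat).
Variables (xs : V) (Rs Ss W0 : {set V}) (sv : V -> V) (x : U).
Hypotheses (eg : simple_graph e) (tt : tree t) (card_UV : #|U| = #|V|).
Hypothesis join : joined e V1 s.
Hypotheses (s0 : 0 < s) (RsV1 : Rs \subset V1) (SsV1 : Ss \subset V1) (dRS : [disjoint Rs & Ss]).
Hypotheses (Sxs : Ss \subset nbhd e xs) (Rs25 : #|Rs| <= 25).
Hypothesis svP : {in [set v in Rs | ~~ e xs v], forall v, sv v \in Ss /\ e v (sv v)}.
Hypothesis svi : {in [set v in Rs | ~~ e xs v] &, injective sv}.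
Hypothesis Srich : forall w, w \notin Rs :|: Ss -> s + 25 <= deg_in e w Ss.
Let G := xs |: (Ss :|: Rs).
Let Y := (V1 :\: W0) :\: G.
Let D := max_degree t.
Hypotheses (W0G : [disjoint W0 & G]).
Hypothesis degW0 : forall v, s * D <= #|nbhd e v :&: W0|.
Hypothesis degY : forall v, s * D <= #|nbhd e v :&: Y|.
Hypothesis Ylarge : 3 * s + 2 * s * D + (#|U| - #|leaves t| + D + #|G|) <= #|Y|.
Hypothesis xP : #|Ss| + 25 < #|leaf_parents_at t x|.

(** Place [x] on [xs], leaf parents at [x] on [Ss] and on the neighbours of [xs] in [Rs]; any other
    [v] in [Rs] receives the leaf of the leaf parent on [sv v]. A hole outside [Rs :|: Ss] sees
    [s + 25] vertices of [Ss], of which at most 25 have spent their leaf. *)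
Lemma star_case : contains_copy e t.
Proof.
have [esym eirr] := eg; have [[tsym tirr] _ _] := tt.
have [par [dep rt]] := tree_rooted x tt.
set L := leaves t; set P := leaf_parents_at t x.
have xnl : x \notin L.
  rewrite inE; apply/negP => /eqP x1; move: xP.
  have : #|P| <= 1 by rewrite -x1; apply/subset_leq_card/subsetP => p; rewrite inE => /andP[].
  by rewrite -/P; clear; lia.
have nlr l : l \in L -> l != x by move=> lL; apply: contraNneq xnl => <-.
have Lleaf l u : l \in L -> u != x -> par u != l.
  by move=> lL; apply: (leaf_no_child tsym rt lL (nlr _ lL)).
have PC p : p \in P -> p \in children x par x.
  by rewrite inE => /andP[]; rewrite (nbhd_par tsym rt) eqxx.
pose lf p := odflt x [pick l in L | (l != x) && (par l == p)].
have lfP p : p \in P -> [/\ lf p \in L, lf p != x & par (lf p) = p].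
  move=> pP; have := PC p pP; rewrite in_children => /andP[px /eqP pp].
  rewrite /lf; case: pickP => [l /and3P[lL lx /eqP] //|no].
  move: pP; rewrite inE => /andP[_ /existsP[l /andP[lL tpl]]].
  have : l \in nbhd t p by rewrite inE.
  rewrite (nbhd_par tsym rt) (negbTE px) in_setU1 pp (negbTE (nlr _ lL)) /= in_children.
  by move=> h; have := no l; rewrite lL h.
have Pnx p : p \in P -> p != x by move/PC; rewrite in_children => /andP[].
have Ppar p : p \in P -> par p = x by move/PC; rewrite in_children => /andP[_ /eqP].
have Pnl p : p \in P -> p \notin L.
  move=> pP; apply/negP => pL; have [_ lx pl] := lfP p pP.
  by have := Lleaf p _ pL lx; rewrite pl eqxx.
pose S1 := Ss :|: (Rs :&: nbhd e xs).
have [i [ii iP]] : exists f : V -> U, {in S1 &, injective f} /\ {in S1, forall v, f v \in P}.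
  apply: (inj_into x); apply: leq_trans (ltnW xP).
  apply: leq_trans (leq_card_setU _ _) _; rewrite leq_add2l.
  by apply: leq_trans Rs25; apply/subset_leq_card/subsetIl.
have xsS : xs \notin S1.
  rewrite !inE eirr andbF orbF; apply/negP => /(subsetP Sxs); by rewrite inE eirr.
(* [xs] may belong to [Rs], and it is not adjacent to itself. *)
pose R2 := [set v in Rs | ~~ e xs v] :\ xs.
have R2P v : v \in R2 -> v \in [set v in Rs | ~~ e xs v] by rewrite in_setD1 => /andP[].
have SsS1 v : v \in Ss -> v \in S1 by rewrite in_setU => ->.
have R2i v : v \in R2 -> i (sv v) \in P by move=> /R2P/svP[/SsS1/iP].
have GP v : v \in G -> [\/ v = xs, v \in S1 | v \in R2].
  rewrite !inE; case: (eqVneq v xs) => [->|vx /=]; first by constructor 1.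
  case: (v \in Ss) => /= [_|vR]; first by constructor 2.
  by rewrite vR /=; case: (e xs v) => /=; [constructor 2|constructor 3].
(* The prescribed placement is built backwards, from vertices of [G] to tree vertices; its inverse
   [f0] starts the embedding. *)
pose g v := if v == xs then x else if v \in S1 then i v else lf (i (sv v)).
have gx : g xs = x by rewrite /g eqxx.
have gS v : v \in S1 -> g v = i v.
  by move=> vS; rewrite /g vS; case: eqVneq => // e1; rewrite e1 (negbTE xsS) in vS.
have gR v : v \in R2 -> g v = lf (i (sv v)).
  move=> vR; rewrite /g; have := vR; rewrite in_setD1 => /andP[/negbTE -> h].
  suff /negbTE -> : v \notin S1 by [].
  move: h; rewrite !inE => /andP[vRs /negbTE ->]; rewrite andbF orbF.
  by rewrite (disjointFr dRS vRs).
have gi : {in G &, injective g}.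
  move=> v w vG wG.
  have h1 v1 : v1 \in S1 -> g v1 != x by move=> h; rewrite gS // Pnx ?iP.
  have h2 v1 : v1 \in R2 -> g v1 != x by move=> h; rewrite gR //; have [] := lfP _ (R2i _ h).
  have h3 v1 v2 : v1 \in S1 -> v2 \in R2 -> g v1 != g v2.
    move=> a b; rewrite (gS _ a) (gR _ b); have [lL _ _] := lfP _ (R2i _ b).
    by apply: contraTneq lL => <-; apply/Pnl/iP.
  case: (GP v vG) => [->|vS|vR]; case: (GP w wG) => [->|wS|wR] //; rewrite ?gx.
  - by move/eqP; rewrite eq_sym (negbTE (h1 _ wS)).
  - by move/eqP; rewrite eq_sym (negbTE (h2 _ wR)).
  - by move/eqP; rewrite (negbTE (h1 _ vS)).
  - by rewrite !gS //; apply: ii.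
  - by move/eqP; rewrite (negbTE (h3 _ _ vS wR)).
  - by move/eqP; rewrite (negbTE (h2 _ vR)).
  - by move/eqP; rewrite eq_sym (negbTE (h3 _ _ wS vR)).
  - rewrite !gR // => E; have [_ _ p1] := lfP _ (R2i _ vR); have [_ _ p2] := lfP _ (R2i _ wR).
    have : i (sv v) = i (sv w) by rewrite -p1 -p2 E.
    have [/SsS1 a _] := svP (R2P _ vR); have [/SsS1 b _] := svP (R2P _ wR).
    by move/(ii _ _ a b)/(svi (R2P _ vR) (R2P _ wR)).
have [f0 f0g] := inverse_on xs gi.
have gG v : v \in G -> g v \in g @: G by apply: imset_f.
(* Leaves at [x] are embedded with the rest of the tree: [finish_leaves] wants leaf parents to lie
   in [V1], which is not known of [xs]. *)
pose L' := (L :\: children x par x) :\: (g @: G).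
have L'L l : l \in L' -> l \in L by rewrite !in_setD => /and3P[].
have L'l l u : l \in L' -> u != x -> par u != l by move=> /L'L; apply: Lleaf.
have xU0 : x \in ~: L' by rewrite inE; apply: contra xnl => /L'L.
have U0p : {in ~: L', forall v, v != x -> par v \in ~: L'}.
  by move=> v _ vx; rewrite inE; apply/negP => /L'l /(_ vx); rewrite eqxx.
have xG : xs \in G by rewrite setU11.
have SG v : v \in S1 -> v \in G by rewrite !inE => /orP[->|/andP[-> _]]; rewrite ?orbT.
have pe0 : partial_embedding e x par (~: L') (g @: G) f0.
  split.
  - by apply/subsetP => _ /imsetP[v vG ->]; rewrite !inE (gG v).
  - by apply/imsetP; exists xs.
  - move=> _ /imsetP[v vG ->]; case: (GP v vG) => [->|vS|vR]; rewrite ?gx ?eqxx // => _.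
      by rewrite gS // Ppar ?iP // -gx gG.
    rewrite gR //; have [_ _ ->] := lfP _ (R2i _ vR).
    have [/SsS1 a _] := svP (R2P _ vR).
    by rewrite -gS // gG // SG.
  - by move=> _ _ /imsetP[v vG ->] /imsetP[w wG ->]; rewrite !f0g // => ->.
  - move=> _ /imsetP[v vG ->]; rewrite f0g //; case: (GP v vG) => [->|vS|vR].
    + by rewrite gx eqxx.
    + move=> _; rewrite gS // Ppar ?iP // -gx f0g //.
      by move: vS; rewrite in_setU => /orP[/(subsetP Sxs)|/setIP[_]]; rewrite inE.
    + move=> _; rewrite gR //; have [_ _ ->] := lfP _ (R2i _ vR).
      have [/SsS1 a b] := svP (R2P _ vR).
      by rewrite -gS // f0g ?SG // esym.
have f0G : f0 @: (g @: G) = G.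
  apply/setP => v; apply/imsetP/idP => [[_ /imsetP[w wG ->] ->]|vG]; first by rewrite f0g.
  by exists (g v); rewrite ?f0g ?gG.
have YV1 : Y \subset V1 by apply: subset_trans (subsetDl _ _) (subsetDl _ _).
have YG : [disjoint G & Y].
  by rewrite -setI_eq0 /Y setDE setIC -setIA [~: G :&: G]setIC setICr setI0.
have U0c : #|~: L'| <= #|U| - #|L| + D + #|G|.
  have h1 : L \subset L' :|: (children x par x :|: g @: G).
    by apply/subsetP => l lL; rewrite !in_setU !in_setD lL; case: (l \in g @: G);
      case: (l \in children x par x).
  have h2 := subset_leq_card h1.
  have [h3 _] := leq_card_setU L' (children x par x :|: g @: G).
  have [h4 _] := leq_card_setU (children x par x) (g @: G).
  have h5 := leq_imset_card g G.
  have h6 : #|children x par x| <= D by apply: card_children rt x.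
  have h7 := cardsC L'; have h8 := max_card (mem L).
  by move: h2 h3 h4 h5 h6 h7 h8; rewrite -/L; clear; lia.
have cD u : #|children x par u| <= D by apply: card_children rt u.
have Yl : 3 * s + 2 * s * D + #|~: L'| <= #|Y|.
  by apply: leq_trans Ylarge; rewrite leq_add2l.
have ext0 : extendable e par (~: L') Y D s (g @: G) f0.
  apply: (extendable_disjoint cD).
  - exact: (expand_small_of_degree degY).
  - exact: (expand_large_of_joined esym join YV1 Yl).
  - by apply/imsetP; exists xs.
  - by case: pe0.
  - by rewrite f0G.
pose Inv (S : {set U}) (f : U -> V) :=
  [/\ g @: G \subset S, {in G, forall v, f (g v) = v} & {in S, forall u, f u \in G :|: Y}].
have [f [fpe [_ fg fGY]]] : exists f, partial_embedding e x par (~: L') (~: L') f /\ Inv (~: L') f.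
  apply: (@grow_embedding V U e x par (~: L') Y D s cD _ dep set0 Inv (g @: G) f0) => //.
  - exact: (expand_large_of_joined esym join YV1 Yl).
  - by move=> v vx; rewrite (dep_par rt vx).
  - by move=> S f q _ _ _ _ _; rewrite inE.
  - move=> S f q y _ [gGS fg fGY] qU qS _ _ yY _; split.
    + by apply: subset_trans gGS (subsetUr _ _).
    + move=> v vG; rewrite fupdate_neq ?fg //.
      by apply: contraNneq qS => <-; apply: (subsetP gGS); apply: gG.
    + move=> u; rewrite in_setU1; case: (eqVneq u q) => [-> _|uq /= uS].
        by rewrite fupdate_eq in_setU yY orbT.
      by rewrite fupdate_neq // fGY.
  - by split=> // _ /imsetP[v vG ->]; rewrite f0g // in_setU vG.
have fi : {in ~: L' &, injective f} by case: fpe.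
have parU0 l : l \in L' -> par l \in ~: L'.
  by move=> lL; rewrite inE; apply/negP => /L'l /(_ (nlr _ (L'L _ lL))); rewrite eqxx.
apply: (@finish_leaves V U e t x par dep V1 s D L' f) => //.
- move=> l lL; have := fGY _ (parU0 _ lL); rewrite in_setU in_setU1.
  case: (eqVneq (f (par l)) xs) => [E _|_ /=].
    have : par l = x by apply: fi; rewrite ?parU0 // E -gx fg.
    move=> pl; move: lL; rewrite !in_setD in_children pl eqxx andbT => /and3P[_ + lL].
    by rewrite (nlr _ lL).
  case/orP=> [/setUP[/(subsetP SsV1)|/(subsetP RsV1)]|/(subsetP YV1)] //.
- move=> l lL; apply: leq_trans (degW0 (f (par l))) _; apply/subset_leq_card/subsetP => w.
  rewrite in_setI in_setD => /andP[-> wW]; rewrite andbT.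
  apply/imsetP => -[u uU wf]; have := fGY u uU; rewrite -wf in_setU (disjointFr W0G wW) /=.
  by rewrite !in_setD wW andbF.
- move=> w wf.
  have wG : w \notin G.
    apply: contra wf => wG; apply/imsetP; exists (g w); rewrite ?fg //.
    by case: pe0 => /subsetP h _ _ _ _; apply: h; apply: gG.
  have wRS : w \notin Rs :|: Ss by apply: contra wG; rewrite setUC => wRS;
    rewrite in_setU1 wRS orbT.
  (* The leaves of the leaf parents on [sv @: R2] already sit on [Rs] and cannot fill [w]. *)
  pose Z := (nbhd e w :&: Ss) :\: (sv @: R2).
  have sZ : s <= #|Z|.
    have := Srich wRS; rewrite /deg_in -(cardsID (sv @: R2)) -/Z.
    have : #|nbhd e w :&: Ss :&: sv @: R2| <= 25.
      apply: leq_trans (subset_leq_card (subsetIr _ _)) _.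
      apply: leq_trans (leq_imset_card _ _) (leq_trans _ Rs25).
      by apply/subset_leq_card/subsetP => v /R2P; rewrite inE => /andP[].
    clear; lia.
  apply: leq_trans sZ _.
  have ZS v : v \in Z -> v \in Ss by rewrite in_setD in_setI => /and3P[].
  rewrite -(card_in_imset (f := fun v => lf (i v)) (D := mem Z)); last first.
    move=> v v' /ZS/SsS1 vS /ZS/SsS1 vS' E; apply: ii => //.
    by have [_ _ <-] := lfP _ (iP _ vS); have [_ _ <-] := lfP _ (iP _ vS'); rewrite E.
  apply/subset_leq_card/subsetP => l /imsetP[v vZ ->].
  have vS := SsS1 _ (ZS _ vZ).
  have [lL lx lp] := lfP _ (iP _ vS).
  rewrite inE lp -(gS _ vS) fg ?SG // gS //.
  have ew : e w v by move: vZ; rewrite in_setD in_setI inE => /and3P[].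
  rewrite ew andbT !in_setD lL in_children lp (negbTE (Pnx _ (iP _ vS))) andbF /= andbT.
  apply/imsetP => -[v' v'G]; case: (GP _ v'G) => [->|v'S|v'R].
  + by rewrite gx => E; rewrite E eqxx in lx.
  + by rewrite gS // => E; have := Pnl _ (iP _ v'S); rewrite -E lL.
  + rewrite gR // => E; have [_ _ lp'] := lfP _ (R2i _ v'R).
    have [/SsS1 a _] := svP (R2P _ v'R).
    have vv : v = sv v' by apply: ii => //; rewrite -lp -lp' E.
    by move: vZ; rewrite in_setD vv imset_f.
Qed.

End StarCase.

(** * Trees whose leaf parents are spread out *)

Section Averaging.
Import GRing.Theory Num.Theory Order.TTheory.
Local Open Scope ring_scope.

(** Double counting: the related pairs have total weight at least [k] times the weight of [A],
    shared among at most [N] members of [X]. *)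
Lemma averaging (I C : finType) (rl : I -> C -> bool) (w : I -> rat) (A : {set I}) (X : {set C})
    (k N : nat) :
  (forall i, 0 <= w i) -> X != set0 -> (#|X| <= N)%N ->
  (forall i, i \in A -> (k <= #|[set c in X | rl i c]|)%N) ->
  exists2 c, c \in X & k%:R * (\sum_(i in A) w i) <= N%:R * (\sum_(i in A | rl i c) w i).
Proof.
move=> w0 /set0Pn[c0 c0X] XN hk.
have [/exists_inP[c cX h]|no] := boolP [exists c in X,
  k%:R * (\sum_(i in A) w i) <= N%:R * (\sum_(i in A | rl i c) w i)]; first by exists c.
have lt c : c \in X -> N%:R * (\sum_(i in A | rl i c) w i) < k%:R * (\sum_(i in A) w i).
  by move=> cX; rewrite ltNge; apply: contra no => h; apply/exists_inP; exists c.
set T := \sum_(i in A) w i in lt.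
have T0 : 0 <= T by apply: sumr_ge0.
have N0 : (0 < N)%N by apply: leq_trans XN; rewrite card_gt0; apply/set0Pn; exists c0.
have dbl : k%:R * T <= \sum_(c in X) \sum_(i in A | rl i c) w i.
  have -> : \sum_(c in X) \sum_(i in A | rl i c) w i = \sum_(i in A) \sum_(c in X | rl i c) w i.
    rewrite (exchange_big_dep (mem A)) /=; last by move=> ? ? _ /andP[].
    by apply: eq_bigr => i iA; apply: eq_bigl => c; rewrite iA.
  rewrite /T mulr_sumr; apply: ler_sum => i iA.
  rewrite (eq_bigl (fun c => c \in [set c in X | rl i c])); last by move=> c; rewrite inE.
  by rewrite sumr_const -(mulr_natl (w i)) ler_wpM2r // ler_nat hk.
have : N%:R * (\sum_(c in X) \sum_(i in A | rl i c) w i) < N%:R * (k%:R * T).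
  rewrite mulr_sumr; apply: (@lt_le_trans _ _ (\sum_(c in X) (k%:R * T))).
    rewrite (bigD1 c0) //= [X in _ < X](bigD1 c0) //=; apply: ltr_leD; first exact: lt.
    by apply: ler_sum => c /andP[cX _]; apply/ltW/lt.
  rewrite sumr_const -(mulr_natl (k%:R * T)) ler_wpM2r ?ler_nat //.
  by apply: mulr_ge0 => //; rewrite ler0n.
rewrite ltr_pM2l ?ltr0n // => h; have := lt_le_trans h dbl; by rewrite ltxx.
Qed.

Section Potential.
Variables (V U : finType) (e ex : rel V) (par : U -> U) (P : {set U}) (b : nat).

Definition hits (S : {set U}) (f : U -> V) w := #|[set p in P :&: S | e w (f p)]|.
(** [ex] is tested at the image of the parent: if [w] is exceptional for it, the choice of [f p]
    among its neighbours cannot be steered towards [w]. *)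
Definition misses (S : {set U}) (f : U -> V) w := #|[set p in P :&: S | ex (f (par p)) w]|.
Definition theta : rat := 1 - b%:R^-1.
Definition weight S f w : rat := (2^-1) ^+ hits S f w * theta ^+ misses S f w.

Hypothesis b2 : (1 < b)%N.

Lemma theta_bounds : 0 < theta < 1.
Proof.
have b1 : (1 : rat) < b%:R by rewrite ltr1n.
by rewrite /theta; have := invf_lt1 (lt_trans ltr01 b1); have := invr_gt0 (b%:R : rat);
  rewrite b1 (lt_trans ltr01 b1); lra.
Qed.

Lemma weight_ge0 S f w : 0 <= weight S f w.
Proof.
by have /andP[h _] := theta_bounds; rewrite mulr_ge0 // exprn_ge0 // ltW.
Qed.

(** Some candidate is adjacent to vertices carrying a fraction [k / #|V| >= 2 / b] of the
    non-exceptional weight; halving that part removes at least [1 / b] of it. Exceptional vertices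
    get the factor [theta] from their miss, so the whole sum shrinks by [theta]. *)
Lemma potential_step (S : {set U}) (f : U -> V) q (X : {set V}) (k : nat) :
  par q \in S -> q \notin S -> q \in P -> (forall v, v \in P :&: S -> par v \in S) ->
  X != set0 -> (0 < k)%N -> (2 * #|V| <= k * b)%N ->
  (forall w, ~~ ex (f (par q)) w -> (k <= #|[set y in X | e w y]|)%N) ->
  exists2 y, y \in X &
    \sum_w weight (q |: S) (fupdate f q y) w <= theta * \sum_w weight S f w.
Proof.
move=> pS qS qP Sp X0 k0 kb hX; set u := f (par q).
pose A := [set w | ~~ ex u w].
have [|y yX hy] := @averaging V V e (weight S f) A X k #|V| (weight_ge0 S f) X0 (max_card _).
  by move=> w; rewrite inE => /hX.
exists y => //.
have nq v : v \in S -> v != q by move=> vS; apply: contraNneq qS => <-.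
have hit w : hits (q |: S) (fupdate f q y) w = (e w y + hits S f w)%N.
  rewrite /hits (cardsD1 q) !inE qP eqxx fupdate_eq /=; congr (_ + _)%N.
  apply: eq_card => p; rewrite !inE; case: (eqVneq p q) => [->|pq] /=.
    by rewrite (negbTE qS) andbF.
  by rewrite fupdate_neq.
have mis w : misses (q |: S) (fupdate f q y) w = (ex u w + misses S f w)%N.
  rewrite /misses (cardsD1 q) !inE qP eqxx (fupdate_neq _ _ (nq _ pS)) /=; congr (_ + _)%N.
  apply: eq_card => p; rewrite !inE; case: (eqVneq p q) => [->|pq] /=.
    by rewrite (negbTE qS) andbF.
  case: (boolP (p \in P)) => //= pP; case: (boolP (p \in S)) => //= pSS.
  by rewrite fupdate_neq // nq // Sp // inE pP.
have wt w : weight (q |: S) (fupdate f q y) w = (2^-1) ^+ (e w y) * theta ^+ (ex u w) * weight S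
  f w.
  by rewrite /weight hit mis !exprD mulrACA.
have /andP[t0 t1] := theta_bounds.
rewrite (bigID (fun w => ex u w)) [X in _ <= _ * X](bigID (fun w => ex u w)) /= mulrDr.
apply: lerD.
  rewrite mulr_sumr; apply: ler_sum => w exw; rewrite wt exw expr1.
  rewrite ler_wpM2r ?weight_ge0 //; apply: ler_piMl; first exact: ltW.
  by apply: exprn_ile1; lra.
have eA (F : V -> rat) : \sum_(w | ~~ ex u w) F w = \sum_(w in A) F w.
  by apply: eq_bigl => w; rewrite inE.
rewrite !eA; set T := \sum_(i in A) weight S f i in hy *.
set T1 := \sum_(i in A | e i y) weight S f i in hy.
have -> : \sum_(w in A) weight (q |: S) (fupdate f q y) w = T - 2^-1 * T1.
  rewrite /T /T1 (bigID (fun w => e w y)) [X in _ = X - _](bigID (fun w => e w y)) /=.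
  have -> : \sum_(i in A | e i y) weight (q |: S) (fupdate f q y) i =
            2^-1 * \sum_(i in A | e i y) weight S f i.
    rewrite mulr_sumr; apply: eq_bigr => w /andP[]; rewrite inE => /negbTE nx ew.
    by rewrite wt nx ew expr1 expr0 mulr1.
  have -> : \sum_(i in A | ~~ e i y) weight (q |: S) (fupdate f q y) i =
            \sum_(i in A | ~~ e i y) weight S f i.
    apply: eq_bigr => w /andP[]; rewrite inE => /negbTE nx /negbTE ew.
    by rewrite wt nx ew !expr0 !mul1r.
  lra.
have T0 : 0 <= T by apply: sumr_ge0 => w _; apply: weight_ge0.
have T10 : 0 <= T1 by apply: sumr_ge0 => w _; apply: weight_ge0.
suff : b%:R^-1 * T <= 2^-1 * T1 by rewrite /theta mulrBl mul1r; lra.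
have b0 : 0 < (b%:R : rat) by rewrite ltr0n; lia.
have k0' : 0 < (k%:R : rat) by rewrite ltr0n.
rewrite -(ler_pM2l b0) mulrA mulfV ?gt_eqF // mul1r -(ler_pM2l k0').
apply: le_trans hy _; rewrite !mulrA ler_wpM2r // -natrM -(ler_pM2r (x := 2)) // mulfVK //.
by rewrite -natrM ler_nat mulnC.
Qed.

End Potential.
End Averaging.

(** * Greedy placement of leaf parents with decreasing potential *)

Section SpreadCase.
Import Order.TTheory GRing.Theory Num.Theory.
Variables (V U : finType) (e ex : rel V) (t : rel U) (V1 W0 B : {set V}) (s b K1 K2 bq lam : nat).
Variables (r : U) (par : U -> U) (dep : U -> nat) (P : {set U}).
Hypotheses (eg : simple_graph e) (tsym : symmetric t).
Hypotheses (rt : rooted t r par dep) (card_UV : #|U| = #|V|).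
Hypotheses (join : joined e V1 s) (s0 : 0 < s).
Let D := max_degree t.
Let L := leaves t :\ r.
Let Y := (V1 :\: W0) :\: B.
Let X := par @: P.
(** The root is included so that the starting image avoids [Y], and the parents [X] because their
    exceptional sets have to be kept disjoint. *)
Let Q := r |: (P :|: X).
Hypotheses (BV1 : B \subset V1) (W0B : [disjoint W0 & B]).
Hypothesis degW0 : forall v, s * D <= #|nbhd e v :&: W0|.
Hypothesis degY : forall v, s * D <= #|nbhd e v :&: Y|.
Hypothesis Ylarge : 3 * s + 2 * s * D + #|~: L| <= #|Y|.
Hypothesis rP : r \notin P.
Hypothesis Pleaf : forall p, p \in P -> exists2 l, l \in L & par l = p.
Hypothesis Pspread : forall x, #|P :&: children r par x| <= K1.
Hypotheses (exsym : symmetric ex) (exfew : forall v, #|[set w | ex v w]| <= lam).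
Hypothesis degB : forall v w, ~~ ex v w -> bq <= #|nbhd e v :&: nbhd e w :&: B|.
(** Bounds the candidates to avoid: images of [Q], and vertices whose exceptional set meets that of
    an earlier image of [X], at most [lam * lam] for each of those. *)
Let F := #|Q| + #|P| * (lam * lam).
Hypotheses (b2 : 1 < b) (Fbq : F < bq) (avg : 2 * #|V| <= (bq - F) * b) (lamV : lam < #|V|).
Hypotheses (cardP : #|P| = K1 + K2) (final : #|V| * 2 ^ s * b.-1 ^ K2 < b ^ K2).

Let Lleaf l u : l \in L -> u != r -> par u != l.
Proof. by rewrite in_setD1 => /andP[lr lL]; apply: (leaf_no_child tsym rt lL lr). Qed.

Let PU0 p : p \in P -> p \in ~: L.
Proof.
case/Pleaf=> l; rewrite in_setD1 => /andP[lr _] <-; rewrite inE; apply/negP => /Lleaf.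
by move=> /(_ _ lr); rewrite eqxx.
Qed.

Let parU0 u : u != r -> par u \in ~: L.
Proof. by move=> ur; rewrite inE; apply/negP => /Lleaf /(_ ur); rewrite eqxx. Qed.

Let cD u : #|children r par u| <= D.
Proof. exact: card_children rt u. Qed.

Let degB1 v : bq <= #|nbhd e v :&: B|.
Proof.
have [w nw] : exists w, ~~ ex v w.
  apply/existsP; rewrite -negb_forall; apply/negP => /forallP h.
  have := exfew v; have -> : [set w | ex v w] = [set: V] by apply/setP => w; rewrite !inE h.
  by rewrite cardsT leqNgt lamV.
apply: leq_trans (degB nw) _; apply/subset_leq_card/setSI/subsetIl.
Qed.

Let Inv (S : {set U}) (f : U -> V) :=
  [/\ {in S, forall u, f u \in if u \in Q then B else Y},
      {in X :&: S &, forall x y, x != y -> forall w, ~~ (ex (f x) w && ex (f y) w)} &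
      (\sum_w weight e ex par P b S f w <= theta b ^+ #|P :&: S| * #|V|%:R)%R].

Let YB y : y \in Y -> y \notin B.
Proof. by rewrite in_setD => /andP[]. Qed.

Let weight_outside (S : {set U}) (f : U -> V) q y w : par q \in S -> q \notin S -> q \notin P ->
  {in P :&: S, forall v, par v \in S} ->
  weight e ex par P b (q |: S) (fupdate f q y) w = weight e ex par P b S f w.
Proof.
move=> pS qS qP Sp; rewrite /weight.
have nq v : v \in S -> v != q by move=> vS; apply: contraNneq qS => <-.
have PS v : (v \in P :&: (q |: S)) = (v \in P :&: S).
  by rewrite !inE; case: eqVneq => [->|] //=; rewrite (negbTE qP).
congr (_ ^+ _ * _ ^+ _)%R; apply: eq_card => v; rewrite !inE.
  case: (eqVneq v q) => [->|vq]; first by rewrite (negbTE qP).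
  by rewrite fupdate_neq.
case: (boolP (v \in P)) => //= vP; case: (eqVneq v q) => [vq|vq] /=.
  by rewrite vq (negbTE qP) in vP.
case: (boolP (v \in S)) => //= vS; rewrite fupdate_neq // nq // Sp //.
by rewrite inE vP.
Qed.

Let Inv_spread (S : {set U}) (f : U -> V) q y : q \notin S ->
  {in X :&: S &, forall x y, x != y -> forall w, ~~ (ex (f x) w && ex (f y) w)} ->
  (q \in X -> forall x, x \in X :&: S -> forall w, ~~ (ex (f x) w && ex y w)) ->
  {in X :&: (q |: S) &, forall x z, x != z ->
     forall w, ~~ (ex (fupdate f q y x) w && ex (fupdate f q y z) w)}.
Proof.
move=> qS hS hq x z; rewrite !in_setI !in_setU1 => /andP[xX xq] /andP[zX zq] xz w.
case: (eqVneq x q) xq => [xe _|xne /= xS].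
  case: (eqVneq z q) zq => [ze _|zne /= zS]; first by rewrite xe ze eqxx in xz.
  rewrite xe fupdate_eq fupdate_neq // andbC; apply: hq; rewrite -?xe // inE zX zS //.
rewrite (fupdate_neq _ _ xne).
case: (eqVneq z q) zq => [ze _|zne /= zS].
  by rewrite ze fupdate_eq; apply: hq; rewrite -?ze // inE xX xS.
by rewrite fupdate_neq //; apply: hS; rewrite ?inE ?xX ?zX.
Qed.

Let Inv_image (S : {set U}) (f : U -> V) q y : q \notin S ->
  {in S, forall u, f u \in if u \in Q then B else Y} ->
  y \in (if q \in Q then B else Y) ->
  {in q |: S, forall u, fupdate f q y u \in if u \in Q then B else Y}.
Proof.
move=> qS hS hy u; rewrite in_setU1; case: (eqVneq u q) => [->|uq /= uS].
  by rewrite fupdate_eq.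
by rewrite fupdate_neq //; apply: hS.
Qed.

Let spread_step (S : {set U}) (f : U -> V) q : partial_embedding e r par (~: L) S f -> Inv S f ->
  q \in ~: L -> q \notin S -> par q \in S -> q \in Q ->
  exists y, [/\ y \notin Y, y \notin f @: S, e (f (par q)) y & Inv (q |: S) (fupdate f q y)].
Proof.
case=> _ rS Sp _ _ [hB hX hW] qU qS pS qQ.
have qr : q != r by apply: contraNneq qS => ->.
set u := f (par q).
have PSp : {in P :&: S, forall v, par v \in S}.
  move=> v /setIP[vP vS]; apply: Sp => //; by apply: contraNneq rP => <-.
pose near_used := [set y | [exists x in X :&: S, [exists w, ex (f x) w && ex y w]]].
pose used := f @: (Q :&: S).
have cused : #|used :|: near_used| <= F.
  apply: leq_trans (leq_card_setU _ _) _; apply: leq_add.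
    by apply: leq_trans (leq_imset_card _ _) (subset_leq_card (subsetIl _ _)).
  have : near_used \subset \bigcup_(x in X :&: S) \bigcup_(w in [set w | ex (f x) w]) [set y | ex
    w y].
    apply/subsetP => y; rewrite inE => /existsP[x /andP[xXS /existsP[w /andP[xw yw]]]].
    apply/bigcupP; exists x => //; apply/bigcupP; exists w; rewrite inE // exsym //.
  move/subset_leq_card/leq_trans; apply; apply: leq_trans (card_bigcup_leq _ _) _.
  apply: (@leq_trans (\sum_(x in X :&: S) lam * lam)); last first.
    rewrite sum_nat_const leq_mul2r; apply/orP; right.
    by apply: leq_trans (subset_leq_card (subsetIl _ _)) (leq_imset_card _ _).
  apply: leq_sum => x _; apply: leq_trans (card_bigcup_leq _ _) _.
  apply: (@leq_trans (\sum_(w in [set w | ex (f x) w]) lam)); first by apply: leq_sum.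
  by rewrite sum_nat_const leq_mul2r exfew orbT.
pose Cand := (nbhd e u :&: B) :\: (used :|: near_used).
have big (A : {set V}) : bq <= #|A| -> bq - F <= #|A :\: (used :|: near_used)|.
  move=> h; have := cardsID (used :|: near_used) A.
  have := subset_leq_card (subsetIr A (used :|: near_used)).
  move: h cused; clear; lia.
have Cand_ok y : y \in Cand -> [/\ y \in B, y \notin Y, y \notin f @: S, e u y &
    forall x, x \in X :&: S -> forall w, ~~ (ex (f x) w && ex y w)].
  rewrite in_setD in_setU negb_or => /andP[/andP[yu yn] /setIP[+ yB]]; rewrite inE => ey.
  split=> //.
  - by apply: contraTN yB => /YB.
  - apply: contra yu => /imsetP[v vS E]; apply/imsetP; exists v => //.
    rewrite inE vS andbT; have := hB v vS; case: (v \in Q) => //.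
    by rewrite -E => /YB; rewrite yB.
  - move=> x xX w; apply: contra yn => h; rewrite inE; apply/existsP; exists x; rewrite xX.
    by apply/existsP; exists w.
have [qP|qP] := boolP (q \in P); last first.
  have [y yC] : exists y, y \in Cand.
    apply: card_gt0_ex; apply: leq_trans (big _ (degB1 u)); rewrite subn_gt0 //.
  have [yB yY yS ey yX] := Cand_ok y yC.
  exists y; split=> //; split.
  - by apply: Inv_image; rewrite ?qQ.
  - by apply: Inv_spread.
  - have -> : P :&: (q |: S) = P :&: S.
      by apply/setP => v; rewrite !inE; case: eqVneq => [->|] //=; rewrite (negbTE qP).
    by under eq_bigr do rewrite weight_outside //.
have [||||y yC hy] := @potential_step V U e ex par P b b2 S f q Cand (bq - F) pS qS qP PSp.
- by rewrite -card_gt0; apply: leq_trans (big _ (degB1 u)); rewrite subn_gt0.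
- by rewrite subn_gt0.
- exact: avg.
- move=> w nw; apply: leq_trans (big _ (degB nw)) _; apply/subset_leq_card/subsetP => y.
  by rewrite /Cand !in_setD !in_setI [y \in [set _ in _ | _]]inE !in_setD !in_setI !inE
    => /andP[-> /andP[/andP[-> ->] ->]].
have [yB yY yS ey yX] := Cand_ok y yC.
exists y; split=> //; split.
- by apply: Inv_image; rewrite ?qQ.
- by apply: Inv_spread.
have -> : #|P :&: (q |: S)| = #|P :&: S|.+1.
  rewrite (cardsD1 q) !inE qP eqxx /= add1n; congr _.+1; apply: eq_card => v.
  by rewrite !inE; case: (eqVneq v q) => [->|] //=; rewrite (negbTE qS) andbF.
apply: le_trans hy _; rewrite exprS -mulrA; apply: ler_wpM2l => //.
by have /andP[/ltW] := theta_bounds b2.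
Qed.

(** If [w] were hit fewer than [s] times, its weight would be at least [2^-s * theta ^ K1], as
    disjoint exceptional sets confine its misses to the children of one vertex. By [final] this
    exceeds the whole potential [theta ^ (K1 + K2) * #|V|]. *)
Lemma spread_case : contains_copy e t.
Proof.
have [esym eirr] := eg.
have rU0 : r \in ~: L by rewrite !inE eqxx.
have YV1 : Y \subset V1 by apply: subset_trans (subsetDl _ _) (subsetDl _ _).
have V0 : 0 < #|V| by apply: leq_ltn_trans lamV.
have [v0 _] := card_gt0_ex (A := [set: V]) (eq_ind_r (fun k => 0 < k) V0 (cardsT V)).
have [b0] : exists b0, b0 \in nbhd e v0 :&: B.
  by apply: card_gt0_ex; apply: leq_trans (degB1 v0); apply: leq_ltn_trans Fbq.
rewrite in_setI => /andP[_ b0B].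
have im0 : (fun=> b0) @: [set r] = [set b0] by rewrite imset_set1.
have [f [fpe [fB fX fW]]] : exists f, partial_embedding e r par (~: L) (~: L) f /\ Inv (~: L) f.
  apply: (@grow_embedding V U e r par (~: L) Y D s cD _ dep Q Inv [set r] (fun=> b0)) => //.
  - exact: (expand_large_of_joined esym join YV1 Ylarge).
  - by move=> v vr; rewrite (dep_par rt vr).
  - by move=> v _; apply: parU0.
  - move=> S f q y [_ rS Sp _ _] [hB hX hW] qU qS pS qQ yY yS.
    have qP : q \notin P by apply: contra qQ => qP; rewrite !inE qP orbT.
    have qX : q \notin X by apply: contra qQ => qX; rewrite !inE qX !orbT.
    split.
    + by apply: Inv_image; rewrite ?(negbTE qQ).
    + by apply: Inv_spread => //; rewrite (negbTE qX).
    + have -> : P :&: (q |: S) = P :&: S.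
        by apply/setP => v; rewrite !inE; case: eqVneq => [->|] //=; rewrite (negbTE qP).
      have PSp : {in P :&: S, forall v, par v \in S}.
        by move=> v /setIP[vP vS]; apply: Sp => //; apply: contraNneq rP => <-.
      by under eq_bigr do rewrite weight_outside //.
  - split.
    + by rewrite sub1set.
    + by rewrite set11.
    + by move=> v /set1P ->; rewrite eqxx.
    + by move=> u v /set1P -> /set1P ->.
    + by move=> v /set1P ->; rewrite eqxx.
  - apply: (extendable_disjoint cD).
    + exact: (expand_small_of_degree degY).
    + exact: (expand_large_of_joined esym join YV1 Ylarge).
    + by rewrite set11.
    + by move=> u v /set1P -> /set1P ->.
    + by rewrite im0 disjoints1; apply: contraTN b0B => /YB.
  - split.
    + by move=> u /set1P ->; rewrite /Q setU11.
    + by move=> x y /setIP[_ /set1P ->] /setIP[_ /set1P ->]; rewrite eqxx.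
    + have PS0 : P :&: [set r] = set0.
        by apply/setP => v; rewrite !inE; case: eqVneq => [->|]; rewrite ?andbF ?(negbTE rP).
      rewrite PS0 cards0 expr0 mul1r.
      have w1 w : weight e ex par P b [set r] (fun=> b0) w = 1%R.
        rewrite /weight /hits /misses PS0.
        by rewrite !(eq_card0 (A := [set _ in set0 | _])) ?expr0 ?mulr1 // => v; rewrite !inE.
      by under eq_bigr do rewrite w1; rewrite sumr_const.
have fi : {in ~: L &, injective f} by case: fpe.
have W0Y u : u \in ~: L -> f u \notin W0.
  move=> uU; have := fB u uU; case: ifP => _; first by move=> h; rewrite (disjointFl W0B h).
  by rewrite !in_setD => /and3P[].
have hitsP w : s <= hits e P (~: L) f w.
  rewrite leqNgt; apply/negP => hs.
  have ms : misses ex par P (~: L) f w <= K1.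
    have [M0|/set0Pn[p0]] := eqVneq [set p in P :&: ~: L | ex (f (par p)) w] set0.
      by rewrite /misses M0 cards0.
    rewrite inE in_setI => /andP[/andP[p0P p0L] ex0].
    apply: leq_trans (Pspread (par p0)); apply/subset_leq_card/subsetP => p.
    rewrite inE !in_setI => /andP[/andP[pP pL] exp]; rewrite pP in_children.
    have pr p' : p' \in P -> p' != r by move=> h; apply: contraNneq rP => <-.
    rewrite pr //=; apply/eqP/eqP/negPn/negP => ne.
    have inX p' : p' \in P -> par p' \in X :&: ~: L.
      by move=> h; rewrite in_setI imset_f //= parU0 // pr.
    by have := fX _ _ (inX _ pP) (inX _ p0P) ne w; rewrite exp ex0.
  have /andP[t0 t1] := theta_bounds b2.
  have PL : P :&: ~: L = P by apply/setIidPl/subsetP.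
  have lew : (weight e ex par P b (~: L) f w <= theta b ^+ (K1 + K2) * #|V|%:R)%R.
    rewrite -cardP -{2}PL; apply: le_trans fW; rewrite (bigD1 w) //= lerDl.
    by apply: sumr_ge0 => v _; apply: weight_ge0.
  have : (2^-1 ^+ s * theta b ^+ K1 <= theta b ^+ (K1 + K2) * #|V|%:R :> rat)%R.
    apply: le_trans lew; rewrite /weight; apply: ler_pM.
    - by rewrite exprn_ge0.
    - by rewrite exprn_ge0 // ltW.
    - by apply: ler_wiXn2l => //; exact: (ltnW hs).
    - by apply: ler_wiXn2l => //; rewrite ltW.
  rewrite exprD [(_ * theta b ^+ K1)%R]mulrC -mulrA ler_pM2l ?exprn_gt0 //.
  have bpos : (0 < b%:R :> rat)%R by rewrite ltr0n; apply: ltnW.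
  have tE : theta b = (b.-1%:R / b%:R)%R.
    by rewrite /theta -subn1 natrB ?(ltnW b2) // mulrBl mulfV ?gt_eqF // mul1r.
  rewrite tE expr_div_n exprVn.
  rewrite -(ler_pM2l (x := (2 ^+ s * b%:R ^+ K2)%R)); last by rewrite mulr_gt0 ?exprn_gt0.
  have -> : (2 ^+ s * b%:R ^+ K2 * (2 ^+ s)^-1 = b%:R ^+ K2 :> rat)%R.
    by rewrite mulrAC mulfV ?mul1r // expf_neq0.
  have -> : (2 ^+ s * b%:R ^+ K2 * (b.-1%:R ^+ K2 / b%:R ^+ K2 * #|V|%:R) =
             #|V|%:R * 2 ^+ s * b.-1%:R ^+ K2 :> rat)%R.
    by field; rewrite expf_neq0 // gt_eqF.
  by rewrite -!natrX -!natrM ler_nat leqNgt final.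
apply: (@finish_leaves V U e t r par dep V1 s D L f) => //.
- move=> l; rewrite in_setD1 => /andP[lr _]; have := fB _ (parU0 lr).
  by case: ifP => _; [move/(subsetP BV1) | move/(subsetP YV1)].
- move=> l lL; apply: leq_trans (degW0 (f (par l))) _; apply/subset_leq_card/subsetP => w.
  rewrite in_setI in_setD => /andP[-> wW]; rewrite andbT.
  by apply/imsetP => -[u uU wf]; have := W0Y u uU; rewrite -wf wW.
- move=> w wf; apply: leq_trans (hitsP w) _.
  pose lf p := odflt r [pick l in L | par l == p].
  have lfP p : p \in P -> lf p \in L /\ par (lf p) = p.
    rewrite /lf => /Pleaf[l lL lp]; case: pickP => [l' /andP[? /eqP] //|/(_ l)].
    by rewrite lL lp eqxx.
  rewrite /hits -(card_in_imset (f := lf)); last first.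
    move=> p q; rewrite !inE => /andP[/andP[pP _] _] /andP[/andP[qP _] _] E.
    by have [_ <-] := lfP _ pP; have [_ <-] := lfP _ qP; rewrite E.
  apply/subset_leq_card/subsetP => l /imsetP[p].
  rewrite inE => /andP[/setIP[pP _] ew] ->; have [lL lp] := lfP _ pP.
  by rewrite inE lL lp.
Qed.

End SpreadCase.

(** * Connecting by disjoint paths *)

Lemma card_setD_ge (T : finType) (A B : {set T}) : #|A| - #|B| <= #|A :\: B|.
Proof.
by rewrite leq_subLR -(cardsID B A) leq_add2r; apply/subset_leq_card/subsetIr.
Qed.

Section Connecting.
Variables (V : finType) (e : rel V) (V1 : {set V}) (s : nat).
Hypotheses (esym : symmetric e) (join : joined e V1 s).

(** Each step withholds [2 * s] vertices of [A]; joinedness leaves fewer than [s] of them without a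
    neighbour among the current ends, so at least [s] become new ends. The paths may overlap, as
    only one of them is ever used. *)
Lemma reachable_ends l (A : {set V}) u : A \subset V1 -> s <= #|nbhd e u :&: A| ->
  s + 2 * s * l <= #|A| ->
  exists Y : {set V}, [/\ Y \subset A, s <= #|Y| & forall y, y \in Y ->
    exists p, [/\ size p = l.+1, uniq p, {subset p <= A}, path e u p & last u p = y]].
Proof.
elim: l A => [|l IH] A AV1 uA cA.
  exists (nbhd e u :&: A); split=> //; first exact: subsetIr.
  move=> y; rewrite !inE => /andP[uy yA]; exists [:: y]; rewrite /= uy; split=> // x.
  by rewrite inE => /eqP ->.
(* These neighbours of [u] stay out of the withheld set [X], so the induction hypothesis can start
   from them. *)
have [Y1 [Y1s Y1c]] := subset_of_card uA.
have Y1A : Y1 \subset A by apply: subset_trans Y1s (subsetIr _ _).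
have [X [XA Xc]] : exists B : {set V}, B \subset A :\: Y1 /\ #|B| = 2 * s.
  apply: subset_of_card; apply: leq_trans (card_setD_ge _ _); rewrite Y1c.
  by move: cA; clear; lia.
have XA' : X \subset A by apply: subset_trans XA (subsetDl _ _).
have [||| Y [YA Yc Yp]] := IH (A :\: X).
- exact: subset_trans (subsetDl _ _) AV1.
- rewrite -Y1c; apply/subset_leq_card/subsetP => y yY; have := subsetP Y1s y yY.
  rewrite in_setI in_setI in_setD => /andP[-> ->]; rewrite /= andbT.
  by apply/negP => /(subsetP XA); rewrite in_setD yY.
- by apply: leq_trans (card_setD_ge _ _); rewrite Xc; move: cA; clear; lia.
pose Y' := [set x in X | [exists y in Y, e y x]].
exists Y'; split.
- by apply: subset_trans XA'; apply/subsetP => x; rewrite inE => /andP[].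
- rewrite leqNgt; apply/negP => Y's.
  have sX : s <= #|X :\: Y'|.
    by apply: leq_trans (card_setD_ge _ _); rewrite Xc; move: Y's; clear; lia.
  have [||a [b [aX bY eab]]] := join _ sX Yc.
  + apply: subset_trans (subsetDl _ _) (subset_trans XA' AV1).
  + rewrite -setI_eq0; apply/eqP/setP => x; rewrite in_set0 in_setI in_setD.
    apply/negbTE/negP => /andP[/andP[_ xX] /(subsetP YA)]; by rewrite in_setD xX.
  + move: aX; rewrite in_setD => /andP[/negP aN aX]; apply: aN; rewrite inE aX.
    by apply/existsP; exists b; rewrite bY esym.
- move=> x; rewrite inE => /andP[xX /existsP[y /andP[yY eyx]]].
  have [p [sp up pA pp lp]] := Yp y yY.
  exists (rcons p x); rewrite size_rcons sp rcons_uniq up rcons_path pp lp eyx last_rcons.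
  split=> //.
    by rewrite andbT; apply/negP => /pA; rewrite in_setD xX.
  move=> z; rewrite mem_rcons inE => /orP[/eqP ->|/pA]; first exact: (subsetP XA').
  by rewrite in_setD => /andP[].
Qed.

(** Withhold [s] neighbours of [v]; joinedness links them to the ends reached from [u]. *)
Lemma connect_through l (A : {set V}) u v : A \subset V1 ->
  2 * s <= #|nbhd e u :&: A| -> 2 * s <= #|nbhd e v :&: A| -> 2 * s + 2 * s * l <= #|A| ->
  exists p, [/\ size p = l.+2, uniq p, {subset p <= A} & path e u (rcons p v)].
Proof.
move=> AV1 uA vA cA.
have [B [Bs Bc]] : exists B : {set V}, B \subset nbhd e v :&: A /\ #|B| = s.
  by apply: subset_of_card; move: vA; clear; lia.
have BA : B \subset A by apply: subset_trans Bs (subsetIr _ _).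
have [||| Y [YA Yc Yp]] := @reachable_ends l (A :\: B) u.
- exact: subset_trans (subsetDl _ _) AV1.
- rewrite setIDA; apply: leq_trans (card_setD_ge _ _); rewrite Bc; move: uA; clear; lia.
- by apply: leq_trans (card_setD_ge _ _); rewrite Bc; move: cA; clear; lia.
have [||y [b [yY bB eyb]]] := join _ Yc (eq_leq (Logic.eq_sym Bc)).
- by apply: subset_trans YA (subset_trans (subsetDl _ _) AV1).
- rewrite -setI_eq0; apply/eqP/setP => x; rewrite in_set0 in_setI.
  apply/negbTE/negP => /andP[/(subsetP YA) + xB]; by rewrite in_setD xB.
have [p [sp up pA pp lp]] := Yp y yY.
exists (rcons p b); rewrite size_rcons sp rcons_uniq up !rcons_path pp lp eyb last_rcons.
split=> //.
- by rewrite andbT; apply/negP => /pA; rewrite in_setD bB.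
- move=> z; rewrite mem_rcons inE => /orP[/eqP ->|/pA]; first exact: (subsetP BA).
  by rewrite in_setD => /andP[].
- by have := subsetP Bs b bB; rewrite !inE esym => /andP[->].
Qed.

Section Family.
Variables (I : finType) (src dst : I -> V) (len : I -> nat) (q : nat).

Definition linked (J : {set I}) (A : {set V}) (P : I -> seq V) : Prop :=
  {in J, forall i, [/\ size (P i) = len i, uniq (P i), {subset P i <= A} &
     path e (src i) (rcons (P i) (dst i))]} /\
  {in J &, forall i j, i != j -> forall x, x \in P i -> x \notin P j}.

Lemma linkedS J (A A' : {set V}) P : A \subset A' -> linked J A P -> linked J A' P.
Proof.
move=> AA' [h1 h2]; split=> // i /h1[? ? h ?]; split=> // x /h; exact: (subsetP AA').
Qed.

Lemma linked_fupdate (J : {set I}) A P i p : i \notin J -> linked J (A :\: [set x in p]) P ->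
  size p = len i -> uniq p -> {subset p <= A} -> path e (src i) (rcons p (dst i)) ->
  linked (i |: J) A (fupdate P i p).
Proof.
move=> iJ [h1 h2] sp up pA pp.
have nJ j : j \in J -> j != i by move=> jJ; apply: contraNneq iJ => <-.
have pP j x : j \in J -> x \in P j -> x \notin p.
  by move=> jJ xj; have [_ _ /(_ x xj) + _] := h1 j jJ; rewrite in_setD inE => /andP[].
split=> [j|j k]; rewrite !in_setU1.
  case: (eqVneq j i) => [-> _|ji /= jJ]; first by rewrite fupdate_eq.
  rewrite fupdate_neq //; have [? ? h ?] := h1 j jJ; split=> // x /h.
  by rewrite in_setD => /andP[].
case: (eqVneq j i) => [-> _|ji /= jJ]; case: (eqVneq k i) => [-> _|ki /= kJ] jk x.
- by move: jk; rewrite ?eqxx.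
- rewrite fupdate_eq fupdate_neq //; apply: contraTN; exact: pP.
- by rewrite fupdate_eq fupdate_neq //; apply: pP.
- by rewrite !fupdate_neq //; apply: h2.
Qed.

Hypothesis lenP : forall i, 2 <= len i <= q.

Lemma connect_one i (A : {set V}) : A \subset V1 -> 2 * s <= #|nbhd e (src i) :&: A| ->
  2 * s <= #|nbhd e (dst i) :&: A| -> 2 * s + 2 * s * q <= #|A| ->
  exists p, [/\ size p = len i, uniq p, {subset p <= A} & path e (src i) (rcons p (dst i))].
Proof.
move=> AV1 h1 h2 h3; have /andP[l2 lq] := lenP i.
have -> : len i = (len i - 2).+2 by move: l2; clear; lia.
apply: connect_through => //; apply: leq_trans h3; rewrite leq_add2l leq_mul2l.
by apply/orP; right; apply: leq_trans (leq_subr _ _) lq.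
Qed.

Lemma connect_few (J : {set I}) (A : {set V}) : A \subset V1 ->
  (forall v, 2 * s + q * #|J| <= #|nbhd e v :&: A|) ->
  2 * s + 2 * s * q + q * #|J| <= #|A| ->
  exists P, linked J A P.
Proof.
elim: {J}#|J| {-2}J (erefl #|J|) A => [|k IH] J Jk A AV1 rich cA.
  by exists (fun=> [::]); move/eqP: Jk; rewrite cards_eq0 => /eqP ->; split=> i; rewrite inE.
have [i iJ] : exists i, i \in J by apply: card_gt0_ex; rewrite Jk.
have [|||p [sp up pA pp]] := @connect_one i A AV1.
- by apply: leq_trans (rich _); apply: leq_addr.
- by apply: leq_trans (rich _); apply: leq_addr.
- by apply: leq_trans cA; apply: leq_addr.
have Jk' : #|J :\ i| = k by move: Jk; rewrite (cardsD1 i) iJ => -[].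
have cp : #|[set x in p]| <= q.
  by rewrite cardsE (card_uniqP up) sp; have /andP[] := lenP i.
have [|||P hP] := IH (J :\ i) Jk' (A :\: [set x in p]).
- exact: subset_trans (subsetDl _ _) AV1.
- move=> v; rewrite setIDA; apply: leq_trans (card_setD_ge _ _).
  move: (rich v) cp; rewrite Jk Jk' mulnS; clear; lia.
- apply: leq_trans (card_setD_ge _ _); move: cA cp; rewrite Jk Jk' mulnS; clear; lia.
exists (fupdate P i p); rewrite -(setD1K iJ); apply: linked_fupdate => //.
by rewrite setD11.
Qed.

(* Any [s] vertices with fewer than [2 s] neighbours in [A] would miss [s]
   vertices of [A]; so fewer than [s] vertices are ever stuck, and the at most
   [2 s] requests they block are served through [Z]. *)
Lemma connect_all (J : {set I}) (A Z : {set V}) : A :|: Z \subset V1 -> [disjoint A & Z] ->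
  (forall v, #|[set i in J | (src i == v) || (dst i == v)]| <= 2) ->
  (forall v, 2 * s + q * (2 * s) <= #|nbhd e v :&: Z|) ->
  \sum_(i in J) len i + (2 * s * s + 4 * s + 4 * s * q) <= #|A| ->
  exists P, linked J (A :|: Z) P.
Proof.
elim: {J}#|J| {-2}J (erefl #|J|) A => [|k IH] J Jk A AV1 dAZ mult rich cA.
  by exists (fun=> [::]); move/eqP: Jk; rewrite cards_eq0 => /eqP ->; split=> i; rewrite inE.
pose stuck := [set v | #|nbhd e v :&: A| < 2 * s].
have A1 : A \subset V1 by apply: subset_trans (subsetUl _ _) AV1.
have [/existsP[i /and3P[iJ is_ id_]]|none] :=
    boolP [exists i, [&& i \in J, src i \notin stuck & dst i \notin stuck]].
  have [|||p [sp up pA pp]] := @connect_one i A A1.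
  - by move: is_; rewrite inE -leqNgt.
  - by move: id_; rewrite inE -leqNgt.
  - by move: cA; clear; nia.
  have Jk' : #|J :\ i| = k by move: Jk; rewrite (cardsD1 i) iJ => -[].
  have cp : #|[set x in p]| = len i by rewrite cardsE (card_uniqP up) sp.
  have sum : \sum_(j in J) len j = len i + \sum_(j in J :\ i) len j.
    by rewrite (big_setD1 i).
  have [|||||P hP] := IH (J :\ i) Jk' (A :\: [set x in p]) => //.
  - by apply: subset_trans AV1; apply/setSU/subsetDl.
  - exact: disjointWl (subsetDl _ _) dAZ.
  - move=> v; apply: leq_trans (mult v); apply/subset_leq_card/subsetP => j.
    by rewrite !inE => /andP[/andP[_ ->] ->].
  - by apply: leq_trans (card_setD_ge _ _); move: cA; rewrite cp sum; clear; lia.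
  exists (fupdate P i p); rewrite -(setD1K iJ); apply: linked_fupdate => //.
  - by rewrite setD11.
  - apply: linkedS hP; apply/subsetP => x; rewrite in_setU !in_setD in_setU.
    case/orP=> [/andP[-> ->] //|xZ]; rewrite xZ orbT andbT inE.
    by apply/negP => /pA xA; rewrite (disjointFr dAZ xA) in xZ.
  - by move=> x /pA xA; rewrite in_setU xA.
have cstuck : #|stuck| < s.
  rewrite ltnNge; apply/negP => /subset_of_card[B [Bst Bc]].
  pose A' := (A :\: \bigcup_(v in B) (nbhd e v :&: A)) :\: B.
  have cN : #|\bigcup_(v in B) (nbhd e v :&: A)| <= s * (2 * s).
    apply: leq_trans (card_bigcup_leq _ _) _; rewrite -{1}Bc -sum_nat_const.
    by apply: leq_sum => v /(subsetP Bst); rewrite inE => /ltnW.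
  have sA' : s <= #|A'|.
    apply: leq_trans (card_setD_ge _ _).
    have := card_setD_ge A (\bigcup_(v in B) (nbhd e v :&: A)).
    by move: cN cA; rewrite Bc; clear; nia.
  have [||a [b [aA bB eab]]] := join _ sA' (eq_leq (Logic.eq_sym Bc)).
  - by apply: subset_trans A1; apply: subset_trans (subsetDl _ _) (subsetDl _ _).
  - by rewrite -setI_eq0 /A' setDE -setIA [~: B :&: B]setIC setICr setI0.
  - move: aA; rewrite !in_setD => /and3P[_ /negP aN aA]; apply: aN.
    by apply/bigcupP; exists b; rewrite // !inE esym eab.
have cJ : #|J| <= 2 * s.
  apply: (@leq_trans (\sum_(v in stuck) 2)); last first.
    by rewrite sum_nat_const; move: cstuck; clear; lia.
  apply: (@leq_trans (\sum_(v in stuck) #|[set i in J | (src i == v) || (dst i == v)]|)).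
    apply: leq_trans (card_bigcup_leq _ _); apply/subset_leq_card/subsetP => i iJ.
    move: none; rewrite negb_exists => /forallP /(_ i); rewrite iJ /= negb_and !negbK.
    by case/orP=> st; apply/bigcupP; [exists (src i)|exists (dst i)];
      rewrite // inE iJ eqxx ?orbT.
  by apply: leq_sum.
apply: connect_few => //.
- move=> v; apply: (@leq_trans #|nbhd e v :&: Z|).
    by apply: leq_trans (rich v); rewrite leq_add2l leq_mul2l cJ orbT.
  by apply/subset_leq_card/setIS/subsetUr.
- apply: (@leq_trans #|A|); last by apply/subset_leq_card/subsetUl.
  by move: cA cJ; clear; nia.
Qed.

End Family.
End Connecting.

(** * Bare paths *)

Section BarePaths.
Variables (U : finType) (t : rel U) (r : U) (par : U -> U) (dep : U -> nat) (q : nat).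
Hypotheses (tsym : symmetric t) (rt : rooted t r par dep) (q0 : 0 < q).

Definition interior (H : {set U}) (c : U -> U) : {set U} :=
  [set v | [exists h in H, [exists j : 'I_q, v == iter j c h]]].

Lemma interiorP (H : {set U}) (c : U -> U) v : reflect (exists h j, [/\ h \in H, j < q & v = iter
  j c h])
  (v \in interior H c).
Proof.
rewrite inE; apply: (iffP exists_inP) => [[h hH /existsP[j /eqP ->]]|[h [j [hH jq ->]]]].
  by exists h, j.
by exists h => //; apply/existsP; exists (Ordinal jq).
Qed.

(* The heads in [H] start disjoint vertical bare paths [h, c h, ..., c^(q-1) h]. *)
Definition bare_paths (H : {set U}) (c : U -> U) : Prop :=
  [/\ {in H, forall h, [/\ h != r, par h \notin interior H c & iter q c h \notin interior H c]},
      {in H, forall h j, j < q -> iter j.+1 c h != r /\ par (iter j.+1 c h) = iter j c h},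
      {in H &, forall h k i j, i < q -> j < q -> iter i c h = iter j c k -> h = k /\ i = j},
      (forall v, v != r -> v \notin interior H c -> par v \in interior H c ->
         exists2 h, h \in H & v = iter q c h) &
      {in H &, injective par}].

Let C1 := [set v | (v != r) && (#|children r par v| == 1)].
Let c v := odflt v [pick w in children r par v].

Let cP v : v \in C1 -> c v != r /\ par (c v) = v.
Proof.
rewrite inE => /andP[_ /cards1P[w ew]]; rewrite /c ew.
case: pickP => [w' /set1P ->|/(_ w)]; last by rewrite set11.
by have : w \in children r par v by [rewrite ew set11]; rewrite in_children => /andP[? /eqP].
Qed.

Let c_par w : w != r -> par w \in C1 -> c (par w) = w.
Proof.
move=> wr pw; have [cr cp] := cP pw; move: pw; rewrite inE => /andP[_ /cards1P[x ex]].
have : w \in children r par (par w) by rewrite in_children wr eqxx.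
have : c (par w) \in children r par (par w) by rewrite in_children cr cp eqxx.
by rewrite ex => /set1P -> /set1P ->.
Qed.

(** The position of [v] below the top of its run of single-child vertices. The fuel is the depth, so
    it cannot run out before the root is reached. *)
Fixpoint chain_index (k : nat) (v : U) : nat :=
  if k is k'.+1 then (if par v \in C1 then (chain_index k' (par v)).+1 else 0) else 0.
Let idx v := chain_index (dep v) v.

Let idx_c v : v \in C1 -> idx (c v) = (idx v).+1.
Proof. by move=> vC; have [cr cp] := cP vC; rewrite /idx (dep_par rt cr) /= cp vC. Qed.

Let idx_par v : v != r -> 0 < idx v -> par v \in C1 /\ idx v = (idx (par v)).+1.
Proof. by move=> vr; rewrite /idx (dep_par rt vr) /=; case: ifP. Qed.

(** The modulus exceeds the length [q] by one, so consecutive paths in a run are separated by one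
    vertex of index 0 modulo [q.+1], an end for both. Residue 1 makes the parent of a head a member
    of [C1], whence [par] is injective on heads. *)
Let H := [set h in C1 | (idx h %% q.+1 == 1) && [forall j : 'I_q, iter j c h \in C1]].

Let HC h j : h \in H -> j < q -> iter j c h \in C1.
Proof. by rewrite inE => /and3P[_ _ /forallP a] jq; apply: (a (Ordinal jq)). Qed.

Let Hidx h j : h \in H -> j <= q -> idx (iter j c h) = idx h + j.
Proof.
move=> hH; elim: j => [|j IH] jq; first by rewrite addn0.
by rewrite iterS idx_c ?HC // IH ?addnS // ltnW.
Qed.

Let Hmod h j : h \in H -> j <= q -> idx (iter j c h) %% q.+1 = j.+1 %% q.+1.
Proof.
move=> hH jq; rewrite Hidx // -modnDml; move: hH; rewrite inE => /and3P[_ /eqP -> _].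
by rewrite add1n.
Qed.

Let int_mod v : v \in interior H c -> 0 < idx v %% q.+1.
Proof. by case/interiorP => h [j [hH jq ->]]; rewrite (Hmod hH (ltnW jq)) modn_small. Qed.

Let Hr h : h \in H -> h != r.
Proof. by rewrite !inE => /and3P[/andP[]]. Qed.

Let Hpar h : h \in H -> par h \in C1 /\ idx h = (idx (par h)).+1.
Proof.
move=> hH; apply: idx_par; first exact: Hr.
by have := Hmod hH (leq0n q); rewrite /= [1 %% _]modn_small //; case: (idx h) => //; rewrite mod0n.
Qed.

Let HS h j : h \in H -> j < q -> iter j.+1 c h != r /\ par (iter j.+1 c h) = iter j c h.
Proof. by move=> hH jq; apply: cP; apply: HC. Qed.

Lemma bare_paths_heads : bare_paths H c.
Proof.
split.
- move=> h hH; split; first exact: Hr.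
    apply/negP => /int_mod; have [_ e] := Hpar hH.
    have := Hmod hH (leq0n q); rewrite /= e [1 %% _]modn_small // -addn1 -modnDml.
    have : idx (par h) %% q.+1 < q.+1 by apply: ltn_mod.
    move: (_ %% _) => m mq; case: m mq => // m mq.
    case: (ltnP m.+2 q.+1) => h1; first by rewrite addn1 modn_small.
    have -> : m.+1 + 1 = q.+1 by move: mq h1; clear; lia.
    by rewrite modnn.
  by apply/negP => /int_mod; rewrite Hmod // modnn.
- by move=> h hH j jq; apply: HS.
- move=> h k hH kH i j iq jq E.
  have ij : i = j.
    have := Hmod hH (ltnW iq); rewrite E Hmod 1?ltnW // !modn_small //.
    by case.
  split=> //; move: E; rewrite -ij {j ij jq}; elim: i iq => // i IH iq E.
  apply: IH; first exact: ltnW.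
  have [_ <-] := HS hH (ltnW iq); have [_ <-] := HS kH (ltnW iq).
  by rewrite E.
- move=> v vr vI /interiorP[h [j [hH jq pv]]].
  have vE : v = iter j.+1 c h by rewrite iterS -pv c_par // pv HC.
  exists h => //; suff <- : j.+1 = q by [].
  apply/eqP; rewrite eqn_leq jq leqNgt; apply/negP => jq'.
  by move/negP: vI; apply; apply/interiorP; exists h, j.+1.
- move=> h k hH kH E; have [hC _] := Hpar hH; have [kC _] := Hpar kH.
  by rewrite -(c_par (Hr hH) hC) E c_par // Hr.
Qed.

Let nonC1 := #|~: C1|.

Let below_ends v : v \in C1 -> (forall j, j <= q -> v \notin iter j par @: (~: C1)) ->
  forall j, j <= q -> iter j c v \in C1 /\ iter j par (iter j c v) = v.
Proof.
move=> vC hv; elim=> [|j IH] jq //; have [jC jp] := IH (ltnW jq).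
have [_ cp] := cP jC; have e : iter j.+1 par (iter j.+1 c v) = v.
  by rewrite iterSr iterS cp.
split=> //; apply/negPn/negP => nC; have /negP[] := hv _ jq.
by apply/imsetP; exists (iter j.+1 c v); rewrite ?in_setC ?e.
Qed.

Let above v m : v \in C1 -> m <= idx v ->
  [/\ iter m par v \in C1, idx v = idx (iter m par v) + m & forall j, j <= m ->
     iter j c (iter m par v) = iter (m - j) par v].
Proof.
move=> vC; elim: m => [|m IH] mi; first by split; rewrite ?addn0 // => j; rewrite leqn0 => /eqP ->.
have [mC me mj] := IH (ltnW mi).
have mr : iter m par v != r by move: mC; rewrite inE => /andP[].
have [|pC pe] := idx_par mr; first by move: me mi; clear; lia.
split=> [//||j jm]; first by rewrite iterS me pe addnS addSn.
case: j jm => [|j] jm //; rewrite iterSr iterS c_par // mj // subSS.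
Qed.

(** A vertex outside the interiors is not in [C1], or lies at most [q] steps above such a vertex, or
    is the spacer above a head. Otherwise the whole block of [q] indices around it stays in [C1] and
    makes it interior. *)
Lemma card_outside_interior :
  #|~: interior H c| <= (q.+2) * nonC1 + #|H|.
Proof.
have sub : ~: interior H c \subset ~: C1 :|: (\bigcup_(j < q.+1) (iter j par @: (~: C1))) :|: par
  @: H.
  apply/subsetP => v; rewrite !in_setU in_setC => vI.
  case: (boolP (v \in C1)) => vC; last by rewrite inE vC.
  case: (boolP (v \in \bigcup_(j < q.+1) _)) => [_|vB]; first by rewrite orbT.
  have hv j : j <= q -> v \notin iter j par @: (~: C1).
    move=> jq; apply: contra vB => h; apply/bigcupP.
    by exists (Ordinal (n := q.+1) (m := j) jq).
  have dn := below_ends vC hv; rewrite orbF; apply/orP; right.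
  pose m := idx v %% q.+1; have mq : m <= q by rewrite -ltnS ltn_mod.
  have [m0|m0] := posnP m.
    apply/imsetP; exists (c v); last by have [_ ->] := cP vC.
    rewrite inE idx_c // (dn 1 q0).1 /=; apply/andP; split.
      by rewrite -addn1 -modnDml -/m m0 modn_small.
    by apply/forallP => j; rewrite -iterSr (dn j.+1 (ltn_ord j)).1.
  have mi : m.-1 <= idx v.
    by apply: leq_trans (leq_pred _) _; apply: leq_mod.
  have [hC he hj] := above vC mi; set h := iter m.-1 par v in hC he hj.
  have vh : v = iter m.-1 c h by rewrite hj // subnn.
  case/negP: vI; apply/interiorP; exists h, m.-1; split=> //; last by move: m0 mq; clear; lia.
  rewrite inE hC /=; apply/andP; split.
    have : idx v = idx v %/ q.+1 * q.+1 + m by apply: divn_eq.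
    have -> : idx h = idx v - m.-1 by rewrite he addnK.
    move=> ->; have -> : idx v %/ q.+1 * q.+1 + m - m.-1 = 1 + idx v %/ q.+1 * q.+1.
      rewrite -addnBA ?leq_pred // addnC; congr (_ + _).
      by rewrite -{1}(prednK m0) subSnn.
    by rewrite -modnDmr modnMl addn0 modn_small.
  apply/forallP => j; case: (leqP j m.-1) => jm.
    rewrite hj //; have [|//] := @above v (m.-1 - j) vC.
    by apply: leq_trans mi; apply: leq_subr.
  rewrite -(subnKC (ltnW jm)) addnC iterD -vh; apply: (dn _ _).1.
  by have := ltn_ord j; move: (j : nat) => k; clear; lia.
apply: leq_trans (subset_leq_card sub) _; apply: leq_trans (leq_card_setU _ _) _.
apply: leq_add; last exact: leq_imset_card.
apply: leq_trans (leq_card_setU _ _) _; rewrite mulSn leq_add2l.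
apply: leq_trans (card_bigcup_leq _ _) _.
apply: (@leq_trans (\sum_(j < q.+1) nonC1)); first by apply: leq_sum => j _; apply: leq_imset_card.
by rewrite sum_nat_const card_ord.
Qed.

Lemma card_interior : #|interior H c| = q * #|H|.
Proof.
have [_ _ inj _ _] := bare_paths_heads.
have -> : interior H c = [set iter (hj.2 : 'I_q) c hj.1 | hj in setX H [set: 'I_q]].
  apply/setP => v; apply/interiorP/imsetP => [[h [j [hH jq ->]]]|[[h j]]].
    by exists (h, Ordinal jq); rewrite // in_setX hH inE.
  by rewrite in_setX => /andP[hH _] ->; exists h, j; split.
rewrite card_in_imset ?cardsX ?cardsT ?card_ord 1?mulnC //.
move=> [h i] [k j]; rewrite !in_setX /= => /andP[hH _] /andP[kH _] E.
by have [-> /val_inj ->] := inj h k hH kH i j (ltn_ord i) (ltn_ord j) E.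
Qed.

(** Count children: apart from the root, vertices with two or more children are no more numerous
    than childless ones, and the latter are leaves. The root accounts for the 1. *)
Lemma card_nonC1 : nonC1 <= 2 * #|leaves t| + 1.
Proof.
have sumch : \sum_v #|children r par v| = #|[set w | w != r]|.
  rewrite -[RHS]sum1_card [RHS](partition_big par predT) //=; apply: eq_bigr => v _.
  by rewrite -sum1_card; apply: eq_bigl => w; rewrite !inE.
have cr : #|[set w | w != r]| = #|U|.-1.
  by rewrite -(cardC1 r); apply: eq_card => w; rewrite !inE.
pose C0 := [set v | (v != r) && (#|children r par v| == 0)].
pose C2 := [set v | (v != r) && (1 < #|children r par v|)].
have C0L : #|C0| <= #|leaves t|.
  apply/subset_leq_card/subsetP => v; rewrite !inE => /andP[vr /eqP c0].
  by rewrite (card_nbhd_par tsym rt vr) c0.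
have lb : #|C1| + 2 * #|C2| <= \sum_v #|children r par v|.
  rewrite -!sum1_card mulnC big_distrl /= big_mkcond [X in _ + X <= _]big_mkcond -big_split /=.
  by apply: leq_sum => v _; rewrite !inE; case: (v != r) => //=; case: (#|_|) => [|[|?]].
have part : #|U| <= 1 + #|C0| + #|C1| + #|C2|.
  rewrite -cardsT; have : [set: U] \subset [set r] :|: C0 :|: C1 :|: C2.
    apply/subsetP => v _; rewrite !inE; case: (v == r) => //=.
    by case: (#|_|) => [|[|?]].
  move/subset_leq_card/leq_trans; apply.
  do 3! (apply: leq_trans (leq_card_setU _ _) _; rewrite leq_add2r).
  by rewrite cards1.
have U0 : 0 < #|U| by apply/card_gt0P; exists r.
have := cardsC C1; rewrite -/nonC1; move: sumch cr C0L lb part U0; clear; lia.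
Qed.

Lemma bare_path_decomposition : exists H c, [/\ bare_paths H c,
  #|~: interior H c| + q * #|H| = #|U| &
  #|~: interior H c| <= q.+2 * (2 * #|leaves t| + 1) + #|H|].
Proof.
exists H, c; split; first exact: bare_paths_heads.
  by rewrite -card_interior addnC cardsC.
apply: leq_trans card_outside_interior _; rewrite leq_add2r leq_mul2l card_nonC1.
by rewrite orbT.
Qed.

(** * Gluing vertex paths into an embedding of the remaining forest *)

Section Assemble.
Variables (V : finType) (e : rel V) (f0 : U -> V) (P : U -> seq V).
Variables (Hd : {set U}) (cc : U -> U).
Let F := ~: interior Hd cc.
Hypotheses (esym : symmetric e) (bp : bare_paths Hd cc).
Hypothesis f0i : {in F &, injective f0}.
Hypothesis f0e : {in F, forall v, v != r -> par v \in F -> e (f0 (par v)) (f0 v)}.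
Hypothesis Psize : {in Hd, forall h, size (P h) = q}.
Hypothesis Puniq : {in Hd, forall h, uniq (P h)}.
Hypothesis Ppath : {in Hd, forall h, path e (f0 (par h)) (rcons (P h) (f0 (iter q cc h)))}.
Hypothesis Pout : {in Hd, forall h x, x \in P h -> x \notin f0 @: F}.
Hypothesis Pdisj : {in Hd &, forall h k, h != k -> forall x, x \in P h -> x \notin P k}.

Lemma assemble_bare_paths : contains_copy e t.
Proof.
have [b1 b2 b3 b4 _] := bp.
pose x0 := f0 r.
pose f v := if [pick hj : U * 'I_q | (hj.1 \in Hd) && (v == iter hj.2 cc hj.1)] is Some hj
  then nth x0 (P hj.1) hj.2 else f0 v.
have fI h j : h \in Hd -> j < q -> f (iter j cc h) = nth x0 (P h) j.
  move=> hH jq; rewrite /f; case: pickP => [[k i] /= /andP[kH /eqP E]|/(_ (h, Ordinal jq))].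
    by have [-> ->] := b3 h k hH kH j i jq (ltn_ord i) E.
  by rewrite /= hH eqxx.
have fF v : v \in F -> f v = f0 v.
  rewrite /F inE => vF; rewrite /f; case: pickP => // -[k i] /= /andP[kH /eqP E].
  by case/negP: vF; apply/interiorP; exists k, i; split.
have Fcase v : v \in F \/ exists h j, [/\ h \in Hd, j < q & v = iter j cc h].
  by case: (boolP (v \in interior Hd cc)) => [/interiorP|vF]; [right|left; rewrite inE].
have memP h j : h \in Hd -> j < q -> nth x0 (P h) j \in P h.
  by move=> hH jq; apply: mem_nth; rewrite Psize.
apply: (embedding_of_par rt (f := f)) => //.
  move=> v w; case: (Fcase v) => [vF|[h [i [hH iq ->]]]];
    case: (Fcase w) => [wF|[k [j [kH jq ->]]]].
  - by rewrite !fF //; apply: f0i.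
  - rewrite fF // fI // => E; have := Pout kH (memP _ _ kH jq).
    by rewrite -E imset_f.
  - rewrite fI // fF // => E; have := Pout hH (memP _ _ hH iq).
    by rewrite E imset_f.
  - rewrite !fI //; case: (eqVneq h k) => [<-|hk] E.
      by move/eqP: E; rewrite nth_uniq ?Psize ?Puniq // => /eqP ->.
    by have := Pdisj hH kH hk (memP _ _ hH iq); rewrite E memP.
have stepP h i : h \in Hd -> i <= q ->
    e (nth x0 (f0 (par h) :: P h) i) (nth x0 (rcons (P h) (f0 (iter q cc h))) i).
  move=> hH iq; have /(pathP x0) /(_ i) := Ppath hH.
  rewrite size_rcons Psize // ltnS => /(_ iq).
  by rewrite -rcons_cons nth_rcons /= Psize // ltnS iq.
move=> v vr; case: (Fcase v) => [vF|[h [j [hH jq ->]]]].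
  case: (Fcase (par v)) => [pF|[k [j [kH jq pv]]]].
    by rewrite !fF //; apply: f0e.
  have [||h hH vE] := b4 v vr.
  - by move: vF; rewrite inE.
  - by apply/interiorP; exists k, j.
  have [_ pq] := b2 h hH q.-1 (eq_leq (prednK q0)).
  have pE : par (iter q cc h) = iter q.-1 cc h by rewrite -{1}(prednK q0) pq.
  rewrite (fF v) // vE pE fI ?prednK //; have := stepP h q hH (leqnn q).
  have nE x l : nth x0 (x :: l) q = nth x0 l q.-1 by rewrite -{1}(prednK q0).
  by rewrite nE nth_rcons Psize // ltnn eqxx.
case: j jq => [|j] jq /=.
  have [hr hp _] := b1 h hH.
  have := fI h 0 hH q0; rewrite /= => ->; rewrite fF ?in_setC //.
  by have := stepP h 0 hH (leq0n q); rewrite nth_rcons Psize // q0.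
have [_ pj] := b2 h hH j (ltnW jq); rewrite -iterS pj !fI //; last exact: ltnW.
by have := stepP h j.+1 hH (ltnW jq); rewrite nth_rcons Psize // jq.
Qed.

End Assemble.
End BarePaths.

(** * Absorption by chains of cliques *)

(* What is used of a matching of size 3: a path that enters and leaves through
   such links can use different vertices for entering and leaving a clique. *)
Definition robust_link (V : finType) (e : rel V) : rel {set V} := fun K K' =>
  [forall x, [forall y, [exists a in K, [exists b in K', [&& e a b, a != x & b != y]]]]].

Lemma robust_linkP (V : finType) (e : rel V) (K K' : {set V}) : reflect
  (forall x y, exists a b, [/\ a \in K, b \in K', e a b, a != x & b != y]) (robust_link e K K').
Proof.
apply: (iffP forallP) => [h x y|h x].
  have /forallP /(_ y) /exists_inP[a aK /exists_inP[b bK /and3P[? ? ?]]] := h x.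
  by exists a, b.
apply/forallP => y; have [a [b [aK bK eab ax by']]] := h x y.
by apply/exists_inP; exists a => //; apply/exists_inP; exists b; rewrite // eab ax by'.
Qed.

Lemma robust_link_sym (V : finType) (e : rel V) : symmetric e -> symmetric (robust_link e).
Proof.
move=> esym K K'; apply/robust_linkP/robust_linkP => h x y;
  have [a [b [aK bK eab ax by']]] := h y x; exists b, a; by rewrite esym.
Qed.

(** Each of [x] and [y] lies on at most one of three disjoint edges. *)
Lemma robust_link_of_matching (V : finType) (e : rel V) (K K' : {set V}) :
  has_matching e 3 K K' -> robust_link e K K'.
Proof.
case/existsP => M /andP[/andP[/trivIsetP tM /forall_inP hM] /eqP M3].
apply/robust_linkP => x y.
have le1 z : #|[set E in M | z \in E]| <= 1.
  apply/card_le1_eqP => E E'; rewrite !inE => /andP[EM zE] /andP[E'M zE'].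
  apply/eqP/negPn/negP => ne; have := tM _ _ E'M EM ne.
  by move/pred0P/(_ z); rewrite /= zE zE'.
have [E] : exists E, E \in M :\: ([set E in M | x \in E] :|: [set E in M | y \in E]).
  apply: card_gt0_ex; apply: leq_trans (card_setD_ge _ _); rewrite M3.
  rewrite subn_gt0 ltnS; apply: leq_trans (leq_card_setU _ _) _.
  exact: leq_add (le1 x) (le1 y).
rewrite in_setD in_setU !inE => /andP[/norP[+ +] EM]; rewrite EM /= => xE yE.
have /exists_inP[a aK /exists_inP[b bK /andP[eab /eqP Eab]]] := hM E EM.
exists a, b; split=> //.
  by apply: contraNneq xE => <-; rewrite Eab !inE eqxx.
by apply: contraNneq yE => <-; rewrite Eab !inE eqxx orbT.
Qed.

Section Chains.
Variables (V : finType) (e : rel V).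

Lemma path_in_clique k (K : {set V}) x p : is_clique e k K -> uniq (x :: p) ->
  {subset x :: p <= K} -> path e x p.
Proof.
case/andP=> _ /forall_inP cK; elim: p x => //= y p IH x /andP[xp up] sub.
rewrite IH //; last by move=> z zp; apply: sub; rewrite inE zp orbT.
rewrite andbT; have /forall_inP /(_ y) h := cK x (sub x (mem_head _ _)).
apply: (implyP (h _)); first by apply: sub; rewrite !inE eqxx orbT.
by apply: contraNneq xp => ->; rewrite mem_head.
Qed.

Lemma traverse_clique k (K : {set V}) x y : is_clique e k K -> x \in K -> y \in K -> x != y ->
  exists p, [/\ (size p).+1 = k, uniq (x :: p), path e x p, last x p = y & {subset x :: p <= K}].
Proof.
move=> cK xK yK xy; pose p := rcons (enum (K :\ x :\ y)) y.
have sub : {subset x :: p <= K}.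
  move=> z; rewrite inE mem_rcons inE mem_enum !inE.
  by case/or3P => [/eqP->|/eqP->|/and3P[]].
have up : uniq (x :: p).
  rewrite /= rcons_uniq mem_rcons inE !mem_enum !inE eqxx andbF orbF xy enum_uniq.
  by rewrite eqxx.
exists p; split=> //; last by rewrite last_rcons.
  rewrite size_rcons -cardE; have /andP[/eqP <- _] := cK.
  by rewrite (cardsD1 x K) xK (cardsD1 y (K :\ x)) !inE yK eq_sym xy.
exact: path_in_clique cK up sub.
Qed.

(** The link out of [K0] is chosen to leave at a vertex other than [x] and to arrive at one other
    than [y]; so every clique, even the last, is traversed between distinct vertices. A chain of one
    clique has no link, hence the extra condition. *)
Lemma traverse_chain k (Ks : seq {set V}) (K0 : {set V}) x y :
  (forall K, K \in K0 :: Ks -> is_clique e k K) ->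
  {in K0 :: Ks &, forall K K' : {set V}, K != K' -> [disjoint K & K']} -> uniq (K0 :: Ks) ->
  path (robust_link e) K0 Ks -> x \in K0 -> y \in last K0 Ks -> (Ks = [::] -> x != y) ->
  exists p, [/\ (size p).+1 = k * (size Ks).+1, uniq (x :: p), path e x p, last x p = y &
    forall v, v \in x :: p -> exists2 K, K \in K0 :: Ks & v \in K].
Proof.
elim: Ks K0 x => [|K1 Ks IH] K0 x cK dK uK lK xK yK xy.
  have [||||p [sp up pp lp sub]] := @traverse_clique k K0 x y _ _ _ _ => //.
  - by apply: cK; rewrite mem_head.
  - exact: xy.
  exists p; rewrite muln1; split=> // v vp; exists K0; rewrite ?mem_head //; exact: sub.
rewrite /= in lK; rewrite cons_uniq in uK.
move: lK uK => /andP[/robust_linkP /(_ x y) [a [b [aK bK eab ax by']]] lK] /andP[K0n uK].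
have [p0 [sp0 up0 pp0 lp0 sub0]] : exists p, [/\ (size p).+1 = k, uniq (x :: p), path e x p, last
  x p = a & {subset x :: p <= K0}].
  by apply: traverse_clique; rewrite 1?eq_sym // cK // mem_head.
have [|||p1 [sp1 up1 pp1 lp1 sub1]] := IH K1 b _ _ uK lK bK yK.
- by move=> K KK; apply: cK; rewrite inE KK orbT.
- by move=> K K' KK KK'; apply: dK; rewrite inE ?KK ?KK' orbT.
- by [].
exists (p0 ++ b :: p1); split.
- by rewrite size_cat [size (b :: _)]/= [size (K1 :: _)]/= mulnS -sp1 -sp0 addSn.
- have -> : x :: (p0 ++ b :: p1) = (x :: p0) ++ b :: p1 by [].
  rewrite cat_uniq up0 up1 andbT; apply/hasPn => v vp.
  apply/negP => /sub0 vK; have [K KK vK'] := sub1 v vp.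
  have := dK K0 K (mem_head _ _); rewrite inE KK orbT => /(_ isT).
  have -> : K0 != K by apply: contraNneq K0n => ->.
  by move=> /(_ isT) /disjointFr /(_ vK); rewrite vK'.
- by rewrite cat_path pp0 lp0 /= eab.
- by rewrite last_cat.
- move=> v; have -> : x :: (p0 ++ b :: p1) = (x :: p0) ++ b :: p1 by [].
  rewrite mem_cat => /orP[/sub0 vK|/sub1[K KK vK]].
    by exists K0; rewrite ?mem_head.
  by exists K; rewrite // inE KK orbT.
Qed.

End Chains.

(** * Disjoint chains with prescribed ends in a dense graph *)

Section Fill.
Variables (C I : finType) (lk : rel C) (N g : nat) (J : {set I}) (S T : I -> C) (F : {set C}).
Hypotheses (lsym : symmetric lk) (Si : {in J &, injective S}) (Ti : {in J &, injective T}).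
Hypothesis ST : forall i j, i \in J -> j \in J -> S i != T j.
Hypotheses (SF : {in J, forall i, S i \notin F}) (TF : {in J, forall i, T i \notin F}).
Hypothesis cF : #|F| = #|J| * g.+2.
Let all_nodes := F :|: S @: J :|: T @: J.
Hypothesis dense : forall K, K \in all_nodes -> #|[set K' in all_nodes | ~~ lk K K']| <= N.
Hypotheses (g2 : 1 < g) (JN : 3 * N <= 2 * #|J|) (J0 : 0 < #|J|).

Lemma greedy_path k : k + N <= #|F| ->
  exists p, [/\ size p = k, uniq p, {subset p <= F} & sorted lk p].
Proof.
elim: k => [|k IH] kF; first by exists [::].
have [p [sp up pF lp]] := IH (ltnW kF).
have cp : #|F :\: [set x in p]| = #|F| - k.
  have pF' : [set x in p] \subset F by apply/subsetP => x; rewrite inE; apply: pF.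
  by rewrite cardsDS // cardsE (card_uniqP up) sp.
case: (lastP p) sp up pF lp cp => [|q K] sp up pF lp cp.
  have [K KF] : exists K, K \in F by apply: card_gt0_ex; move: kF; clear; lia.
  exists [:: K]; split=> //; first by rewrite /= -sp.
  by move=> x; rewrite inE => /eqP ->.
have KF : K \in F by apply: pF; rewrite mem_rcons mem_head.
have [K'] : exists K', K' \in (F :\: [set x in rcons q K]) :\: [set K' in all_nodes | ~~ lk K K'].
  apply: card_gt0_ex; apply: leq_trans (card_setD_ge _ _); rewrite cp.
  have := dense (K := K); rewrite !in_setU KF => /(_ isT).
  by move: kF; clear; lia.
rewrite in_setD inE in_setD => /andP[nl /andP[nq K'F]].
exists (rcons (rcons q K) K'); split.
- by rewrite size_rcons sp.
- by rewrite rcons_uniq up andbT; rewrite inE in nq.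
- by move=> x; rewrite mem_rcons inE => /orP[/eqP ->|/pF].
- move: nl; rewrite !in_setU K'F /= negbK => lKK'.
  move: lp; case: q {sp up pF cp nq} => [|z q] /=; first by rewrite lKK'.
  by move=> h; rewrite rcons_path h last_rcons.
Qed.

(** A greedy path is cut into [#|J|] pieces of [g] nodes; the [2 * #|J|] nodes of [F] left over fill
    the gaps between pieces and ends. Each gap accepts all but [2 * N] of them, and each of them is
    rejected by at most [N] gaps, so Hall's condition follows from [3 * N <= 2 * #|J|]. *)
Lemma fill_chains : exists fl : I -> seq C,
  {in J, forall i, [/\ size (fl i) = g.+2, uniq (fl i), {subset fl i <= F} &
     path lk (S i) (rcons (fl i) (T i))]} /\
  {in J &, forall i j, i != j -> forall x, x \in fl i -> x \notin fl j}.
Proof.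
have [i0 i0J] := card_gt0_ex J0.
have [p [sp up pF lp]] : exists p, [/\ size p = #|J| * g, uniq p, {subset p <= F} & sorted lk p].
  by apply: greedy_path; rewrite cF; move: JN; clear; lia.
pose K0 := S i0; pose ix i := index i (enum J).
have ixJ i : i \in J -> ix i < #|J| by move=> iJ; rewrite cardE index_mem mem_enum.
have ixi : {in J &, injective ix}.
  by move=> i j iJ jJ E; have := congr1 (nth i0 (enum J)) E; rewrite !nth_index ?mem_enum.
have pos i j : i \in J -> j < g -> ix i * g + j < size p.
  move=> /ixJ h jg; rewrite sp; apply: (@leq_trans ((ix i).+1 * g));
    last by rewrite leq_mul2r h orbT.
  by rewrite mulSn addnC ltn_add2r.
pose nd i j := nth K0 p (ix i * g + j).
have ndp i j : i \in J -> j < g -> nd i j \in p by move=> iJ jg; apply/mem_nth/pos.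
have nd_inj i j i' j' : i \in J -> i' \in J -> j < g -> j' < g -> nd i j = nd i' j' ->
    i = i' /\ j = j'.
  move=> iJ iJ' jg jg' /eqP; rewrite nth_uniq ?pos // => /eqP E.
  have g0 : 0 < g by apply: ltnW.
  have E1 : ix i = ix i'.
    by have := congr1 (divn^~ g) E; rewrite /= !divnMDl // !divn_small // !addn0.
  by split; [apply: ixi|move/eqP: E; rewrite E1 eqn_add2l => /eqP].
pose G i := mkseq (nd i) g.
have GP i x : x \in G i -> exists2 j, j < g & x = nd i j.
  by case/mapP => j; rewrite mem_iota => /andP[_ jg] ->; exists j.
pose X := F :\: [set x in p].
have cX : #|X| = 2 * #|J|.
  have pF' : [set x in p] \subset F by apply/subsetP => x; rewrite inE; apply: pF.
  by rewrite cardsDS // cardsE (card_uniqP up) sp cF; clear; lia.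
(* The gap [(i, false)] precedes the piece of [i], the gap [(i, true)] follows it. *)
pose lft (ib : I * bool) := if ib.2 then nd ib.1 g.-1 else S ib.1.
pose rgt (ib : I * bool) := if ib.2 then T ib.1 else nd ib.1 0.
pose opt ib := [set K in X | lk (lft ib) K && lk K (rgt ib)].
have ndF i j : i \in J -> j < g -> nd i j \in F by move=> iJ jg; apply/pF/ndp.
pose JJ := [set ib : I * bool | ib.1 \in J].
have inall ib : ib \in JJ -> lft ib \in all_nodes /\ rgt ib \in all_nodes.
  have g1 : g.-1 < g by move: g2; clear; lia.
  have SA i : i \in J -> S i \in all_nodes by move=> iJ; rewrite !in_setU imset_f ?orbT.
  have TA i : i \in J -> T i \in all_nodes by move=> iJ; rewrite in_setU [X in _ || X]imset_f ?orbT.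
  have nA i j : i \in J -> j < g -> nd i j \in all_nodes by move=> iJ jg; rewrite !in_setU ndF.
  rewrite inE; case: ib => i [] /= iJ; split; rewrite ?SA ?TA ?nA //; exact: ltnW.
have cJJ : #|JJ| = 2 * #|J|.
  have -> : JJ = setX J [set: bool] by apply/setP => -[i b]; rewrite !inE andbT.
  by rewrite cardsX cardsT card_bool mulnC.
have [h [hi hopt]] : exists h : I * bool -> C, {in JJ &, injective h} /\
    {in JJ, forall ib, h ib \in opt ib}.
  apply: (hall K0) => L LJ.
  have [->|/set0Pn[ib0 ib0L]] := eqVneq L set0; first by rewrite cards0.
  set B := \bigcup_(i in L) opt i.
  have BX : B \subset X by apply/bigcupsP => ib _; apply/subsetP => K; rewrite inE => /andP[].
  have lb : 2 * #|J| - 2 * N <= #|B|.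
    apply: (@leq_trans #|opt ib0|); last by apply/subset_leq_card/(bigcup_sup ib0).
    have [lA rA] := inall _ (subsetP LJ _ ib0L).
    have -> : opt ib0 = (X :\: [set K' in all_nodes | ~~ lk (lft ib0) K']) :\:
        [set K' in all_nodes | ~~ lk (rgt ib0) K'].
      apply/setP => K; rewrite [LHS]inE !in_setD.
      case: (boolP (K \in F)) => KF; rewrite ?andbF //.
      by rewrite !inE KF /= !negbK lsym [lk K _]lsym; case: (K \in p);
        rewrite ?andbF ?andbT //= andbC lsym.
    apply: leq_trans (card_setD_ge _ _);
      have := card_setD_ge X [set K' in all_nodes | ~~ lk (lft ib0) K'].
    by move: (dense lA) (dense rA); rewrite cX; clear; lia.
  case: (leqP #|L| (2 * #|J| - 2 * N)) => Lc; first exact: leq_trans lb.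
  suff -> : B = X by rewrite cX -cJJ subset_leq_card.
  apply/eqP; rewrite eqEsubset BX /=; apply/subsetP => K KX; apply/negPn/negP => KB.
  have KF : K \in F by move: KX; rewrite in_setD => /andP[].
  have KA : K \in all_nodes by rewrite !in_setU KF.
  (* Distinct positions have distinct neighbouring nodes, so each position that
     rejects [K] accounts for its own non-neighbour of [K]. *)
  pose wit ib := if lk (lft ib) K then rgt ib else lft ib.
  have nl ib : ib \in L -> wit ib \in [set K' in all_nodes | ~~ lk K K'].
    move=> ibL; have [lA rA] := inall _ (subsetP LJ _ ibL); rewrite inE /wit.
    case: ifP => [l1|/negbT l1]; last by rewrite lA lsym.
    rewrite rA /=; apply: contra KB => l2; apply/bigcupP; exists ib => //.
    by rewrite inE KX l1 l2.
  have g1 : g.-1 < g by move: g2; clear; lia.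
  have g0 : 0 < g by apply: ltnW.
  have wi : {in L &, injective wit}.
    (* The two gaps at one piece must border on different nodes of it. *)
    have gg : g.-1 != 0 by move: g2; clear; lia.
    have nSF i i' j : i \in J -> i' \in J -> j < g -> S i = nd i' j -> False.
      by move=> iJ iJ' jg E; have := SF iJ; rewrite E ndF.
    have nTF i i' j : i \in J -> i' \in J -> j < g -> T i = nd i' j -> False.
      by move=> iJ iJ' jg E; have := TF iJ; rewrite E ndF.
    move=> [i b] [i' b'] iL iL'.
    have iJ : i \in J by have := subsetP LJ _ iL; rewrite inE.
    have iJ' : i' \in J by have := subsetP LJ _ iL'; rewrite inE.
    rewrite /wit /lft /rgt /=; case: b {iL}; case: b' {iL'} => /=;
      case: ifP => _; case: ifP => _ E; try (by case: (nSF _ _ _ iJ iJ' _ E));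
      try (by case: (nSF _ _ _ iJ' iJ _ (Logic.eq_sym E)));
      try (by case: (nTF _ _ _ iJ iJ' _ E));
      try (by case: (nTF _ _ _ iJ' iJ _ (Logic.eq_sym E)));
      try (by rewrite (Si iJ iJ' E)); try (by rewrite (Ti iJ iJ' E));
      try (by have := ST iJ iJ'; rewrite E eqxx);
      try (by have := ST iJ' iJ; rewrite E eqxx);
      try (by have [|| -> //] := nd_inj _ _ _ _ iJ iJ' _ _ E);
      by have [||_ h] := nd_inj _ _ _ _ iJ iJ' _ _ E; rewrite ?h // ?h // -?h in gg *.
  have : #|L| <= N.
    rewrite -(card_in_imset wi); apply: leq_trans (dense KA); apply/subset_leq_card/subsetP => x.
    by case/imsetP => ib ibL ->; apply: nl.
  by move: Lc JN; clear; lia.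
have hX ib : ib \in JJ -> h ib \in X by move/hopt; rewrite inE => /andP[].
have hp ib : ib \in JJ -> h ib \notin p by move/hX; rewrite in_setD inE => /andP[].
have hF ib : ib \in JJ -> h ib \in F by move/hX; rewrite in_setD => /andP[].
have JJi i b : i \in J -> (i, b) \in JJ by rewrite inE.
have Gp i x : i \in J -> x \in G i -> x \in p by move=> iJ /GP[j jg ->]; apply: ndp.
pose fl i := h (i, false) :: rcons (G i) (h (i, true)).
have fl_in i x : i \in J -> x \in fl i -> (x \in G i) \/ exists b, x = h (i, b).
  move=> iJ; rewrite inE mem_rcons inE => /or3P[/eqP ->|/eqP ->|xG]; by [right;
    exists false|right; exists true|left].
exists fl; split.
  move=> i iJ; split.
  - by rewrite /fl /= size_rcons size_mkseq.
  - rewrite /fl /= rcons_uniq mem_rcons inE negb_or.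
    apply/and3P; split.
    + by apply/andP; split;
        [apply/eqP => /(hi _ _ (JJi _ _ iJ) (JJi _ _ iJ))|apply: contra (hp _ (JJi _ _ iJ));
          apply: Gp].
    + by apply: contra (hp _ (JJi _ _ iJ)); apply: Gp.
    + rewrite map_inj_in_uniq ?iota_uniq // => j j';
        rewrite !mem_iota => /andP[_ jg] /andP[_ jg'] E.
      by have [] := nd_inj _ _ _ _ iJ iJ jg jg' E.
  - by move=> x /(fl_in _ _ iJ)[/(Gp _ _ iJ)/pF //|[b ->]]; apply/hF/JJi.
  - have := hopt _ (JJi i false iJ); rewrite inE => /andP[_ /andP[/= l1 l2]].
    have := hopt _ (JJi i true iJ); rewrite inE => /andP[_ /andP[/= l3 l4]].
    rewrite /fl /= l1 !rcons_path last_rcons l4 andbT.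
    have gS : g = g.-1.+1 by rewrite prednK // ltnW.
    have -> : last (h (i, false)) (G i) = nd i g.-1.
      by rewrite (last_nth K0) size_mkseq {1}gS /= nth_mkseq // {2}gS.
    rewrite l3 andbT; have : sorted lk (G i).
      apply/(sortedP K0) => j; rewrite size_mkseq => jg; rewrite !nth_mkseq // 1?ltnW //.
      rewrite /nd addnS; apply/(sortedP K0) => //; by rewrite -addnS pos.
    have -> : G i = nd i 0 :: behead (G i) by rewrite /G gS.
    by rewrite /= l2.
move=> i j iJ jJ ij x xi; apply/negP => xj.
case: (fl_in _ _ iJ xi) (fl_in _ _ jJ xj) => [xG|[b xh]] [xG'|[b' xh']].
- have [k kg E] := GP _ _ xG; have [k' kg' E'] := GP _ _ xG'.
  have [ij' _] := nd_inj i k j k' iJ jJ kg kg' (etrans (Logic.eq_sym E) E').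
  by rewrite ij' eqxx in ij.
- by have := hp _ (JJi j b' jJ); rewrite -xh' (Gp _ _ iJ xG).
- by have := hp _ (JJi i b iJ); rewrite -xh (Gp _ _ jJ xG').
- have := hi _ _ (JJi _ _ iJ) (JJi _ _ jJ) (etrans (Logic.eq_sym xh) xh').
  by case=> ij' _; rewrite ij' eqxx in ij.
Qed.

End Fill.

Lemma path_glue (T : Type) (e : rel T) a p x p' :
  path e a (rcons p x) -> path e x p' -> path e a (p ++ x :: p').
Proof. by rewrite rcons_path cat_path /= => /andP[-> ->] ->. Qed.

Lemma uniq_cat (T : eqType) (a b : seq T) : uniq a -> uniq b ->
  (forall x, x \in a -> x \in b -> False) -> uniq (a ++ b).
Proof.
move=> ua ub ab; rewrite cat_uniq ua ub andbT; apply/hasPn => x xb.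
by apply/negP => xa; apply: ab xa xb.
Qed.

Lemma exists_on (I : finType) (B : Type) (b0 : B) (J : {set I}) (Q : I -> B -> Prop) :
  {in J, forall i, exists b, Q i b} -> exists f : I -> B, {in J, forall i, Q i (f i)}.
Proof.
move=> h; have : forall i, exists b, i \in J -> Q i b.
  by move=> i; case: (boolP (i \in J)) => [/h[b]|_]; [exists b|exists b0].
by case/fin_all_exists => f hf; exists f => i /hf.
Qed.

(** * Absorbing one vertex between two chains *)

Section Absorb.
Variables (V U : finType) (e : rel V) (Kp : {set {set V}}) (Hr : {set U}) (N : nat).
Variables (bd : U * bool -> {set V}) (xv : U * bool -> V) (w : U -> V).
Let JJ := [set i : U * bool | i.1 \in Hr].
Hypotheses (esym : symmetric e) (cK : forall K, K \in Kp -> is_clique e 5 K).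
Hypotheses (tK : trivIset Kp) (cKp : #|Kp| = 98 * N) (cH : #|Hr| = N) (N0 : 0 < N).
Hypothesis dense : forall K, K \in Kp -> #|[set K' in Kp | ~~ robust_link e K K']| <= N.
Hypotheses (bdi : {in JJ &, injective bd}) (bdK : {in JJ, forall i, bd i \in Kp}).
Hypothesis xbd : {in JJ, forall i, xv i \in bd i}.
Hypotheses (wi : {in Hr &, injective w}) (wK : {in Hr, forall h, w h \notin cover Kp}).
Hypothesis wdeg : {in Hr, forall h, 4 * N <= #|[set K in Kp | [exists a in K, e (w h) a]]|}.

(** For each [h], one chain of 49 cliques leads from [bd (h, false)] to a clique adjacent to [w h],
    and another from such a clique to [bd (h, true)]. That makes [2 * 49 * 5 + 1 = 491] vertices,
    the first of which is not in [m h]. *)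
Lemma absorb : exists m : U -> seq V,
  {in Hr, forall h, [/\ size (m h) = 490, uniq (xv (h, false) :: m h),
     path e (xv (h, false)) (m h), last (xv (h, false)) (m h) = xv (h, true) &
     {subset xv (h, false) :: m h <= w h |: cover Kp}]} /\
  {in Hr &, forall h k, h != k ->
     forall v, v \in xv (h, false) :: m h -> v \notin xv (k, false) :: m k}.
Proof.
have cJJ : #|JJ| = 2 * N.
  have -> : JJ = setX Hr [set: bool] by apply/setP => -[i b]; rewrite !inE andbT.
  by rewrite cardsX cardsT card_bool mulnC cH.
have dKK K K' v : K \in Kp -> K' \in Kp -> v \in K -> v \in K' -> K = K'.
  move=> KK KK' vK vK'; apply/eqP/negPn/negP => ne; have /trivIsetP/(_ _ _ KK KK' ne) := tK.
  by move/disjointFr => /(_ _ vK); rewrite vK'.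
(* At most [2 * N] end cliques are lost, and the remaining [2 * N] choices equal the number of
   requests, so Hall's condition is immediate. *)
pose ad (i : U * bool) := [set K in Kp | [exists a in K, e (w i.1) a]] :\: bd @: JJ.
have adc i : i \in JJ -> 2 * N <= #|ad i|.
  move=> iJ; apply: leq_trans (card_setD_ge _ _).
  have h1 : 4 * N <= #|[set K in Kp | [exists a in K, e (w i.1) a]]|.
    by apply: wdeg; move: iJ; rewrite inE.
  have h2 : #|bd @: JJ| <= 2 * N by rewrite -cJJ leq_imset_card.
  by apply: leq_trans (leq_sub h1 h2); rewrite -mulnBl.
have [con [coni conad]] : exists con : U * bool -> {set V}, {in JJ &, injective con} /\
    {in JJ, forall i, con i \in ad i}.
  apply: (hall set0) => L LJ.
  have [->|/set0Pn[i0 i0L]] := eqVneq L set0; first by rewrite cards0.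
  apply: leq_trans (subset_leq_card LJ) _; rewrite cJJ.
  apply: leq_trans (adc _ (subsetP LJ _ i0L)) _.
  by apply: subset_leq_card; apply: (bigcup_sup i0).
have conK i : i \in JJ -> con i \in Kp by move/conad; rewrite in_setD inE => /and3P[].
have con_bd i j : i \in JJ -> j \in JJ -> con i != bd j.
  move=> iJ jJ; have := conad i iJ; rewrite in_setD => /andP[+ _].
  by apply: contraNneq => ->; apply: imset_f.
have [cv cvP] : exists cv : U * bool -> V, {in JJ, forall i, cv i \in con i /\ e (w i.1) (cv i)}.
  have [x0 _] : exists x0, x0 \in Hr by apply: card_gt0_ex; rewrite cH.
  apply: (@exists_on _ _ (w x0) JJ (fun i a => a \in con i /\ e (w i.1) a)) => i /conad;
    rewrite in_setD inE.
  by case/andP => _ /andP[_ /exists_inP[a aK ea]]; exists a.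
(* Chains with flag [false] run towards [w], those with flag [true] away from it. *)
pose S (i : U * bool) := if i.2 then con i else bd i.
pose T (i : U * bool) := if i.2 then bd i else con i.
pose st (i : U * bool) := if i.2 then cv i else xv i.
pose en (i : U * bool) := if i.2 then xv i else cv i.
have Si : {in JJ &, injective S}.
  move=> i j iJ jJ; rewrite /S; case: ifP => _; case: ifP => _ E.
  - exact: coni.
  - by have := con_bd i j iJ jJ; rewrite E eqxx.
  - by have := con_bd j i jJ iJ; rewrite -E eqxx.
  - exact: bdi.
have Ti : {in JJ &, injective T}.
  move=> i j iJ jJ; rewrite /T; case: ifP => _; case: ifP => _ E.
  - exact: bdi.
  - by have := con_bd j i jJ iJ; rewrite -E eqxx.
  - by have := con_bd i j iJ jJ; rewrite E eqxx.
  - exact: coni.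
have ST i j : i \in JJ -> j \in JJ -> S i != T j.
  move=> iJ jJ; rewrite /S /T; case: ifP => i2; case: ifP => j2.
  - exact: con_bd.
  - by apply/eqP => /(coni _ _ iJ jJ) E; rewrite E j2 in i2.
  - by apply/eqP => /(bdi iJ jJ) E; rewrite E j2 in i2.
  - by rewrite eq_sym con_bd.
have SK i : i \in JJ -> S i \in Kp by move=> iJ; rewrite /S; case: ifP; rewrite ?conK ?bdK.
have TK i : i \in JJ -> T i \in Kp by move=> iJ; rewrite /T; case: ifP; rewrite ?conK ?bdK.
pose F := Kp :\: (S @: JJ :|: T @: JJ).
have SF : {in JJ, forall i, S i \notin F}.
  by move=> i iJ; rewrite in_setD in_setU imset_f.
have TF : {in JJ, forall i, T i \notin F}.
  by move=> i iJ; rewrite in_setD in_setU (imset_f T iJ) orbT.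
(* Removing two end cliques for each of [2 * N] chains leaves [94 * N = 2 * N * 47] cliques. *)
have cF : #|F| = #|JJ| * 45.+2.
  rewrite cardsDS; last by rewrite subUset; apply/andP; split;
    apply/subsetP => _ /imsetP[i iJ ->]; [apply: SK|apply: TK].
  rewrite cardsU disjoint_setI0 ?cards0 ?subn0; last first.
    rewrite -setI_eq0; apply/eqP/setP => K; rewrite in_set0 in_setI; apply/negbTE/negP.
    by case/andP=> /imsetP[i iJ ->] /imsetP[j jJ E]; have := ST i j iJ jJ; rewrite E eqxx.
  by rewrite !card_in_imset // cKp cJJ; clear; lia.
have allK : F :|: S @: JJ :|: T @: JJ \subset Kp.
  rewrite !subUset subsetDl /=; apply/andP; split; apply/subsetP => _ /imsetP[i iJ ->].
    exact: SK.
  exact: TK.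
have [||||fl [flP fld]] := @fill_chains _ _ (robust_link e) N 45 JJ S T F (robust_link_sym esym)
  Si Ti ST SF TF cF.
- move=> K /(subsetP allK) KK; apply: leq_trans (dense KK); apply/subset_leq_card/subsetP => K'.
  by rewrite !inE => /andP[K'a ->]; rewrite andbT; apply: (subsetP allK); rewrite !inE.
- by [].
- by rewrite cJJ; clear; lia.
- by rewrite cJJ; move: N0; clear; lia.
pose cl i := S i :: rcons (fl i) (T i).
have clK i K : i \in JJ -> K \in cl i -> K \in Kp.
  move=> iJ; rewrite inE mem_rcons inE => /or3P[/eqP ->|/eqP ->|Kf]; first exact: SK.
    exact: TK.
  by have [_ _ /(_ _ Kf) + _] := flP i iJ; rewrite in_setD => /andP[].
have cl_inj i j K : i \in JJ -> j \in JJ -> K \in cl i -> K \in cl j -> i = j.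
  have flF i' K' : i' \in JJ -> K' \in fl i' -> K' \in F by move=> iJ;
    have [_ _ h _] := flP i' iJ; apply: h.
  move=> iJ jJ; rewrite !inE !mem_rcons !inE.
  case/or3P=> [/eqP ->|/eqP ->|Ki]; case/or3P=> [/eqP E|/eqP E|Kj].
  - exact: Si.
  - by have := ST _ _ iJ jJ; rewrite E eqxx.
  - by have := SF _ iJ; rewrite (flF _ _ jJ Kj).
  - by have := ST _ _ jJ iJ; rewrite E eqxx.
  - exact: Ti.
  - by have := TF _ iJ; rewrite (flF _ _ jJ Kj).
  - by have := SF _ jJ; rewrite -E (flF _ _ iJ Ki).
  - by have := TF _ jJ; rewrite -E (flF _ _ iJ Ki).
  - by apply/eqP/negPn/negP => ij; have := fld _ _ iJ jJ ij K Ki; rewrite Kj.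
have [ch chP] : exists ch : U * bool -> seq V, {in JJ, forall i, [/\ size (ch i) = 244,
    uniq (st i :: ch i), path e (st i) (ch i), last (st i) (ch i) = en i &
    forall v, v \in st i :: ch i -> exists2 K, K \in cl i & v \in K]}.
  apply: (@exists_on _ _ [::] JJ (fun i c => [/\ size c = 244,
    uniq (st i :: c), path e (st i) c, last (st i) c = en i &
    forall v, v \in st i :: c -> exists2 K, K \in cl i & v \in K])) => i iJ;
      have [fs fu fF fp] := flP i iJ.
  have [|||||||p [sp up pp lp pK]] := @traverse_chain V e 5 (rcons (fl i) (T i)) (S i) (st i) (en
    i).
  - by move=> K /(clK _ _ iJ)/cK.
  - move=> K K' /(clK _ _ iJ) KK /(clK _ _ iJ) KK'; exact: (trivIsetP tK).
  - rewrite /= rcons_uniq mem_rcons inE (negbTE (ST _ _ iJ iJ)) fu andbT /=.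
    by apply/andP; split; apply/negP => /fF; apply/negP; [apply: SF|apply: TF].
  - exact: fp.
  - by rewrite /st /S; case: ifP => _; [have [] := cvP i iJ | apply: xbd].
  - by rewrite last_rcons /en /T; case: ifP => _; [apply: xbd | have [] := cvP i iJ].
  - by move/(congr1 size); rewrite size_rcons.
  exists p; split=> //; move: sp; rewrite size_rcons fs; clear; lia.
pose m h := ch (h, false) ++ w h :: st (h, true) :: ch (h, true).
have JJi h b : h \in Hr -> (h, b) \in JJ by rewrite inE.
have chcov i v : i \in JJ -> v \in st i :: ch i -> v \in cover Kp.
  move=> iJ; have [_ _ _ _ h] := chP i iJ; case/h => K /(clK _ _ iJ) KK vK.
  by apply/bigcupP; exists K.
have chinj i j v : i \in JJ -> j \in JJ -> v \in st i :: ch i -> v \in st j :: ch j -> i = j.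
  move=> iJ jJ; have [_ _ _ _ hi] := chP i iJ; have [_ _ _ _ hj] := chP j jJ.
  case/hi => K Ki vK /hj[K' Kj vK']; apply: (cl_inj _ _ K iJ jJ Ki).
  by rewrite (dKK K K' v) ?(clK _ _ iJ Ki) ?(clK _ _ jJ Kj).
have mem_m h v : h \in Hr -> v \in xv (h, false) :: m h ->
    v = w h \/ exists b, v \in st (h, b) :: ch (h, b).
  move=> hH; rewrite -cat_cons mem_cat [v \in w h :: _]inE.
  by case/or3P=> [h1|/eqP ->|h1]; [right; exists false|left|right; exists true].
exists m; split.
  move=> h hH; have [s0 u0 p0 l0 _] := chP _ (JJi h false hH).
  have [s1 u1 p1 l1 _] := chP _ (JJi h true hH).
  have [_ e0] := cvP _ (JJi h false hH); have [_ e1] := cvP _ (JJi h true hH).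
  have wn b : w h \notin st (h, b) :: ch (h, b).
    by apply: contra (wK hH); apply: chcov; apply: JJi.
  split.
  - by rewrite size_cat /= s0 s1.
  - rewrite -cat_cons; apply: uniq_cat => //.
      by rewrite cons_uniq wn.
    move=> x x0; rewrite inE => /orP[/eqP E|x1]; first by have := wn false; rewrite -E x0.
    by have := chinj _ _ _ (JJi h false hH) (JJi h true hH) x0 x1.
  - rewrite cat_path p0 l0 /= p1 andbT; apply/andP; split; last exact: e1.
    by rewrite esym; exact: e0.
  - by rewrite last_cat /= l1.
  - move=> v /(mem_m _ _ hH)[->|[b vb]]; first by rewrite setU11.
    by rewrite in_setU (chcov _ _ (JJi h b hH) vb) orbT.
move=> h k hH kH hk v vh; apply/negP => vk.
case: (mem_m _ _ hH vh) (mem_m _ _ kH vk) => [->|[b vb]] [E|[b' vb']].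
- by move/eqP: E; rewrite (inj_in_eq wi) // (negbTE hk).
- by have := wK hH; rewrite (chcov _ _ (JJi _ _ kH) vb').
- by have := wK kH; rewrite -E (chcov _ _ (JJi _ _ hH) vb).
- by have [E _] := chinj _ _ _ (JJi _ _ hH) (JJi _ _ kH) vb vb'; rewrite E eqxx in hk.
Qed.

End Absorb.

(** * Trees with few leaves *)

(** The deepest vertex of [F] is placed last, so it is the parent of no vertex of [F]. If its own
    parent is outside [F], the value of [f] there is arbitrary and imposes no edge. *)
Lemma greedy_forest (V U : finType) (e : rel V) (t : rel U) (r : U) par dep (v0 : V)
    (F : {set U}) (Y : {set V}) :
  rooted t r par dep -> (forall v, #|F| <= #|nbhd e v :&: Y|) ->
  exists f : U -> V, [/\ {in F &, injective f}, {in F, forall u, f u \in Y} &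
    {in F, forall u, u != r -> par u \in F -> e (f (par u)) (f u)}].
Proof.
move=> rt; elim: {F}#|F| {-2}F (erefl #|F|) => [|k IH] F Fk hF.
  move/eqP: Fk; rewrite cards_eq0 => /eqP ->; exists (fun=> v0).
  by split=> u; rewrite inE.
have [u0 u0F] : exists u, u \in F by apply: card_gt0_ex; rewrite Fk.
case: (@arg_maxnP _ u0 (fun u => u \in F) dep u0F) => u uF umax.
have Fk' : #|F :\ u| = k by move: Fk; rewrite (cardsD1 u) uF => -[].
have [|f [fi fY fe]] := IH (F :\ u) Fk'; first by move=> v; apply: leq_trans (hF v); rewrite Fk Fk'.
have [y] : exists y, y \in (nbhd e (f (par u)) :&: Y) :\: f @: (F :\ u).
  apply: card_gt0_ex; apply: leq_trans (card_setD_ge _ _); rewrite subn_gt0.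
  by apply: leq_ltn_trans (leq_imset_card _ _) _; rewrite Fk' -Fk.
rewrite in_setD in_setI inE => /andP[yf /andP[ey yY]].
exists (fupdate f u y); rewrite -(setD1K uF); split.
- by apply: inj_fupdate; rewrite ?setD11.
- move=> x; rewrite in_setU1; case: (eqVneq x u) => [-> _|xu /= xF]; first by rewrite fupdate_eq.
  by rewrite fupdate_neq // fY.
- move=> x; rewrite setD1K // => xF xr pxF.
  have pxu : par x != u.
    by apply: contraTneq (umax x xF) => E; rewrite (dep_par rt xr) E -ltnNge.
  rewrite [fupdate f u y (par x)]fupdate_neq //.
  case: (eqVneq x u) => [->|xu]; first by rewrite fupdate_eq.
  by rewrite fupdate_neq // fe // in_setD1 ?xu ?pxu.
Qed.

Section PathCase.
Variables (V U : finType) (e : rel V) (t : rel U) (V1 V2 Z : {set V}) (s N q : nat).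
Variables (KK Kgood Kbad : {set {set V}}).
Variables (r : U) (par : U -> U) (dep : U -> nat) (H : {set U}) (c : U -> U).
Hypotheses (eg : simple_graph e) (rt : rooted t r par dep) (card_UV : #|U| = #|V|).
Hypothesis join : joined e V1 s.
Hypotheses (V12 : V1 :|: V2 = [set: V]) (dV : [disjoint V1 & V2]) (cV2 : #|V2| = 500 * N).
Hypothesis KKP : {in KK, forall K : {set V}, K \subset V2 /\ is_clique e 5 K}.
Hypotheses (tKK : trivIset KK) (cKK : #|KK| = 100 * N) (KKE : KK = Kgood :|: Kbad).
Hypotheses (dKK : [disjoint Kgood & Kbad]) (cKbad : #|Kbad| = N).
Hypothesis deg2 : forall v, v \notin cover Kgood -> 40 * N <= deg_in e v V2.
Hypothesis Kdense : {in Kgood, forall K : {set V},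
  #|[set K' in Kgood | ~~ has_matching e 3 K K']| <= N}.
Hypotheses (N0 : 0 < N) (q495 : 495 <= q).
Let F := ~: interior q H c.
Hypotheses (bp : bare_paths r par q H c) (cF : #|F| + q * #|H| = #|U|) (H3 : 3 * N <= #|H|).
Hypotheses (ZV1 : Z \subset V1) (Zrich : forall v, 2 * s + q * (2 * s) <= #|nbhd e v :&: Z|).
Hypothesis Zsmall : #|Z| + (2 * s * s + 4 * s + 4 * s * q) <= N.
Hypothesis degF : forall v, #|F| <= #|nbhd e v :&: (V1 :\: Z)|.

Let V1n v : v \in V1 -> v \notin V2.
Proof. by move=> h; rewrite (disjointFr dV h). Qed.

Let KV2 K v : K \in KK -> v \in K -> v \in V2.
Proof. by move=> KK' vK; have [/subsetP h _] := KKP KK'; apply: h. Qed.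

Let cliqueK K : K \in KK -> is_clique e 5 K.
Proof. by case/KKP. Qed.

Let cardK K : K \in KK -> #|K| = 5.
Proof. by move/cliqueK => /andP[/eqP]. Qed.

Let sameK K K' v : K \in KK -> K' \in KK -> v \in K -> v \in K' -> K = K'.
Proof.
move=> KKK KK' vK vK'; apply/eqP/negPn/negP => ne; have /trivIsetP/(_ _ _ KKK KK' ne) := tKK.
by move/disjointFr => /(_ _ vK); rewrite vK'.
Qed.

(** The [100 * N] disjoint cliques of size 5 exhaust the [500 * N] vertices. *)
Let coverKK : cover KK = V2.
Proof.
apply/eqP; rewrite eqEcard; apply/andP; split.
  by apply/bigcupsP => K /KKP[].
have /eqP <- := tKK; rewrite (eq_bigr (fun=> 5)); last by move=> K /cardK.
by rewrite sum_nat_const cKK cV2; clear; lia.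
Qed.

(** One clique contains at most 5 of the [40 * N] neighbours. *)
Let touched v : v \notin cover Kgood -> 8 * N <= #|[set K in KK | [exists a in K, e v a]]|.
Proof.
move=> vK; rewrite -(@leq_pmul2r 5) //.
apply: (@leq_trans (deg_in e v V2)); first by apply: leq_trans (deg2 vK); clear; lia.
rewrite -sum_nat_const.
apply: (@leq_trans (\sum_(K in [set K in KK | [exists a in K, e v a]]) #|K|)).
  apply: leq_trans (card_bigcup_leq _ _); apply/subset_leq_card/subsetP => a.
  rewrite in_setI inE -coverKK => /andP[ea /bigcupP[K KKK aK]].
  apply/bigcupP; exists K => //; rewrite inE KKK; apply/existsP; exists a.
  by rewrite aK.
by apply: leq_sum => K; rewrite inE => /andP[/cardK -> _].
Qed.

(** A row splits its [q] vertices as [2 + 491 + (q - 493)] and a dump as [2 + 5 + (q - 7)], the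
    middle part being served by cliques and the absorbed vertex; 2 is the least length of a
    connecting path. So the connecting paths save [491 * N + 2 * N * 5 = 501 * N] vertices, and
    against [#|V2| = 500 * N] this leaves [N] holes in [V1]. *)
Lemma path_case : contains_copy e t.
Proof.
have [esym eirr] := eg; have [b1 b2 b3 b4 b5] := bp.
have q0 : 0 < q by apply: leq_trans q495.
have [v0 _] : exists v0, v0 \in V2 by apply: card_gt0_ex; rewrite cV2; move: N0; clear; lia.
have [f0 [f0i f0Y f0e]] := greedy_forest v0 rt degF.
have f0V1 u : u \in F -> f0 u \in V1 by move/f0Y; rewrite in_setD => /andP[].
have cpar h : h \in H -> par h \in F by case/b1 => _ h1 _; rewrite inE.
have cend h : h \in H -> iter q c h \in F by case/b1 => _ _ h1; rewrite inE.
have endi : {in H &, injective (fun h => iter q c h)}.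
  have pE k : k \in H -> par (iter q c k) = iter q.-1 c k.
    by move=> kH; have [_ h1] := b2 k kH q.-1 (eq_leq (prednK q0)); rewrite -h1 prednK.
  move=> h k hH kH /= E; have := congr1 par E; rewrite !pE // => E'.
  by have [] := b3 h k hH kH q.-1 q.-1 (eq_leq (prednK q0)) (eq_leq (prednK q0)) E'.
(* Rows absorb one uncovered vertex each; dumps swallow one clique each. *)
have [Hr [HrH cHr]] : exists B : {set U}, B \subset H /\ #|B| = N.
  by apply: subset_of_card; move: H3; clear; lia.
have [Hd [HdH cHd]] : exists B : {set U}, B \subset H :\: Hr /\ #|B| = 2 * N.
  apply: subset_of_card; apply: leq_trans (card_setD_ge _ _); rewrite cHr.
  by move: H3; clear; lia.
have dRD h : h \in Hd -> h \notin Hr by move/(subsetP HdH); rewrite in_setD => /andP[].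
have HdH' h : h \in Hd -> h \in H by move/(subsetP HdH); rewrite in_setD => /andP[].
have HrH' h : h \in Hr -> h \in H by apply: (subsetP HrH).
pose Hm := Hr :|: Hd.
have HmH h : h \in Hm -> h \in H by rewrite in_setU => /orP[/HrH'|/HdH'].
have cKgood : #|Kgood| = 99 * N.
  have := cKK; rewrite KKE cardsU disjoint_setI0 // cards0 subn0 cKbad; clear; lia.
have [Kp [KpG cKp]] : exists B : {set {set V}}, B \subset Kgood /\ #|B| = 98 * N.
  by apply: subset_of_card; rewrite cKgood leq_mul2r orbT.
have GK K : K \in Kgood -> K \in KK by rewrite KKE inE => ->.
have KpK K : K \in Kp -> K \in KK by move/(subsetP KpG)/GK.
(* These are all the bad cliques and the [N] good ones outside [Kp]. *)
pose Kd := KK :\: Kp.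
have cKd : #|Kd| = 2 * N.
  rewrite cardsDS; last by apply/subsetP => K; apply: KpK.
  by rewrite cKK cKp; clear; lia.
pose JJ := [set i : U * bool | i.1 \in Hr].
have cJJ : #|JJ| = 2 * N.
  have -> : JJ = setX Hr [set: bool] by apply/setP => -[i b]; rewrite !inE andbT.
  by rewrite cardsX cardsT card_bool mulnC cHr.
have [bd [bdi bdK]] : exists f : U * bool -> {set V}, {in JJ &, injective f} /\
    {in JJ, forall i, f i \in Kp}.
  by apply: (inj_into set0); rewrite cJJ cKp leq_mul2r orbT.
have [dk [dki dkK]] : exists f : U -> {set V}, {in Hd &, injective f} /\
    {in Hd, forall h, f h \in Kd}.
  by apply: (inj_into set0); rewrite cHd cKd.
have dkKK h : h \in Hd -> dk h \in KK by move/dkK; rewrite in_setD => /andP[].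
pose vx (K : {set V}) (b : bool) := nth v0 (enum K) b.
have vxK K b : K \in KK -> vx K b \in K.
  by move=> KKK; rewrite -mem_enum mem_nth // -cardE cardK //; case: b.
have vx_ne K : K \in KK -> vx K false != vx K true.
  by move=> KKK; rewrite /vx nth_uniq ?enum_uniq // -cardE cardK.
(* The vertices where connecting paths meet cliques. A row has its two ends in different cliques, so
   one fixed vertex of each will do; a dump needs two distinct vertices of one clique. *)
pose X (i : U * bool) := if i.1 \in Hr then vx (bd i) false else vx (dk i.1) i.2.
have Xr h b : h \in Hr -> X (h, b) \in bd (h, b) /\ bd (h, b) \in Kp.
  move=> hH; have bK : bd (h, b) \in Kp by apply: bdK; rewrite inE.
  by rewrite /X /= hH; split=> //; apply/vxK/KpK.
have Xd h b : h \in Hd -> X (h, b) = vx (dk h) b.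
  by move=> hH; rewrite /X /= (negbTE (dRD _ hH)).
have XV2 h b : h \in Hm -> X (h, b) \in V2.
  rewrite in_setU => /orP[hH|hH].
    by have [h1 h2] := Xr h b hH; apply: KV2 (KpK _ h2) h1.
  by rewrite Xd //; apply: (KV2 (dkKK _ hH)); apply/vxK/dkKK.
have Xi h k b : h \in Hm -> k \in Hm -> X (h, b) = X (k, b) -> h = k.
  rewrite !in_setU => /orP[hH|hH] /orP[kH|kH] E.
  - have [h1 h2] := Xr h b hH; have [k1 k2] := Xr k b kH; rewrite E in h1.
    have := sameK (KpK _ h2) (KpK _ k2) h1 k1.
    by move/(bdi (h, b) (k, b)); rewrite !inE => /(_ hH kH) [].
  - have [h1 h2] := Xr h b hH; rewrite E Xd // in h1.
    have := dkK _ kH; rewrite in_setD -(sameK (KpK _ h2) (dkKK _ kH) h1 _) ?h2 //.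
    exact/vxK/dkKK.
  - have [h1 h2] := Xr k b kH; rewrite -E Xd // in h1.
    have := dkK _ hH; rewrite in_setD -(sameK (KpK _ h2) (dkKK _ hH) h1 _) ?h2 //.
    exact/vxK/dkKK.
  - rewrite !Xd // in E; apply: dki => //;
      apply: (sameK (dkKK _ hH) (dkKK _ kH) (vxK _ b (dkKK _ hH))).
    by rewrite E vxK ?dkKK.
(* Request [(h, false)] runs from the upper end of the bare path to its clique part, or to the lower
   end if it has none; request [(h, true)] runs from the clique part to the lower end. *)
pose src (i : U * bool) := if i.2 then X i else f0 (par i.1).
pose dst (i : U * bool) := if ~~ i.2 && (i.1 \in Hm) then X i else f0 (iter q c i.1).
pose len (i : U * bool) := if i.2 then (if i.1 \in Hr then q - 493 else q - 7)
  else (if i.1 \in Hm then 2 else q).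
pose J := [set i : U * bool | if i.2 then i.1 \in Hm else i.1 \in H].
have inJ h b : ((h, b) \in J) = if b then h \in Hm else h \in H by rewrite [LHS]inE.
have srci : {in J &, injective src}.
  move=> [h b] [k b']; rewrite !inJ /src /=; case: b; case: b' => hH kH E.
  - by rewrite (Xi _ _ _ hH kH E).
  - by have := XV2 h true hH; rewrite E (negbTE (V1n (f0V1 _ (cpar _ kH)))).
  - by have := XV2 k true kH; rewrite -E (negbTE (V1n (f0V1 _ (cpar _ hH)))).
  - by rewrite (b5 _ _ hH kH (f0i _ _ (cpar _ hH) (cpar _ kH) E)).
have dsti : {in J &, injective dst}.
  have dE h b : (h, b) \in J -> h \in H by rewrite inJ; case: b => // /HmH.
  move=> [h b] [k b'] hJ kJ; have hH := dE _ _ hJ; have kH := dE _ _ kJ; rewrite /dst /=.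
  case: ifP => hh; case: ifP => kk E.
  - move: hJ kJ hh kk E; rewrite !inJ; case: b; case: b' => //= _ _ hh kk E.
    by rewrite (Xi _ _ _ hh kk E).
  - by have /andP[_ h1] := hh; have := XV2 h b h1; rewrite E (negbTE (V1n (f0V1 _ (cend _ kH)))).
  - by have /andP[_ h1] := kk; have := XV2 k b' h1; rewrite -E (negbTE (V1n (f0V1 _ (cend _ hH)))).
  - have hk : h = k by apply: endi => //; apply: f0i => //; apply: cend.
    subst k; move: hJ kJ hh kk; rewrite !inJ.
    by case: b; case: b' => //= x y z u; [rewrite x in u|rewrite y in z].
pose A := (V1 :\: Z) :\: f0 @: F.
have AV1 : A :|: Z \subset V1.
  by rewrite subUset ZV1 andbT; apply: subset_trans (subsetDl _ _) (subsetDl _ _).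
have dAZ : [disjoint A & Z].
  by rewrite -setI_eq0; apply/eqP/setP => v; rewrite in_set0 in_setI !in_setD; case: (v \in Z);
    rewrite ?andbF.
have cV1 : #|V1| + 500 * N = #|V|.
  by rewrite -cV2 -cardsT -V12 cardsU disjoint_setI0 // cards0 subn0.
have cA : #|A| + #|Z| + #|F| + 500 * N = #|V|.
  rewrite -cV1 -(card_in_imset f0i) cardsDS; last first.
    by apply/subsetP => _ /imsetP[u uF ->]; apply: f0Y.
  have h1 : #|f0 @: F| <= #|V1 :\: Z|.
    by apply/subset_leq_card/subsetP => _ /imsetP[u uF ->]; apply: f0Y.
  by move: h1; rewrite cardsDS //; move: (subset_leq_card ZV1); clear; lia.
have sumlen : \sum_(i in J) len i + 501 * N = q * #|H|.
  have -> : \sum_(i in J) len i = \sum_(h in H) len (h, false) + \sum_(h in Hm) len (h, true).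
    rewrite (bigID (fun i : U * bool => i.2)) /= addnC; congr (_ + _).
      rewrite (reindex_onto (fun h => (h, false)) fst) /=; last by case=> h [] //; rewrite andbF.
      by apply: eq_bigl => h; rewrite inE /= eqxx !andbT.
    rewrite (reindex_onto (fun h => (h, true)) fst) /=; last by case=> h [] //; rewrite andbF.
    by apply: eq_bigl => h; rewrite inE /= eqxx !andbT.
  have dHrd : [disjoint Hr & Hd].
    rewrite -setI_eq0; apply/eqP/setP => h; rewrite in_set0 in_setI; apply/negbTE/negP.
    by case/andP=> h1 /dRD; rewrite h1.
  have cHm : #|Hm| = 3 * N.
    by rewrite cardsU disjoint_setI0 // cards0 subn0 cHr cHd; clear; lia.
  have -> : \sum_(h in H) len (h, false) = 3 * N * 2 + (#|H| - 3 * N) * q.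
    rewrite (big_setID Hm) /=; congr (_ + _).
      rewrite (eq_bigr (fun=> 2)); last by move=> h; rewrite in_setI /len /= => /andP[_ ->].
      rewrite sum_nat_const (_ : H :&: Hm = Hm) ?cHm //.
      by apply/setIidPr/subsetP => h; apply: HmH.
    rewrite (eq_bigr (fun=> q)); last by move=> h; rewrite in_setD /len /= => /andP[/negbTE ->].
    rewrite sum_nat_const cardsDS ?cHm //.
    by apply/subsetP => h; apply: HmH.
  have -> : \sum_(h in Hm) len (h, true) = N * (q - 493) + 2 * N * (q - 7).
    rewrite (big_setID Hr) /=; congr (_ + _).
      rewrite (eq_bigr (fun=> q - 493)); last by move=> h; rewrite in_setI /len /= => /andP[_ ->].
      by rewrite sum_nat_const setIC (setIidPl (subsetUl _ _)) cHr.
    rewrite (eq_bigr (fun=> q - 7)); last by move=> h; rewrite in_setD /len /= => /andP[/negbTE ->].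
    rewrite sum_nat_const setDUl setDv set0U; congr (_ * _).
    by rewrite -cHd; congr #|pred_of_set _|; apply/setDidPl; rewrite disjoint_sym.
  move: q495 H3; clear; move: #|H| => x h1 h2.
  rewrite mulnBl mulnBr mulnBr.
  have : 3 * N * q <= x * q by rewrite leq_mul2r h2 orbT.
  have : N * 493 <= N * q by rewrite leq_mul2l; apply/orP; right; lia.
  have : 2 * N * 7 <= 2 * N * q by rewrite leq_mul2l; apply/orP; right; lia.
  by rewrite [q * x]mulnC -!mulnA; move: (N * q) (x * q); lia.
have lenP i : 2 <= len i <= q.
  rewrite /len; move: q495; case: ifP => _; case: ifP => _; clear; lia.
have [||P [PP Pd]] := @connect_all V e V1 s esym join _ src dst len q lenP J A Z AV1 dAZ _ Zrich.
- move=> v; pose S1 := [set i in J | src i == v]; pose S2 := [set i in J | dst i == v].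
  apply: (@leq_trans #|S1 :|: S2|).
    by apply/subset_leq_card/subsetP => i; rewrite !inE => /andP[-> ->].
  apply: leq_trans (leq_card_setU _ _) _;
    apply: (leq_add (m1 := #|S1|) (m2 := #|S2|) (n1 := 1) (n2 := 1));
    apply/card_le1_eqP => i j; rewrite !inE => /andP[iJ /eqP E] /andP[jJ /eqP E'];
    [apply: srci|apply: dsti]; rewrite ?inE //; by rewrite E E'.
- by move: sumlen cA cF Zsmall; rewrite card_UV; clear; lia.
pose used := \bigcup_(i in J) [set x in P i].
have cused : #|used| <= \sum_(i in J) len i.
  apply: leq_trans (card_bigcup_leq _ _) _; apply: leq_sum => i iJ.
  by have [si ui _ _] := PP i iJ; rewrite cardsE (card_uniqP ui) si.
(* The vertices to absorb are known only now, after all requests have been served. *)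
pose W := (A :|: Z) :\: used.
have cW : N <= #|W|.
  apply: leq_trans (card_setD_ge _ _); rewrite cardsU disjoint_setI0 // cards0 subn0.
  by move: cused sumlen cA cF; rewrite card_UV; clear; lia.
have [w [wi wW]] : exists f : U -> V, {in Hr &, injective f} /\ {in Hr, forall h, f h \in W}.
  by apply: (inj_into v0); rewrite cHr.
have wAZ h : h \in Hr -> w h \in A :|: Z by move/wW; rewrite in_setD => /andP[].
have wV1 h : h \in Hr -> w h \in V1 by move/wAZ/(subsetP AV1).
have wused h i : h \in Hr -> i \in J -> w h \notin P i.
  move=> /wW; rewrite in_setD => /andP[nu _] iJ; apply: contra nu => wP.
  by apply/bigcupP; exists i; rewrite // inE.
have coverV2 (Q : {set {set V}}) v : {subset Q <= KK} -> v \in cover Q -> v \in V2.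
  by move=> QK /bigcupP[K /QK KQ]; apply: KV2.
have [|||||||||||||m1 [m1P m1d]] := @absorb V U e Kp Hr N bd X w.
- exact: esym.
- by move=> K /KpK/cliqueK.
- by apply: trivIsetS tKK; apply/subsetP => K; apply: KpK.
- exact: cKp.
- exact: cHr.
- exact: N0.
- move=> K KKp; have KG := subsetP KpG _ KKp; apply: leq_trans (Kdense KG).
  apply/subset_leq_card/subsetP => K'; rewrite !inE => /andP[/(subsetP KpG) -> nl] /=.
  by apply: contra nl; apply: robust_link_of_matching.
- exact: bdi.
- exact: bdK.
- by move=> [h b]; rewrite inE => /= hH; have [] := Xr h b hH.
- exact: wi.
- by move=> h hH; apply/negP => /(coverV2 _ _ KpK); rewrite (negbTE (V1n (wV1 _ hH))).
- move=> h hH.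
  have nG : w h \notin cover Kgood.
    by apply/negP => /(coverV2 _ _ GK); rewrite (negbTE (V1n (wV1 _ hH))).
  (* Of the [8 * N] cliques touched by [w h], at most [#|Kd| = 2 * N] are outside [Kp]. *)
  apply: (@leq_trans (8 * N - 2 * N)); first by clear; lia.
  apply: leq_trans (leq_sub (touched nG) (leqnn _)) _; rewrite -cKd.
  apply: leq_trans (card_setD_ge _ _) _; apply/subset_leq_card/subsetP => K.
  by rewrite !inE => /andP[+ /andP[KKK ->]]; rewrite KKK !andbT negbK.
have [m2 m2P] : exists m2 : U -> seq V, {in Hd, forall h, [/\ (size (m2 h)).+1 = 5,
    uniq (X (h, false) :: m2 h), path e (X (h, false)) (m2 h), last (X (h, false)) (m2 h) = X (h,
      true) &
    {subset X (h, false) :: m2 h <= dk h}]}.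
  apply: (@exists_on _ _ [::] Hd (fun h p => [/\ (size p).+1 = 5,
    uniq (X (h, false) :: p), path e (X (h, false)) p, last (X (h, false)) p = X (h, true) &
    {subset X (h, false) :: p <= dk h}])) => h hH; rewrite !Xd //.
  by apply: traverse_clique; rewrite ?vxK ?vx_ne ?cliqueK ?dkKK.
pose m h := X (h, false) :: (if h \in Hr then m1 h else m2 h).
have mP h : h \in Hm -> [/\ size (m h) = if h \in Hr then 491 else 5, uniq (m h),
    path e (X (h, false)) (behead (m h)), last (X (h, false)) (behead (m h)) = X (h, true) &
    forall v, v \in m h -> [\/ h \in Hr /\ v = w h, h \in Hr /\ v \in cover Kp | h \in Hd /\ v
      \in dk h]].
  rewrite in_setU /m /=; case: ifP => [hH _|_ /= hH].
    have [-> u1 p1 l1 h1] := m1P h hH; split=> // v /h1; rewrite in_setU1.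
    by case/orP=> [/eqP ->|vK]; [constructor 1|constructor 2].
  have [-> u1 p1 l1 h1] := m2P h hH; split=> // v /h1 vd; by constructor 3.
have mV2 h v : h \in Hm -> v \in m h -> (h \in Hr /\ v = w h) \/ v \in V2.
  move=> hH vm; have [_ _ _ _ h1] := mP h hH; case: (h1 v vm) => [[hr ->]|[hr vK]|[hd vK]].
  - by left.
  - by right; apply: (coverV2 Kp).
  - by right; apply: (KV2 (dkKK _ hd)).
have PAZ i v : i \in J -> v \in P i -> v \in A :|: Z by move=> iJ; have [_ _ h _] := PP i iJ;
  apply: h.
have Pm i h v : i \in J -> h \in Hm -> v \in P i -> v \in m h -> False.
  move=> iJ hH vP vm; case: (mV2 h v hH vm) => [[hr E]|v2].
    by have := wused h i hr iJ; rewrite -E vP.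
  by have := V1n (subsetP AV1 _ (PAZ _ _ iJ vP)); rewrite v2.
have mdisj h k v : h \in Hm -> k \in Hm -> h != k -> v \in m h -> v \in m k -> False.
  move=> hH kH hk vh vk.
  have [_ _ _ _ h1] := mP h hH; have [_ _ _ _ k1] := mP k kH.
  have dnK l x : l \in Hd -> x \in dk l -> x \in cover Kp -> False.
    move=> lH xd /bigcupP[K KKp xK]; have := dkK _ lH; rewrite in_setD.
    by rewrite -(sameK (KpK _ KKp) (dkKK _ lH) xK xd) KKp.
  have case_r : h \in Hr -> k \in Hr -> False.
    move=> hr kr; move: vh vk; rewrite /m hr kr => vh.
    by rewrite (negbTE (m1d h k hr kr hk v vh)).
  have wn l x : l \in Hr -> x \in V2 -> x = w l -> False.
    by move=> lr x2 E; have := V1n (wV1 _ lr); rewrite -E x2.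
  case: (h1 v vh) => [[hr E]|[hr vK]|[hd vK]]; case: (k1 v vk) => [[kr E']|[kr vK']|[kd vK']];
    try exact: case_r.
  - by apply: (wn h v) => //; apply: (KV2 (dkKK _ kd)).
  - exact: dnK vK' vK.
  - by apply: (wn k v) => //; apply: (KV2 (dkKK _ hd)).
  - exact: dnK vK vK'.
  - move/eqP: hk; apply; apply: dki => //.
    exact: sameK (dkKK _ hd) (dkKK _ kd) vK vK'.
pose Q h := if h \in Hm then P (h, false) ++ m h ++ P (h, true) else P (h, false).
have Jf h : h \in H -> (h, false) \in J by move=> hH; rewrite inJ.
have Jt h : h \in Hm -> (h, true) \in J by move=> hH; rewrite inJ.
have memQ h v : h \in H -> v \in Q h ->
    (exists2 b, (h, b) \in J & v \in P (h, b)) \/ (h \in Hm /\ v \in m h).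
  move=> hH; rewrite /Q; case: ifP => hm; last by left; exists false => //; apply: Jf.
  rewrite !mem_cat => /or3P[vP|vm|vP]; last by left; exists true => //; apply: Jt.
    by left; exists false => //; apply: Jf.
  by right.
apply: (@assemble_bare_paths U t r par dep q rt q0 V e f0 Q H c esym bp f0i f0e).
- move=> h hH; have [s0 _ _ _] := PP _ (Jf _ hH); rewrite /Q; case: ifP => hm; last first.
    by rewrite s0 /len /= hm.
  have [s1 _ _ _] := PP _ (Jt _ hm); have [sm _ _ _ _] := mP h hm.
  rewrite !size_cat s0 s1 sm /len /= hm; case: ifP => _; move: q495; clear; lia.
- move=> h hH; have [_ u0 _ _] := PP _ (Jf _ hH); rewrite /Q; case: ifP => hm //.
  have [_ u1 _ _] := PP _ (Jt _ hm); have [_ um _ _ _] := mP h hm.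
  apply: uniq_cat => //.
    apply: uniq_cat => // v vm vP; exact: (Pm _ _ _ (Jt _ hm) hm vP vm).
  move=> v v0P; rewrite mem_cat => /orP[vm|v1P]; first exact: (Pm _ _ _ (Jf _ hH) hm v0P vm).
  have ne : (h, false) != (h, true) by rewrite xpair_eqE andbF.
  by have := Pd _ _ (Jf _ hH) (Jt _ hm) ne v v0P; rewrite v1P.
- move=> h hH; have [_ _ _ p0] := PP _ (Jf _ hH); rewrite /Q; case: ifP => hm; last first.
    by move: p0; rewrite /src /dst /= hm.
  have [_ _ _ p1] := PP _ (Jt _ hm); have [_ _ pm lm _] := mP h hm.
  move: p0 p1; rewrite /src /dst /= hm => p0 p1.
  have -> z : rcons (P (h, false) ++ m h ++ P (h, true)) z =
      P (h, false) ++ X (h, false) :: (behead (m h) ++ rcons (P (h, true)) z).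
    by rewrite rcons_cat /m /= rcons_cat.
  apply: path_glue => //; rewrite cat_path; apply/andP; split; first exact: pm.
  by rewrite lm.
- move=> h hH v /(memQ _ _ hH)[[b bJ vP]|[hm vm]]; apply/imsetP => -[u uF E].
    have := PAZ _ _ bJ vP; rewrite in_setU !in_setD E imset_f //=.
    by have := f0Y u uF; rewrite in_setD => /andP[/negbTE ->].
  case: (mV2 h v hm vm) => [[hr E']|v2]; last by have := V1n (f0V1 _ uF); rewrite -E v2.
  have := wAZ _ hr; rewrite -E' in_setU !in_setD E imset_f //=.
  by have := f0Y u uF; rewrite in_setD => /andP[/negbTE ->].
- move=> h k hH kH hk v vh; apply/negP => vk.
  case: (memQ _ _ hH vh) (memQ _ _ kH vk) => [[b bJ vP]|[hm vm]] [[b' bJ' vP']|[km vm']].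
  + have ne : (h, b) != (k, b') by apply: contraNneq hk => -[-> _].
    by have := Pd _ _ bJ bJ' ne v vP; rewrite vP'.
  + exact: Pm bJ km vP vm'.
  + exact: Pm bJ' hm vP' vm.
  + exact: mdisj hm km hk vm vm'.
Qed.

End PathCase.

(** * Choice of the constants *)

Lemma scaled_le x y k a n : 0 < a -> x * (k * a) <= n -> n <= y * a -> x * k <= y.
Proof. by move=> a0 h1 h2; rewrite -(leq_pmul2r a0) -mulnA; apply: leq_trans h1 h2. Qed.

Lemma hitting_in (V I : finType) (A : I -> {set V}) (J : {set I}) (G0 : {set V}) a m :
  (exists Z : {set V}, #|Z| * m <= #|V| /\
    (forall i, i \in J -> #|V| <= #|A i :&: Z| * (8 * a * m))) ->
  (forall i, i \in J -> A i \subset G0) ->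
  exists Z : {set V}, [/\ Z \subset G0, #|Z| * m <= #|V| &
    (forall i, i \in J -> #|V| <= #|A i :&: Z| * (8 * a * m))].
Proof.
case=> Z [Zm ZA] AG; exists (Z :&: G0); split.
- exact: subsetIr.
- by apply: leq_trans Zm; rewrite leq_mul2r subset_leq_card ?orbT // subsetIl.
- move=> i iJ; have -> : A i :&: (Z :&: G0) = A i :&: Z; last exact: ZA.
  by rewrite setIA setIAC; congr (_ :&: _); apply/setIidPl/AG.
Qed.

(** Bernoulli: [(1 + 1/(b - 1))^b >= 2]. Thus [b] steps of the potential halve it. *)
Lemma two_le_pow b : 1 < b -> 2 * b.-1 ^ b <= b ^ b.
Proof.
case: b => [|[|d]] // _; set k := d.+2; rewrite /=.
have bern j : d.+1 ^ j * d.+1 + j * d.+1 ^ j <= d.+2 ^ j * d.+1.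
  elim: j => [|j IH]; first by rewrite !expn0; lia.
  rewrite !expnS; nia.
have := bern k; rewrite /k -[X in _ <= X]mulnC; set x := d.+1 ^ d.+2; set y := d.+2 ^ d.+2.
nia.
Qed.

Section Cases.
Variables (V U : finType) (e : rel V) (t : rel U) (V1 V2 : {set V}) (s N a lam : nat).
Hypotheses (eg : simple_graph e) (tt : tree t) (card_UV : #|U| = #|V|).
Hypotheses (V12 : V1 :|: V2 = [set: V]) (dV : [disjoint V1 & V2]) (cV2 : #|V2| = 500 * N).
Hypotheses (join : joined e V1 s) (s25 : 25 <= s) (a0 : 0 < a).
Let n := #|V|.
Let D := max_degree t.
(** The exceptional pairs of (3) in integers, with [1 / a] in place of [alpha]. *)
Let ex : rel V := fun v w => #|nbhd e v :&: nbhd e w :&: V1| * a < n.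
Hypotheses (exfew : forall v, #|[set w | ex v w]| <= lam) (lamn : lam < n).

Let card_V1 : #|V1| + 500 * N = n.
Proof. by rewrite -cV2 /n -cardsT -V12 cardsU disjoint_setI0 // cards0 subn0. Qed.

Let degV1 v : n <= #|nbhd e v :&: V1| * a.
Proof.
have [w nw] : exists w, ~~ ex v w.
  apply/existsP; rewrite -negb_forall; apply/negP => /forallP h.
  have := exfew v; have -> : [set w | ex v w] = [set: V] by apply/setP => w; rewrite !inE h.
  by rewrite cardsT leqNgt lamn.
move: nw; rewrite /ex -leqNgt => /leq_trans; apply; rewrite leq_mul2r; apply/orP; right.
by apply/subset_leq_card/setSI/subsetIl.
Qed.

Lemma star_case_numeric (E : nat) (xs : V) (Rs Ss : {set V}) (x : U) :
  Rs \subset V1 -> Ss \subset V1 -> [disjoint Rs & Ss] -> #|Ss| <= 25 * s + 25 ->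
  Ss \subset nbhd e xs -> #|Rs| <= 25 ->
  (exists sv : V -> V,
     {in [set v in Rs | ~~ e xs v], forall v, sv v \in Ss /\ e v (sv v)} /\
     {in [set v in Rs | ~~ e xs v] &, injective sv}) ->
  (forall w, w \notin Rs :|: Ss -> 2 * s <= deg_in e w Ss) ->
  #|Ss| + 25 < #|leaf_parents_at t x| ->
  0 < E -> n <= #|leaves t| * E -> a <= E ->
  (forall A : V -> {set V}, (forall v, n <= #|A v| * (2 * a)) -> exists Z : {set V},
     #|Z| * (8 * E) <= n /\ (forall v, n <= #|A v :&: Z| * (8 * (2 * a) * (8 * E)))) ->
  s * D * (128 * a * E) <= n -> 500 * N * (8 * E) <= n -> (2 * s * D + D) * (8 * E) <= n ->
  (3 * s + 2 * (25 * s + 51)) * (8 * E) <= n ->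
  contains_copy e t.
Proof.
move=> RV SV dRS cS Sx cR [sv [svP svi]] Srich xP E0 nE aE hit h1 h2 h3 h4.
pose G := xs |: (Ss :|: Rs).
have cG : #|G| <= 25 * s + 51.
  rewrite /G cardsU1; have [+ _] := leq_card_setU Ss Rs.
  by move: cS cR; case: (_ \notin _); clear; lia.
have E8 x' : x' * (8 * E) <= n -> x' * 8 <= #|leaves t| by move=> h; apply: scaled_le h nE.
have a8 x' v : x' * (8 * E) <= n -> x' * 8 <= #|nbhd e v :&: V1|.
  move=> h; apply: (scaled_le a0 _ (degV1 v)); apply: leq_trans h.
  by rewrite !leq_mul2l aE !orbT.
have G8 v : #|G| * 8 <= #|nbhd e v :&: V1|.
  apply: a8; apply: leq_trans h4; rewrite leq_mul2r; apply/orP; right.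
  by apply: leq_trans cG _; clear; lia.
have [|Z0 [Zc Zh]] := hit (fun v => (nbhd e v :&: V1) :\: G).
  move=> v; apply: leq_trans (degV1 v) _; rewrite mulnA leq_mul2r; apply/orP; right.
  have := card_setD_ge (nbhd e v :&: V1) G; move: (G8 v); clear; lia.
have [||W0 [W0s W0c W0h]] := @hitting_in V V (fun v => (nbhd e v :&: V1) :\: G) [set: V] (V1 :\:
  G) (2 * a) (8 * E).
- by exists Z0; split=> // v _; apply: Zh.
- by move=> v _; apply/setSD/subsetIr.
have W08 : #|W0| * 8 <= #|leaves t| by apply: E8.
have W0G : [disjoint W0 & G].
  rewrite -setI_eq0; apply/eqP/setP => v; rewrite in_set0 in_setI; apply/negbTE/negP.
  by case/andP=> /(subsetP W0s); rewrite in_setD => /andP[/negbTE ->].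
have sD v : s * D * 8 <= #|nbhd e v :&: V1|.
  apply: a8; apply: leq_trans h3; rewrite leq_mul2r; apply/orP; right; clear; nia.
have Yc : #|V1| <= #|(V1 :\: W0) :\: G| + #|W0| + #|G|.
  have := card_setD_ge V1 W0; have := card_setD_ge (V1 :\: W0) G; clear; lia.
apply: (@star_case V U e t V1 s xs Rs Ss W0 sv x eg tt card_UV join _ RV SV dRS Sx cR svP svi).
- exact: leq_trans s25.
- by move=> w /Srich; apply: leq_trans; move: s25; clear; lia.
- exact: W0G.
- move=> v; have h := W0h v (in_setT v).
  have p0 : 0 < 8 * (2 * a) * (8 * E) by rewrite !muln_gt0 a0 E0.
  apply: (@leq_trans #|((nbhd e v :&: V1) :\: G) :&: W0|).
    rewrite -(leq_pmul2r p0); apply: leq_trans h; apply: leq_trans h1.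
    by apply: eq_leq; rewrite -/D; congr (_ * _); clear; lia.
  by apply/subset_leq_card/setSI; apply: subset_trans (subsetDl _ _) (subsetIl _ _).
- move=> v; have : #|nbhd e v :&: V1| <= #|nbhd e v :&: ((V1 :\: W0) :\: G)| + #|W0| + #|G|.
    have := card_setD_ge (nbhd e v :&: V1) W0; have := card_setD_ge ((nbhd e v :&: V1) :\: W0) G.
    by rewrite -setIDA -setIDA; clear; lia.
  move: (sD v) (G8 v) (a8 #|W0| v W0c); rewrite -/D -/G; clear; lia.
- rewrite -/D -/G card_UV -/n.
  have lU : #|leaves t| <= n by rewrite /n -card_UV max_card.
  by move: lU (E8 _ h2) (E8 _ h3) (E8 _ h4) W08 Yc card_V1 cG; clear; lia.
- exact: xP.
Qed.

(** [K = 8 * (2 * a) * (8 * E)] is the loss in [sparse_hitting_subset] for pairs, so [bq] is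
    [n %/ K]. With [b = 4 * K] the averaging condition holds because the forbidden candidates are
    fewer than a quarter of [bq]. [K2] pays for [s + 2 * lam.+1] halvings, enough since
    [n < 4 ^ lam.+1]. *)
Lemma spread_case_numeric (E K b K1 K2 Mb : nat) (r : U) :
  (forall x, #|leaf_parents_at t x| <= K1) ->
  0 < E -> n <= #|leaves t| * E -> a <= E -> K = 128 * a * E -> b = 4 * K ->
  K2 = b * (s + 2 * lam.+1) -> n < 4 ^ lam.+1 ->
  (forall A : V -> {set V}, (forall v, n <= #|A v| * a) -> exists Z : {set V},
     #|Z| * (8 * E) <= n /\ (forall v, n <= #|A v :&: Z| * (8 * a * (8 * E)))) ->
  (forall (J : {set V * V}) (A : V * V -> {set V}),
     (forall v, v \in J -> n <= #|A v| * (2 * a)) -> exists Z : {set V},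
     #|Z| * (8 * E) <= n /\ (forall v, v \in J -> n <= #|A v :&: Z| * (8 * (2 * a) * (8 * E)))) ->
  s * D * (128 * a * E) <= n -> 500 * N * (8 * E) <= n -> (2 * s * D + D) * (8 * E) <= n ->
  (3 * s + 2 * (25 * s + 51)) * (8 * E) <= n ->
  (K1 + K2).+1 * D * (8 * E) <= n ->
  Mb = K1 + K2 -> 4 * K * (1 + 2 * Mb + Mb * (lam * lam) + 1) <= n ->
  contains_copy e t.
Proof.
move=> spread E0 nE aE KE bE K2E n4 hit1 hit2 h1 h2 h3 h4 h5 ME h6.
have [esym eirr] := eg; have [[tsym tirr] _ _] := tt.
have [par [dep rt]] := tree_rooted r tt.
have E8 x' : x' * (8 * E) <= n -> x' * 8 <= #|leaves t| by move=> h; apply: scaled_le h nE.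
have a8 x' v : x' * (8 * E) <= n -> x' * 8 <= #|nbhd e v :&: V1|.
  move=> h; apply: (scaled_le a0 _ (degV1 v)); apply: leq_trans h.
  by rewrite !leq_mul2l aE !orbT.
have l8 : 8 <= #|leaves t|.
  by have := E8 _ h4; move: s25; clear; lia.
have [W0' [W0'c W0'h]] := hit1 (fun v => nbhd e v :&: V1) degV1.
have [||W0 [W0s W0c W0h]] := @hitting_in V V (fun v => nbhd e v :&: V1) [set: V] V1 a (8 * E).
- by exists W0'; split=> // v _; apply: W0'h.
- by move=> v _; apply: subsetIr.
pose JJ := [set vw : V * V | ~~ ex vw.1 vw.2].
pose AA (vw : V * V) := (nbhd e vw.1 :&: nbhd e vw.2 :&: V1) :\: W0.
have W08 : #|W0| * 8 * a <= n.
  by apply: leq_trans W0c; rewrite -mulnA leq_mul2l leq_mul2l aE !orbT.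
have [|B0 [B0c B0h]] := hit2 JJ AA.
  move=> [v w]; rewrite inE /ex -leqNgt /= => h.
  have := card_setD_ge (nbhd e v :&: nbhd e w :&: V1) W0; rewrite /AA /=.
  move: h W08; move: #|_ :\: _| #|_ :&: V1| #|W0| => x y z; clear; nia.
have [||B [Bs Bc Bh]] := @hitting_in V _ AA JJ (V1 :\: W0) (2 * a) (8 * E).
- by exists B0.
- by move=> vw _; apply/setSD/subsetIr.
pose L := leaves t :\ r.
have cL : #|leaves t| <= #|L|.+1 by rewrite (cardsD1 r (leaves t)) -/L; case: (r \in _); clear; lia.
have Lr l : l \in L -> l != r by rewrite in_setD1 => /andP[].
have parL : #|L| <= #|par @: L| * D.
  apply: (@leq_trans (\sum_(p in par @: L) #|children r par p|)).
    apply: leq_trans (card_bigcup_leq _ _); apply/subset_leq_card/subsetP => l lL.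
    by apply/bigcupP; exists (par l); rewrite ?imset_f // inE (Lr _ lL) eqxx.
  by rewrite -sum_nat_const; apply: leq_sum => p _; apply: card_children rt p.
have [P [Ps Pc]] : exists P : {set U}, P \subset par @: L :\ r /\ #|P| = K1 + K2.
  apply: subset_of_card; rewrite leqNgt; apply/negP => lt.
  have : #|par @: L| <= (K1 + K2).+1.
    by rewrite (cardsD1 r); move: lt; case: (r \in _); clear; lia.
  move=> h; have := leq_mul h (leqnn D); have := E8 _ h5.
  by move: parL cL l8; clear; lia.
have PL p : p \in P -> exists2 l, l \in L & par l = p.
  by move/(subsetP Ps); rewrite in_setD1 => /andP[_ /imsetP[l lL ->]]; exists l.
have Pr p : p \in P -> p != r by move/(subsetP Ps); rewrite in_setD1 => /andP[].
have KK0 : 0 < K by rewrite KE !muln_gt0 a0 E0.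
pose bq := n %/ K.
have W0B : [disjoint W0 & B].
  rewrite -setI_eq0; apply/eqP/setP => v; rewrite in_set0 in_setI; apply/negbTE/negP.
  by case/andP=> vW /(subsetP Bs); rewrite in_setD vW.
have B8 v : #|B| * 8 <= #|nbhd e v :&: V1| by apply: a8.
have sD v : s * D * 8 <= #|nbhd e v :&: V1|.
  apply: a8; apply: leq_trans h3; rewrite leq_mul2r; apply/orP; right; clear; nia.
pose X := par @: P; pose Q := r |: (P :|: X); pose FF := #|Q| + #|P| * (lam * lam).
have FFle : FF.+1 <= 1 + 2 * Mb + Mb * (lam * lam) + 1.
  have : #|Q| <= 1 + 2 * Mb.
    rewrite /Q cardsU1; have [+ _] := leq_card_setU P X.
    have := leq_imset_card par P; rewrite -/X Pc -ME; case: (r \notin _); clear; lia.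
  by rewrite /FF Pc -ME; clear; lia.
have nK : n < bq.+1 * K by apply: ltn_ceil.
have FK : 4 * K * FF.+1 <= n by apply: leq_trans h6; rewrite leq_mul2l FFle orbT.
apply: (@spread_case V U e ex t V1 W0 B s b K1 K2 bq lam r par dep P) => //.
- exact: leq_trans s25.
- exact: subset_trans Bs (subsetDl _ _).
- move=> v; have h := W0h v (in_setT v).
  have p0 : 0 < 8 * a * (8 * E) by rewrite !muln_gt0 a0 E0.
  apply: (@leq_trans #|(nbhd e v :&: V1) :&: W0|).
    rewrite -(leq_pmul2r p0); apply: leq_trans h; apply: leq_trans h1.
    by rewrite -/D leq_mul2l; apply/orP; right; clear; lia.
  by apply/subset_leq_card/setSI/subsetIl.
- move=> v; have : #|nbhd e v :&: V1| <= #|nbhd e v :&: ((V1 :\: W0) :\: B)| + #|W0| + #|B|.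
    have := card_setD_ge (nbhd e v :&: V1) W0; have := card_setD_ge ((nbhd e v :&: V1) :\: W0) B.
    by rewrite -setIDA -setIDA; clear; lia.
  move: (sD v) (B8 v) (a8 #|W0| v W0c); rewrite -/D; clear; lia.
- have Yc : #|V1| <= #|(V1 :\: W0) :\: B| + #|W0| + #|B|.
    have := card_setD_ge V1 W0; have := card_setD_ge (V1 :\: W0) B; clear; lia.
  have := cardsC L; rewrite card_UV -/n -/L -/D.
  move: (E8 _ h2) (E8 _ h3) (E8 _ h4) (E8 _ W0c) (E8 _ Bc) Yc card_V1 cL l8 s25; clear; lia.
- by apply/negP => /Pr; rewrite eqxx.
- move=> x; apply: leq_trans (spread x); apply/subset_leq_card/subsetP => p.
  rewrite in_setI in_children inE => /andP[pP /andP[pr /eqP px]].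
  have [l lL lp] := PL p pP; apply/andP; split.
    by rewrite inE -px tsym; apply: (edge_par rt).
  apply/existsP; exists l; move: (lL); rewrite in_setD1 => /andP[lr ->] /=.
  by rewrite -lp tsym (edge_par rt).
- by move=> v w; rewrite /ex [nbhd e v :&: _]setIC.
- move=> v w nw; have h := Bh (v, w); rewrite inE nw in h.
  apply: (@leq_trans #|AA (v, w) :&: B|); last by apply/subset_leq_card/setSI;
    apply: subset_trans (subsetDl _ _) (subsetIl _ _).
  rewrite /bq -(leq_pmul2r KK0); apply: leq_trans (leq_divM _ _) (leq_trans (h isT) _).
  by rewrite KE leq_mul2l; apply/orP; right; clear; lia.
- by rewrite bE; move: KK0; clear; lia.
- by rewrite -/FF; move: nK FK KK0; clear; nia.
- by rewrite -/FF -/n bE; move: nK FK KK0; clear; nia.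
- have b1 : 1 < b by rewrite bE; move: KK0; clear; lia.
  have := two_le_pow b1; rewrite K2E !expnM -/n => h.
  have h' : (2 * b.-1 ^ b) ^ (s + 2 * lam.+1) <= (b ^ b) ^ (s + 2 * lam.+1) by apply: leq_expn2r.
  apply: leq_trans h'; rewrite [(2 * _) ^ _]expnMn ltn_pmul2r; last first.
    by rewrite !expn_gt0; move: b1; case: (b) => [|[|?]].
  by rewrite expnD expnM mulnC ltn_pmul2l ?expn_gt0.
Qed.

(** [8 * a <= q] limits the number of bare paths to [n / (8 * a)] and [E] limits the part of [F] due
    to leaves, so [F] stays well below the degrees into [V1]. The term [12 * q] secures [3 * N] bare
    paths. *)
Lemma path_case_numeric (q E G : nat) (KK Kgood Kbad : {set {set V}}) (r : U) :
  {in KK, forall K : {set V}, K \subset V2 /\ is_clique e 5 K} ->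
  trivIset KK -> #|KK| = 100 * N -> KK = Kgood :|: Kbad -> [disjoint Kgood & Kbad] ->
  #|Kbad| = N -> (forall v, v \notin cover Kgood -> 40 * N <= deg_in e v V2) ->
  {in Kgood, forall K : {set V}, #|[set K' in Kgood | ~~ has_matching e 3 K K']| <= N} ->
  0 < N -> 495 <= q -> 8 * a <= q -> 0 < E -> 32 * a * q.+2 <= E -> #|leaves t| * E < n ->
  0 < G -> n <= G * N -> N * (8 * a + 12 * q) <= n ->
  (forall A : V -> {set V}, (forall v, n <= #|A v| * a) -> exists Z : {set V},
     #|Z| * (4 * G) <= n /\ (forall v, n <= #|A v :&: Z| * (8 * a * (4 * G)))) ->
  (2 * s * s + 4 * s + 4 * s * q) * (32 * a * G) <= n ->
  16 * a * q.+2 <= n ->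
  contains_copy e t.
Proof.
move=> KKP tKK cKK KKE dKK cKb deg2 Kd N0 q495 qa E0 Eq lE G0 nG Nn hit h1 h2.
have [esym eirr] := eg; have [[tsym tirr] _ _] := tt.
have [par [dep rt]] := tree_rooted r tt.
have q0 : 0 < q by apply: leq_trans q495.
have [H [c [bp cF Fle]]] := bare_path_decomposition tsym rt q0.
set F := ~: interior q H c in cF Fle.
have [Z' [Z'c Z'h]] := hit (fun v => nbhd e v :&: V1) degV1.
have [||Z [Zs Zc Zh]] := @hitting_in V V (fun v => nbhd e v :&: V1) [set: V] V1 a (4 * G).
- by exists Z'; split=> // v _; apply: Z'h.
- by move=> v _; apply: subsetIr.
have Z4 : #|Z| * 4 <= N.
  by rewrite -(leq_pmul2r G0) [N * G]mulnC; apply: leq_trans nG; rewrite -mulnA.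
have Hq : #|H| * (8 * a) <= n.
  by apply: (@leq_trans (#|H| * q)); rewrite ?leq_mul2l ?qa ?orbT // mulnC /n -card_UV -cF leq_addl.
have lq : #|leaves t| * (32 * a * q.+2) <= n.
  by apply: leq_trans (ltnW lE); rewrite leq_mul2l Eq orbT.
have Fa : #|F| * (4 * a) * 2 <= n + n.
  apply: (@leq_trans ((q.+2 * (2 * #|leaves t| + 1) + #|H|) * (4 * a) * 2)).
    by rewrite !leq_mul2r Fle !orbT.
  by move: Hq lq h2; clear; nia.
have Fd v : #|F| * 4 <= #|nbhd e v :&: V1|.
  apply: (scaled_le a0 _ (degV1 v)); move: Fa; clear; lia.
have Nd v : N * 8 <= #|nbhd e v :&: V1|.
  by apply: (scaled_le a0 _ (degV1 v)); apply: leq_trans Nn; rewrite leq_mul2l leq_addr orbT.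
apply: (@path_case V U e t V1 V2 Z s N q KK Kgood Kbad r par dep H c) => //.
- have nq : #|F| * 4 <= n.
    by apply: leq_trans (leq_trans (leq_mul (leqnn _) (leq_pmulr 4 a0)) _) (_ : #|F| * (4 * a) <=
      n) => //; move: Fa; clear; lia.
  have : N * (12 * q) <= n by apply: leq_trans Nn; rewrite leq_mul2l leq_addl orbT.
  move: cF; rewrite card_UV -/n => cF h; rewrite -(leq_pmul2l q0).
  by move: nq cF h; clear; lia.
- move=> v; have h := Zh v (in_setT v).
  have p0 : 0 < 8 * a * (4 * G) by rewrite !muln_gt0 a0 G0.
  apply: (@leq_trans #|(nbhd e v :&: V1) :&: Z|); last by apply/subset_leq_card/setSI/subsetIl.
  rewrite -(leq_pmul2r p0); apply: leq_trans h; apply: leq_trans h1.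
  have -> : 8 * a * (4 * G) = 32 * a * G by clear; lia.
  by rewrite leq_mul2r; apply/orP; right; clear; nia.
- set X := _ + 4 * s * q; have : X * 2 <= N.
    rewrite -(leq_pmul2r G0) [N * G]mulnC; apply: leq_trans nG; apply: leq_trans h1.
    rewrite -/X -mulnA leq_mul2l; apply/orP; right; move: a0; clear; nia.
  by move: Z4; clear; lia.
- move=> v; rewrite setIDA; apply: leq_trans (card_setD_ge _ _).
  by move: (Fd v) (Nd v) Z4; rewrite -/F; clear; lia.
Qed.

End Cases.

(** The theorem in integers, [lam] standing for the floor of [log n]. [E2] and [G'] precede [G]
    because [c] and [gamma'] may not depend on [gamma]; [G] bounds [n / floor(gamma n)], and only
    the threshold [CC] depends on it. *)
Lemma tree_embedding_numeric (a c0 : nat) : 0 < a -> exists E2 G', [/\ 0 < E2, 0 < G' &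
  forall G, 0 < G -> exists CC, forall (V U : finType) (e : rel V) (t : rel U)
    (V1 V2 : {set V}) (s N lam : nat) (xs : V) (Rs Ss : {set V})
    (KK Kgood Kbad : {set {set V}}),
  simple_graph e -> tree t -> #|U| = #|V| ->
  V1 :|: V2 = [set: V] -> [disjoint V1 & V2] -> #|V2| = 500 * N ->
  joined e V1 s -> 25 <= s -> s <= c0 * lam.+1 ->
  (forall v, #|[set w | #|nbhd e v :&: nbhd e w :&: V1| * a < #|V|]| <= lam) ->
  Rs \subset V1 -> Ss \subset V1 -> [disjoint Rs & Ss] -> #|Ss| <= 25 * s + 25 ->
  Ss \subset nbhd e xs -> #|Rs| <= 25 ->
  (exists sv : V -> V,
     {in [set v in Rs | ~~ e xs v], forall v, sv v \in Ss /\ e v (sv v)} /\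
     {in [set v in Rs | ~~ e xs v] &, injective sv}) ->
  (forall w, w \notin Rs :|: Ss -> 2 * s <= deg_in e w Ss) ->
  {in KK, forall K : {set V}, K \subset V2 /\ is_clique e 5 K} ->
  trivIset KK -> #|KK| = 100 * N -> KK = Kgood :|: Kbad -> [disjoint Kgood & Kbad] ->
  #|Kbad| = N -> (forall v, v \notin cover Kgood -> 40 * N <= deg_in e v V2) ->
  {in Kgood, forall K : {set V}, #|[set K' in Kgood | ~~ has_matching e 3 K K']| <= N} ->
  0 < N -> #|V| <= G * N -> N * G' <= #|V| -> #|V| < 4 ^ lam.+1 ->
  max_degree t * lam.+1 * E2 <= #|V| -> CC * lam.+1 ^ 4 <= #|V| ->
  contains_copy e t].
Proof.
(* A row needs [495] vertices, [8 * a] keeps bare paths few, and [n / E] is the border between many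
   and few leaves. *)
move=> a0; pose q := 495 + 8 * a; pose E := 32 * a * q.+2.
pose K := 128 * a * E; pose b := 4 * K; pose M := 25 * c0 + 51 + b * c0 + 2 * b.
have E0 : 0 < E by rewrite !muln_gt0 a0.
have aE : a <= E by rewrite /E mulnAC leq_pmull // muln_gt0.
(* The three terms of the first witness serve [h1], [h3] and the room for [K1 + K2] leaf parents. In
   the second, [4000 * E] serves [h2] and the rest is for the path case. *)
exists (128 * a * E * c0.+1 + 8 * E * (2 * c0 + 1) + 8 * E * M), (4000 * E + (8 * a + 12 * q)).
split.
- rewrite -!addnA addn_gt0; apply/orP; left.
  by rewrite (muln_gt0 (128 * a * E)) (muln_gt0 (128 * a)) E0 muln_gt0 a0.
- by rewrite addn_gt0 (muln_gt0 4000) E0.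
move=> G G0.
have [nA hA] := @sparse_hitting_subset (2 * a) (8 * E) (leq_trans a0 (leq_pmull a (isT : 0 < 2)))
  (leq_trans E0 (leq_pmull E (isT : 0 < 8))).
have [nB hB] := @sparse_hitting_subset a (8 * E) a0 (leq_trans E0 (leq_pmull E (isT : 0 < 8))).
have [nC hC] := @sparse_hitting_subset a (4 * G) a0 (leq_trans G0 (leq_pmull G (isT : 0 < 4))).
(* Coefficients of the lower bounds needed on [n]: [T1], [T2], [T3], [T4] go with the powers 1, 3,
   2, 0 of [L], all covered by the fourth. *)
pose T1 := (53 * c0 + 102) * (8 * E); pose T2 := 4 * K * (2 + 3 * M).
pose T3 := (2 * c0 * c0 + 4 * c0 + 4 * c0 * q) * (32 * a * G); pose T4 := 16 * a * q.+2.
exists (T1 + T2 + T3 + T4 + nA + nB + nC + 2).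
move=> V U e t V1 V2 s N lam xs Rs Ss KK Kgood Kbad eg tt cUV V12 dV cV2 join s25 sc0 exfew
  RV SV dRS cS Sx cR hsv Srich KKP tKK cKK KKE dKK cKb deg2 Kd N0 nG NG n4 DE2 big.
set L := lam.+1 in sc0 n4 DE2 big; set n := #|V| in nG NG n4 DE2 big; set D := max_degree t in DE2.
have L1 : 0 < L by [].
have bigT T : T <= T1 + T2 + T3 + T4 + nA + nB + nC + 2 -> forall k, k <= 4 -> T * L ^ k <= n.
  move=> hT k k4; apply: leq_trans big; apply: leq_mul => //.
  by rewrite leq_pexp2l.
have b1 : T1 * L <= n by rewrite -[L]expn1; apply: bigT => //; clear; lia.
have b2 : T2 * L ^ 3 <= n by apply: bigT => //; clear; lia.
have b3 : T3 * L ^ 2 <= n by apply: bigT => //; clear; lia.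
have b4 : T4 <= n by rewrite -[T4]muln1 -(expn0 L); apply: bigT => //; clear; lia.
have bA : nA <= n by rewrite -[nA]muln1 -(expn0 L); apply: bigT => //; clear; lia.
have bB : nB <= n by rewrite -[nB]muln1 -(expn0 L); apply: bigT => //; clear; lia.
have bC : nC <= n by rewrite -[nC]muln1 -(expn0 L); apply: bigT => //; clear; lia.
have bL : 2 * L <= n by rewrite -[L]expn1; apply: bigT => //; clear; lia.
have lamn : lam < n by move: bL; rewrite /L; clear; lia.
have [r _] : exists r : U, r \in [set: U].
  by apply: card_gt0_ex; rewrite cardsT cUV; apply: leq_ltn_trans lamn.
have Vn : #|[set: V]| <= n ^ 2 by rewrite cardsT -/n -mulnn leq_pmull //; apply: leq_ltn_trans lamn.
have VVn (J : {set V * V}) : #|J| <= n ^ 2.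
  by apply: leq_trans (max_card _) _; rewrite card_prod -/n mulnn.
have sD X : X * c0 <= 128 * a * E * c0.+1 + 8 * E * (2 * c0 + 1) + 8 * E * M -> s * D * X <= n.
  move=> h; apply: leq_trans DE2; apply: (@leq_trans (c0 * L * D * X)).
    by rewrite !leq_mul2r sc0 !orbT.
  have -> : c0 * L * D * X = D * L * (X * c0) by clear; lia.
  by rewrite leq_mul2l h orbT.
have h1 : s * D * (128 * a * E) <= n.
  by apply: sD; rewrite mulnS; clear; lia.
have h2 : 500 * N * (8 * E) <= n.
  by apply: leq_trans NG; rewrite mulnDr; clear; lia.
have h3 : (2 * s * D + D) * (8 * E) <= n.
  apply: leq_trans DE2; apply: (@leq_trans ((2 * (c0 * L) * D + D * L) * (8 * E))).
    rewrite leq_mul2r; apply/orP; right; apply: leq_add; last exact: leq_pmulr.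
    by rewrite leq_mul2r leq_mul2l sc0 !orbT.
  have -> : (2 * (c0 * L) * D + D * L) * (8 * E) = D * L * (8 * E * (2 * c0 + 1)) by clear; nia.
  by rewrite leq_mul2l; apply/orP; right; clear; lia.
have h4 : (3 * s + 2 * (25 * s + 51)) * (8 * E) <= n.
  apply: leq_trans b1; have -> : T1 * L = (53 * c0 + 102) * L * (8 * E) by rewrite /T1; clear; nia.
  by rewrite leq_mul2r; apply/orP; right; move: sc0 L1; clear; nia.
case: (leqP n (#|leaves t| * E)) => leavesE.
  case: (boolP [exists x, #|Ss| + 25 < #|leaf_parents_at t x|]) => [/existsP[x xP]|noP].
    apply: (@star_case_numeric V U e t V1 V2 s N a lam eg tt cUV V12 dV cV2 join s25 a0 exfew
      lamn E xs Rs Ss x) => //.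
    by move=> A Ah; have [|Z [Zc Zh]] := hA V V A [set: V] bA Vn;
      [move=> v _; apply: Ah | exists Z; split=> // v; apply: Zh].
  pose K1 := 25 * s + 50; pose K2 := b * (s + 2 * L).
  have MbM : (K1 + K2).+1 <= M * L.
    rewrite /K1 /K2 /M; have : b * s <= b * (c0 * L) by rewrite leq_mul2l sc0 orbT.
    by move: sc0 L1; clear; nia.
  apply: (@spread_case_numeric V U e t V1 V2 s N a lam eg tt cUV V12 dV cV2 join s25 a0 exfew
    lamn E K b K1 K2 (K1 + K2) r) => //.
  - move=> x; move: noP; rewrite negb_exists => /forallP /(_ x); rewrite -leqNgt.
    by move/leq_trans; apply; rewrite /K1; move: cS; clear; lia.
  - by move=> A Ah; have [|Z [Zc Zh]] := hB V V A [set: V] bB Vn;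
      [move=> v _; apply: Ah | exists Z; split=> // v; apply: Zh].
  - by move=> J A Ah; have [|Z [Zc Zh]] := hA V _ A J bA (VVn J); [exact: Ah | exists Z].
  - apply: leq_trans DE2; apply: (@leq_trans (M * L * D * (8 * E))).
      by rewrite leq_mul2r leq_mul2r MbM !orbT.
    have -> : M * L * D * (8 * E) = D * L * (8 * E * M) by clear; lia.
    by rewrite leq_mul2l; apply/orP; right; clear; lia.
  - apply: leq_trans b2; rewrite /T2 -[X in _ <= X]mulnA leq_mul2l; apply/orP; right.
    have l2 : lam * lam <= L ^ 2 by rewrite -mulnn; apply: leq_mul; apply: leqnSn.
    have h5 := leq_mul (ltnW MbM) l2.
    have e3 : M * L * L ^ 2 = M * L ^ 3 by rewrite -mulnA -expnS.
    have l3 : L <= L ^ 3 by rewrite -{1}[L]expn1 leq_pexp2l.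
    have l0 : 1 <= L ^ 3 by rewrite expn_gt0.
    have h6 : M * L <= M * L ^ 3 by rewrite leq_mul2l l3 orbT.
    by rewrite mulnDl -mulnA; move: h5 h6 e3 l0 MbM; clear; lia.
apply: (@path_case_numeric V U e t V1 V2 s N a lam eg tt cUV V12 dV cV2 join a0 exfew lamn q E G
  KK Kgood Kbad r) => //.
- by rewrite /q leq_addl.
- by apply: leq_trans NG; rewrite leq_mul2l leq_addl orbT.
- by move=> A Ah; have [|Z [Zc Zh]] := hC V V A [set: V] bC Vn;
    [move=> v _; apply: Ah | exists Z; split=> // v; apply: Zh].
- apply: leq_trans b3;
    have -> : T3 * L ^ 2 = (2 * c0 * c0 + 4 * c0 + 4 * c0 * q) * L ^ 2 * (32 * a * G).
    by rewrite /T3; clear; nia.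
  rewrite leq_mul2r; apply/orP; right.
  have s2 := leq_mul sc0 sc0; have e2 : c0 * L * (c0 * L) = c0 * c0 * L ^ 2 by rewrite -mulnn;
    clear; nia.
  have l2 : L <= L ^ 2 by rewrite -mulnn leq_pmull.
  have h5 : s <= c0 * L ^ 2 by apply: leq_trans sc0 _; rewrite leq_mul2l l2 orbT.
  have h6 : s * q <= c0 * L ^ 2 * q by rewrite leq_mul2r h5 orbT.
  by move: s2 e2 h5 h6; clear; nia.
Qed.

Import Order.TTheory GRing.Theory Num.Theory.
Local Open Scope ring_scope.

(** * Integer bounds for the logarithm *)

Section LogBounds.
Variable R : realType.
Implicit Type n : nat.

Lemma expR1_ge2 : (2 : R) <= expR 1.
Proof. by have := expR_ge1Dx (1 : R); lra. Qed.

(** Square the inequality [exp(-1/2) >= 1 - 1/2]. *)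
Lemma expR1_le4 : expR 1 <= (4 : R).
Proof.
have h : (2^-1 : R) <= expR (- 2^-1) by have := expR_ge1Dx (- 2^-1 : R); lra.
have e : expR (1 : R) * (expR (- 2^-1) * expR (- 2^-1)) = 1.
  by rewrite -!expRD (_ : 1 + _ = 0 :> R) ?expR0 //; lra.
have p := expR_gt0 (1 : R); have p2 := expR_gt0 (- 2^-1 : R).
have : 2^-1 * 2^-1 <= expR (- 2^-1) * expR (- 2^-1) :> R.
  by apply: ler_pM; rewrite ?invr_ge0.
move=> h2; have : expR 1 * (2^-1 * 2^-1) <= 1 :> R by rewrite -[leRHS]e ler_pM2l.
lra.
Qed.

Lemma lt_pow4_ln n : (0 < n)%N -> (n < 4 ^ (Num.truncn (ln n%:R : R)).+1)%N.
Proof.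
move=> n0; rewrite -(ltr_nat R) natrX.
have n0' : (0 : R) < n%:R by rewrite ltr0n.
rewrite -[ltLHS]lnK //; apply: (@lt_le_trans _ _ (expR ((Num.truncn (ln n%:R : R)).+1%:R * 1))).
  by rewrite mulr1 ltr_expR truncnS_gt.
by rewrite expRM_natl lerXn2r ?nnegrE ?expR_ge0 ?expR1_le4.
Qed.

Lemma pow2_ln_le n : (0 < n)%N -> (2 ^ Num.truncn (ln n%:R : R) <= n)%N.
Proof.
move=> n0; rewrite -(ler_nat R) natrX.
have n0' : (0 : R) < n%:R by rewrite ltr0n.
rewrite -[leRHS]lnK //; apply: (@le_trans _ _ (expR ((Num.truncn (ln n%:R : R))%:R * 1))).
  by rewrite expRM_natl lerXn2r ?nnegrE ?expR_ge0 ?expR1_ge2.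
by rewrite mulr1 ler_expR truncn_le ln_ge0 // ler1n.
Qed.

(** With [x] half of [k], [n >= 2 ^ k >= (2 ^ x) ^ 2]; squaring the quadratic bound on [2 ^ x] gives
    the fourth power. Small [k] is covered by the choice of [n0]. *)
Lemma ln_pow4_small (c : nat) : exists n0, forall n, (n0 <= n)%N ->
  (c * (Num.truncn (ln n%:R : R)).+1 ^ 4 <= n)%N.
Proof.
have [x0 hx0] := square_lt_exp2 (4 * c.+1).
exists (c * (2 * x0).+2 ^ 4).+1 => n n0n.
have n0 : (0 < n)%N by apply: leq_ltn_trans n0n.
have := pow2_ln_le n0; set k := Num.truncn _ => kn.
case: (leqP k (2 * x0).+1) => kx.
  by apply: leq_trans (ltnW n0n); rewrite leq_mul2l leq_exp2r // ltnS kx orbT.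
pose x := (k %/ 2)%N; have xk : (2 * x <= k < 2 * x + 2)%N by rewrite /x; lia.
have x0x : (x0 <= x)%N by lia.
apply: leq_trans kn.
apply: (@leq_trans ((2 ^ x) ^ 2)); last by rewrite -expnM leq_pexp2l //; lia.
apply: (@leq_trans ((4 * c.+1 * x.+1 ^ 2) ^ 2)); last by rewrite leq_exp2r // ltnW // hx0.
have h : (k.+1 ^ 4 <= (2 * x.+1) ^ 4)%N by rewrite leq_exp2r //; lia.
rewrite expnMn -expnM [(_ * _ ^ 4)%N]mulnC.
have : (16 * c <= (4 * c.+1) ^ 2)%N by rewrite -mulnn; nia.
by move: h; rewrite expnMn -[(2 ^ 4)%N]/16%N -[(2 * 2)%N]/4%N; nia.
Qed.

End LogBounds.

(* [Num.truncn x : nat] is the floor of [x] for [0 <= x]. *)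
Theorem theorem3p1 (R : realType) (alpha C0 : R) :
  0 < alpha < 1 -> 0 < C0 ->
  exists gamma' c : R, [/\ 0 < gamma', 0 < c &
  forall gamma : R, 0 < gamma < gamma' ->
  exists n0 : nat, forall n : nat, (n0 <= n)%N ->
  forall (V : finType) (e : rel V), simple_graph e -> #|V| = n ->
  forall V1 V2 : {set V},
    V1 :|: V2 = [set: V] -> [disjoint V1 & V2] ->
    #|V2| = (500 * Num.truncn (gamma * n%:R)%R)%N ->
  forall (xs : V) (Rs Ss : {set V}),
    Rs \subset V1 -> Ss \subset V1 -> [disjoint Rs & Ss] ->
    #|Ss| = Num.truncn (25 * C0 * ln n%:R) -> Ss \subset nbhd e xs ->
    (#|Rs| <= 25)%N ->
    (exists s : V -> V,
       {in [set v in Rs | ~~ e xs v], forall v, s v \in Ss /\ e v (s v)} /\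
       {in [set v in Rs | ~~ e xs v] &, injective s}) ->
    (forall w : V, w \notin Rs :|: Ss ->
       2 * C0 * ln n%:R <= (deg_in e w Ss)%:R) ->
    (forall v : V,
       #|[set w : V | #|nbhd e v :&: nbhd e w :&: V1|%:R < alpha * n%:R]|%:R
         <= ln n%:R :> R) ->
    (forall A B : {set V}, A \subset V1 -> [disjoint A & B] ->
       #|A| = Num.truncn (C0 * ln n%:R) ->
       #|B| = Num.truncn (C0 * ln n%:R) ->
       exists a b : V, [/\ a \in A, b \in B & e a b]) ->
  forall KK Kgood Kbad : {set {set V}},
    {in KK, forall K : {set V}, K \subset V2 /\ is_clique e 5 K} ->
    trivIset KK ->
    #|KK| = (100 * Num.truncn (gamma * n%:R)%R)%N ->
    KK = Kgood :|: Kbad -> [disjoint Kgood & Kbad] ->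
    #|Kbad| = Num.truncn (gamma * n%:R) ->
    (forall v : V, v \notin cover Kgood ->
       (40 * Num.truncn (gamma * n%:R)%R <= deg_in e v V2)%N) ->
    {in Kgood, forall K : {set V},
       #|[set K' in Kgood | ~~ has_matching e 3 K K']|%:R <= gamma * n%:R} ->
  forall (U : finType) (t : rel U), tree t -> #|U| = n ->
    (max_degree t)%:R <= c * n%:R / ln n%:R ->
    contains_copy e t].
Proof.
move=> /andP[al0 al1] C00.
pose a := (Num.truncn alpha^-1).+1.
have a1 : 1 < alpha * a%:R.
  by rewrite mulrC -ltr_pdivrMr // div1r truncnS_gt.
pose c0 := (Num.truncn C0).+1.
have C0c : C0 <= c0%:R by rewrite ltW // truncnS_gt.
have [E2 [G' [E20 G'0 core]]] := @tree_embedding_numeric a c0 isT.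
have E2p : 0 < E2%:R :> R by rewrite ltr0n.
have G'p : 0 < G'%:R :> R by rewrite ltr0n.
(* The factor 2 in [c] absorbs [lam.+1 <= 2 * ln n]. *)
exists (G'%:R^-1), ((2 * E2%:R)^-1); split; rewrite ?invr_gt0 ?mulr_gt0 //.
move=> gamma /andP[g0 gG].
(* Twice [1 / gamma], so that [n <= G * N] survives the rounding in [N]. *)
pose G := (Num.truncn (2 / gamma)).+1.
have Gg : 2 < G%:R * gamma by rewrite -ltr_pdivrMr // truncnS_gt.
have [CC hCC] := core G isT.
have [nA hA] := ln_pow4_small R CC.
(* [nB] and [nC] give [C0 * ln n >= 25] and [ln n >= 1]; the summand [G] in the threshold gives
   [gamma * n > 2]. *)
pose nB := (Num.truncn (expR (25 / C0))).+1.
pose nC := (Num.truncn (expR (1 : R))).+1.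
exists (nA + nB + nC + G)%N => n hn V e eg cV; subst n.
set n := #|V| in hn *.
move=> V1 V2 V12 dV cV2 xs Rs Ss RV SV dRS cS Sx cR hsv Srich few jn.
move=> KK Kgood Kbad KKP tKK cKK KKE dKK cKb deg2 Kd U t tt cU Dle.
have n0 : (0 < n)%N by apply: leq_trans hn; rewrite addnS.
have np : 0 < n%:R :> R by rewrite ltr0n.
set l := ln n%:R : R in cS Srich few jn Dle.
have l_ge x : (Num.truncn (expR x) < n)%N -> x <= l.
  move=> h; rewrite -ler_expR lnK //; apply/ltW; apply: lt_le_trans (truncnS_gt _) _.
  by rewrite ler_nat.
have nBn : (nB <= n)%N by move: hn; clear; lia.
have nCn : (nC <= n)%N by move: hn; clear; lia.
have l1 : 1 <= l by apply: l_ge.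
have lC : 25 <= C0 * l.
  by rewrite mulrC -ler_pdivrMr // l_ge.
have l0 : 0 <= l by apply: le_trans l1.
set s := Num.truncn (C0 * l) in jn; set N := Num.truncn (gamma * n%:R) in cV2 cKK cKb deg2.
set lam := Num.truncn l.
have sle : s%:R <= C0 * l by rewrite truncn_le mulr_ge0 // ltW.
have slt : C0 * l < s.+1%:R by apply: truncnS_gt.
have laml : l < lam.+1%:R by apply: truncnS_gt.
have laml' : lam%:R <= l by rewrite truncn_le.
have gn2 : 2 < gamma * n%:R.
  apply: lt_le_trans Gg _; rewrite mulrC ler_pM2l // ler_nat; move: hn; clear; lia.
have Nle : N%:R <= gamma * n%:R by rewrite truncn_le mulr_ge0 // ltW.
have Nlt : gamma * n%:R < N.+1%:R by apply: truncnS_gt.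
apply: (hCC V U e t V1 V2 s N lam xs Rs Ss KK Kgood Kbad) => //.
- move=> A B AV sA sB dAB.
  have [A' [A'A cA']] := subset_of_card sA; have [B' [B'B cB']] := subset_of_card sB.
  have [||||x [y [xA yB exy]]] := jn A' B' => //.
  + exact: subset_trans AV.
  + exact: disjointWl A'A (disjointWr B'B dAB).
  + by exists x, y; split=> //; [apply: (subsetP A'A)|apply: (subsetP B'B)].
- by rewrite truncn_ge_nat // (le_trans _ lC).
- rewrite -(ler_nat R) natrM; apply: le_trans sle _.
  by apply: ler_pM => //; apply: ltW.
- move=> v; rewrite truncn_ge_nat //; apply: le_trans (few v); rewrite ler_nat.
  apply/subset_leq_card/subsetP => w; rewrite !inE -(ltr_nat R) natrM => h.
  have a0 : 0 < a%:R :> R by rewrite ltr0n.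
  rewrite -(ltr_pM2r a0); apply: lt_le_trans h _.
  by rewrite mulrAC ler_peMl ?ler0n // ltW.
- rewrite cS -ltnS truncn_lt_nat; last by rewrite !mulr_ge0 // ltW.
  rewrite -mulrA; have : (25 * s + 25).+1%:R = 25 * s.+1%:R + 1 :> R by rewrite -!natr1 natrD
    natrM; ring.
  by move=> ->; lra.
- move=> w wRS; rewrite -(ler_nat R); apply: le_trans (Srich w wRS).
  by rewrite natrM -mulrA ler_pM2l.
- by move=> K KG; rewrite truncn_ge_nat ?Kd // mulr_ge0 // ltW.
- by rewrite truncn_gt0; lra.
- rewrite -(ler_nat R) natrM -/n; rewrite -natr1 in Nlt.
  have hN : gamma * n%:R <= 2 * N%:R by lra.
  rewrite -(ler_pM2l g0); apply: le_trans hN _; rewrite mulrA [gamma * _]mulrC.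
  by rewrite ler_wpM2r ?ler0n // ltW.
- rewrite -(ler_nat R) natrM -/n -ler_pdivlMr //; apply: le_trans Nle _.
  by rewrite mulrC ler_pM2l // ltW.
- exact: lt_pow4_ln.
- rewrite -(ler_nat R) !natrM -/n.
  have lp : 0 < l by apply: lt_le_trans l1.
  have h : (max_degree t)%:R * l * (2 * E2%:R) <= n%:R.
    rewrite -ler_pdivlMr ?mulr_gt0 // -ler_pdivlMr //.
    by apply: le_trans Dle _; rewrite [_ * n%:R]mulrC.
  have h2 : lam.+1%:R <= 2 * l by rewrite -natr1; lra.
  apply: le_trans h; rewrite -!mulrA ler_wpM2l ?ler0n //.
  by rewrite mulrA [l * 2]mulrC ler_wpM2r ?ler0n.
- by apply: hA; move: hn; clear; lia.
Qed.
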